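(* Let $H$ be a complex Hilbert space, let $T$ be a bounded linear operator on $H$, and let $\Omega\subset\mathbb{C}$ be a bounded open set containing the spectrum of $T$. Suppose that, for each $f\in A(\Omega)$, there exists $g\in A(\Omega)$ such that \[ \|g\|_\Omega\le\|f\|_\Omega \quad\text{and}\quad \|f(T)+g(T)^*\|\le 2\|f\|_\Omega . \] Then \[ \|f(T)\|\le(1+\sqrt{2})\,\|f\|_\Omega \quad\text{for all } f\in A(\Omega). \]
   Context: For a bounded open set $\Omega\subset\mathbb{C}$, $A(\Omega)$ denotes the algebra of continuous functions $f:\overline{\Omega}\to\mathbb{C}$ that are holomorphic on $\Omega$, and $\|f\|_\Omega:=\sup_{z\in\Omega}|f(z)|$. ($\Omega$ is not assumed connected.) For $f\in A(\Omega)$ and a bounded operator $T$ on $H$ with spectrum contained in $\Omega$, $f(T)$ is defined by the holomorphic functional calculus (Cauchy integral $\frac{1}{2\pi i}\int f(\zeta)(\zeta I-T)^{-1}\,d\zeta$ over a cycle in $\Omega$ surrounding the spectrum of $T$). $\|\cdot\|$ on operators is the operator norm and $^*$ denotes the Hilbert-space adjoint. *)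

(* Defs.v *)
From Stdlib Require Import Reals Lra List.
From Stdlib Require Import ClassicalEpsilon FunctionalExtensionality.
From Stdlib Require Import PropExtensionality ProofIrrelevance.
From Coquelicot Require Import Coquelicot.

Open Scope R_scope.

(* Inverses, adjoints and contours are total functions, in the manner of
   Coquelicot's [RInt]; the default [d] is only reached when no object with the
   property [P] exists. *)
Definition choose_or {A : Type} (d : A) (P : A -> Prop) : A :=
  match excluded_middle_informative (exists x, P x) with
  | left h => proj1_sig (constructive_indefinite_description P h)
  | right _ => d
  end.

Lemma choose_or_spec {A : Type} (d : A) (P : A -> Prop) :
  (exists x, P x) -> P (choose_or d P).
Proof.
intros h; unfold choose_or.
destruct (excluded_middle_informative _) as [h'|n]; [|now destruct n].
exact (proj2_sig (constructive_indefinite_description P h')).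
Qed.

(* The supremum of a set of nonnegative reals.  [real] sends the supremum
   [m_infty] of the empty set to 0; it also sends [p_infty] to 0, but the
   definition is only used on bounded sets. *)
Definition sup (E : R -> Prop) : R := real (Lub_Rbar E).

Lemma sup_ub (E : R -> Prop) (M : R) :
  (forall r, E r -> r <= M) -> forall r, E r -> r <= sup E.
Proof.
intros HM r Hr; unfold sup.
destruct (Lub_Rbar_correct E) as [ub lub].
assert (h1 := ub r Hr).
assert (h2 := lub (Finite M) (fun x Hx => HM x Hx)).
now destruct (Lub_Rbar E).
Qed.

Lemma sup_le (E : R -> Prop) (M : R) :
  0 <= M -> (forall r, E r -> r <= M) -> sup E <= M.
Proof.
intros H0 HM; unfold sup.
assert (h := proj2 (Lub_Rbar_correct E) (Finite M) (fun x Hx => HM x Hx)).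
now destruct (Lub_Rbar E).
Qed.

Lemma minus_plus_plus {G : AbelianGroup} (a b c d : G) :
  minus (plus a b) (plus c d) = plus (minus a c) (minus b d).
Proof.
unfold minus; rewrite opp_plus, <- !plus_assoc; f_equal.
rewrite !plus_assoc; f_equal; apply plus_comm.
Qed.

(** * Bounded operators on a complex Banach space *)

(* Coquelicot's [is_linear] includes boundedness. *)
Record operator (E : CompleteNormedModule C_AbsRing) := Operator {
  op_fun :> E -> E;
  op_linear : is_linear op_fun }.
Arguments Operator {E}.
Arguments op_fun {E}.
Arguments op_linear {E}.

Definition opnorm {E : CompleteNormedModule C_AbsRing} (A : operator E) : R :=
  sup (fun r => exists x : E, norm x <= 1 /\ r = norm (A x)).

Section OperatorSpace.

Context {E : CompleteNormedModule C_AbsRing}.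
Implicit Types A B : operator E.

Lemma operator_eq A B : (forall x, A x = B x) -> A = B.
Proof.
destruct A as [a la], B as [b lb]; simpl; intros h.
assert (e : a = b) by now apply functional_extensionality.
subst b; f_equal; apply proof_irrelevance.
Qed.

Lemma opnorm_bounded A :
  exists M, forall r, (exists x : E, norm x <= 1 /\ r = norm (A x)) -> r <= M.
Proof.
destruct (linear_norm _ (op_linear A)) as [M [M0 HM]].
exists M; intros r [x [Hx ->]].
apply Rle_trans with (1 := HM x).
rewrite <- (Rmult_1_r M) at 2; apply Rmult_le_compat_l; lra.
Qed.

Lemma opnorm_unit A (x : E) : norm x <= 1 -> norm (A x) <= opnorm A.
Proof.
intros Hx; destruct (opnorm_bounded A) as [M HM].
apply (sup_ub _ M HM); now exists x.
Qed.

Lemma norm_zero_le (r : R) : 0 <= r -> norm (zero : E) <= r.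
Proof. intros h; apply Rle_trans with (2 := h); right; exact (@norm_zero _ E). Qed.

Lemma opnorm_ge0 A : 0 <= opnorm A.
Proof.
apply Rle_trans with (norm (A zero)); [apply norm_ge_0|].
apply opnorm_unit, norm_zero_le; lra.
Qed.

Lemma norm_scal_RtoC (r : R) (x : E) :
  norm (scal (RtoC r : C_AbsRing) x) <= Rabs r * norm x.
Proof. rewrite <- (Cmod_R r); exact (norm_scal (RtoC r : C_AbsRing) x). Qed.

Lemma opnorm_ub A (x : E) : norm (A x) <= opnorm A * norm x.
Proof.
destruct (Req_dec (norm x) 0) as [x0|x0].
  rewrite x0, Rmult_0_r, (norm_eq_zero x x0).
  rewrite (linear_zero _ (op_linear A)); apply norm_zero_le; lra.
assert (px : 0 < norm x) by (assert (h := norm_ge_0 x); lra).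
set (u := scal (RtoC (/ norm x) : C_AbsRing) x).
assert (nu : norm u <= 1).
  apply Rle_trans with (1 := norm_scal_RtoC _ _).
  rewrite Rabs_pos_eq; [|left; now apply Rinv_0_lt_compat].
  right; now apply Rinv_l.
assert (e : x = scal (RtoC (norm x) : C_AbsRing) u).
  unfold u; rewrite scal_assoc.
  change (mult (RtoC (norm x) : C_AbsRing) (RtoC (/ norm x)))
    with (Cmult (RtoC (norm x)) (RtoC (/ norm x))).
  rewrite <- RtoC_mult, Rinv_r; [|exact x0].
  symmetry; exact (scal_one x).
rewrite e at 1; rewrite (linear_scal _ (op_linear A)).
apply Rle_trans with (1 := norm_scal_RtoC _ _).
rewrite Rabs_pos_eq; [|lra].
rewrite Rmult_comm; apply Rmult_le_compat_r; [lra|now apply opnorm_unit].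
Qed.

Lemma opnorm_le A (M : R) :
  0 <= M -> (forall x, norm (A x) <= M * norm x) -> opnorm A <= M.
Proof.
intros M0 HM; apply sup_le; [exact M0|].
intros r [x [Hx ->]]; apply Rle_trans with (1 := HM x).
rewrite <- (Rmult_1_r M) at 2; now apply Rmult_le_compat_l.
Qed.

Lemma op_plus_linear A B : is_linear (fun x => plus (A x) (B x)).
Proof.
apply (is_linear_comp (fun x => (A x, B x)) (fun t => plus (fst t) (snd t))).
- apply is_linear_prod; apply op_linear.
- apply is_linear_plus.
Qed.

Definition op_plus A B : operator E := Operator _ (op_plus_linear A B).

Definition op_zero : operator E := Operator _ is_linear_zero.

Definition op_opp A : operator E :=
  Operator (fun x => opp (A x)) (is_linear_comp _ _ (op_linear A) is_linear_opp).

Definition op_scal (c : C) A : operator E :=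
  Operator (fun x => scal (c : C_AbsRing) (A x))
    (is_linear_comp _ _ (op_linear A) (is_linear_scal_r (c : C_AbsRing) Cmult_comm)).

Definition op_one : operator E := Operator _ is_linear_id.

Definition op_comp A B : operator E :=
  Operator (fun x => A (B x)) (is_linear_comp _ _ (op_linear B) (op_linear A)).

Definition operator_AbelianMonoid_mixin : AbelianMonoid.mixin_of (operator E).
Proof.
apply (AbelianMonoid.Mixin _ op_plus op_zero).
- intros A B; apply operator_eq; intros x; apply plus_comm.
- intros A B D; apply operator_eq; intros x; apply plus_assoc.
- intros A; apply operator_eq; intros x; apply plus_zero_r.
Defined.

Canonical operator_AbelianMonoid :=
  AbelianMonoid.Pack (operator E) operator_AbelianMonoid_mixin (operator E).

Definition operator_AbelianGroup_mixin :
  AbelianGroup.mixin_of operator_AbelianMonoid.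
Proof.
apply (AbelianGroup.Mixin operator_AbelianMonoid op_opp).
intros A; apply operator_eq; intros x; apply (plus_opp_r (A x)).
Defined.

Canonical operator_AbelianGroup :=
  AbelianGroup.Pack (operator E) (AbelianGroup.Class _ _ operator_AbelianGroup_mixin)
    (operator E).

(* The real module structure is the one [RInt] needs. *)
Definition operator_ModuleSpace_mixin :
  ModuleSpace.mixin_of R_Ring operator_AbelianGroup.
Proof.
apply (ModuleSpace.Mixin R_Ring operator_AbelianGroup
         (fun (r : R) A => op_scal (RtoC r) A)).
- intros x y u; apply operator_eq; intros v; simpl.
  rewrite scal_assoc; f_equal; symmetry; apply (RtoC_mult x y).
- intros u; apply operator_eq; intros v; exact (scal_one (u v)).
- intros x u v; apply operator_eq; intros w.
  exact (scal_distr_l (RtoC x : C_AbsRing) (u w) (v w)).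
- intros x y u; apply operator_eq; intros v; simpl.
  change (plus x y) with (x + y); rewrite RtoC_plus.
  exact (scal_distr_r (RtoC x : C_AbsRing) (RtoC y) (u v)).
Defined.

Canonical operator_ModuleSpace :=
  ModuleSpace.Pack R_Ring (operator E)
    (ModuleSpace.Class _ _ _ operator_ModuleSpace_mixin) (operator E).

Lemma opnorm_plus A B : opnorm (plus A B) <= opnorm A + opnorm B.
Proof.
apply opnorm_le; [apply Rplus_le_le_0_compat; apply opnorm_ge0|].
intros x; apply Rle_trans with (norm (A x) + norm (B x)).
  exact (norm_triangle (A x) (B x)).
rewrite Rmult_plus_distr_r; apply Rplus_le_compat; apply opnorm_ub.
Qed.

Lemma opnorm_scal (r : R) A : opnorm (scal r A) <= Rabs r * opnorm A.
Proof.
apply opnorm_le.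
  apply Rmult_le_pos; [apply Rabs_pos|apply opnorm_ge0].
intros x; apply Rle_trans with (1 := norm_scal_RtoC r (A x)).
rewrite Rmult_assoc; apply Rmult_le_compat_l; [apply Rabs_pos|apply opnorm_ub].
Qed.

Lemma opnorm_eq0 A : opnorm A = 0 -> A = zero.
Proof.
intros h; apply operator_eq; intros x; apply norm_eq_zero.
assert (h1 := opnorm_ub A x); rewrite h in h1.
assert (h2 := norm_ge_0 (A x)); lra.
Qed.

Lemma opnorm_zero : opnorm (zero : operator E) = 0.
Proof.
apply Rle_antisym; [|apply opnorm_ge0].
apply opnorm_le; [lra|]; intros x.
rewrite Rmult_0_l; apply norm_zero_le; lra.
Qed.

Lemma opnorm_opp A : opnorm (opp A) = opnorm A.
Proof.
assert (le : forall B, opnorm (opp B) <= opnorm B).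
  intros B; apply opnorm_le; [apply opnorm_ge0|]; intros x.
  apply Rle_trans with (2 := opnorm_ub B x); right; exact (norm_opp (B x)).
apply Rle_antisym; [apply le|].
apply Rle_trans with (2 := le (opp A)); right; f_equal.
symmetry; apply (opp_opp A).
Qed.

Definition operator_UniformSpace_mixin : UniformSpace.mixin_of (operator E).
Proof.
apply (UniformSpace.Mixin _ op_zero (fun A e B => opnorm (minus B A) < e)).
- intros A e; apply Rle_lt_trans with 0; [right|apply cond_pos].
  rewrite minus_eq_zero; exact opnorm_zero.
- intros A B e; rewrite <- (opp_minus B A).
  intros h; apply Rle_lt_trans with (2 := h); right.
  exact (opnorm_opp (minus B A)).
- intros A B D e1 e2 h1 h2.
  apply Rle_lt_trans with (opnorm (minus D B) + opnorm (minus B A)); [|lra].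
  rewrite (minus_trans B D A); apply opnorm_plus.
Defined.

Canonical operator_UniformSpace :=
  UniformSpace.Pack (operator E) operator_UniformSpace_mixin (operator E).

Canonical operator_NormedModuleAux :=
  NormedModuleAux.Pack R_AbsRing (operator E)
    (NormedModuleAux.Class R_AbsRing (operator E)
       (ModuleSpace.class R_Ring operator_ModuleSpace)
       (UniformSpace.class operator_UniformSpace)) (operator E).

Definition operator_NormedModule_mixin :
  NormedModule.mixin_of R_AbsRing operator_NormedModuleAux.
Proof.
apply (NormedModule.Mixin R_AbsRing operator_NormedModuleAux opnorm 1).
- exact opnorm_plus.
- exact opnorm_scal.
- intros A B e h; exact h.
- intros A B e h; rewrite Rmult_1_l; exact h.
- exact opnorm_eq0.
Defined.

Canonical operator_NormedModule :=
  NormedModule.Pack R_AbsRing (operator E)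
    (NormedModule.Class R_AbsRing (operator E) _ operator_NormedModule_mixin)
    (operator E).

Definition pointwise_lim (F : (operator E -> Prop) -> Prop) (x : E) : E :=
  lim (filtermap (fun A => A x) F).

Lemma pointwise_lim_spec (F : (operator E -> Prop) -> Prop) :
  ProperFilter F -> cauchy F -> forall x (eps : posreal),
  F (fun A => norm (minus (A x) (pointwise_lim F x)) < eps).
Proof.
intros PF cF x eps.
set (k := @norm_factor _ E).
assert (k0 : 0 < k) by apply norm_factor_gt_0.
assert (p : 0 < eps / k) by (apply Rdiv_lt_0_compat; [apply cond_pos|exact k0]).
assert (h : filtermap (fun A => A x) F (ball (pointwise_lim F x) (mkposreal _ p))).
  refine (complete_cauchy (T := E) (filtermap (fun A : operator E => A x) F) _ _ _).
  intros e.
  assert (n0 : 0 < norm x + 1) by (assert (h := norm_ge_0 x); lra).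
  assert (q : 0 < e / (norm x + 1)) by (apply Rdiv_lt_0_compat; [apply cond_pos|exact n0]).
  destruct (cF (mkposreal _ q)) as [A HA].
  exists (A x); unfold filtermap; revert HA; apply filter_imp; intros B HB.
  apply (norm_compat1 (V := E)).
  apply Rle_lt_trans with (opnorm (minus B A) * norm x); [exact (opnorm_ub (minus B A) x)|].
  change (opnorm (minus B A) < e / (norm x + 1)) in HB.
  apply Rle_lt_trans with (e / (norm x + 1) * norm x).
    apply Rmult_le_compat_r; [apply norm_ge_0|lra].
  replace (pos e) with (e / (norm x + 1) * (norm x + 1)) at 2 by (field; lra).
  apply Rmult_lt_compat_l; [exact q|lra].
revert h; unfold filtermap; apply filter_imp; intros A HA.
apply (norm_compat2 (V := E)) in HA; simpl in HA; fold k in HA.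
replace (k * (eps / k)) with (pos eps) in HA by (field; lra); exact HA.
Qed.

Lemma norm_le_small (x : E) (M : R) :
  (forall eps : posreal, norm x <= M + eps) -> norm x <= M.
Proof. intros h; apply le_epsilon; intros e He; exact (h (mkposreal e He)). Qed.

Lemma norm_minus_sym (x y : E) : norm (minus x y) = norm (minus y x).
Proof. rewrite <- (opp_minus y x); exact (norm_opp (minus y x)). Qed.

Lemma norm_plus_le (x y : E) : norm (plus x y) <= norm x + norm y.
Proof. exact (norm_triangle x y). Qed.

Lemma norm_minus_trans (y x z : E) :
  norm (minus x z) <= norm (minus x y) + norm (minus y z).
Proof.
rewrite (minus_trans y x z); exact (norm_plus_le (minus x y) (minus y z)).
Qed.

Lemma pointwise_lim_near (F : (operator E -> Prop) -> Prop) :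
  ProperFilter F -> cauchy F -> forall (A : operator E) (e : R),
  F (fun B => opnorm (minus B A) < e) ->
  forall x, norm (minus (pointwise_lim F x) (A x)) <= e * norm x.
Proof.
intros PF cF A e HA x; apply norm_le_small; intros d.
destruct (filter_ex _ (filter_and _ _ HA (pointwise_lim_spec F PF cF x d)))
  as [B [HB1 HB2]].
apply Rle_trans with (1 := norm_minus_trans (B x) _ _).
rewrite norm_minus_sym in HB2.
assert (h : norm (minus (B x) (A x)) <= opnorm (minus B A) * norm x)
  by exact (opnorm_ub (minus B A) x).
assert (h' : opnorm (minus B A) * norm x <= e * norm x)
  by (apply Rmult_le_compat_r; [apply norm_ge_0|lra]).
lra.
Qed.

Lemma eq_of_norm_small (x y : E) :
  (forall eps : posreal, norm (minus x y) <= eps) -> x = y.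
Proof.
intros h.
assert (n : norm (minus x y) <= 0).
  apply norm_le_small; intros e; rewrite Rplus_0_l; apply h.
assert (h0 := norm_ge_0 (minus x y)).
assert (z0 : norm (minus x y) = 0) by lra.
apply (plus_reg_r (opp y)); rewrite plus_opp_r.
exact (norm_eq_zero (minus x y) z0).
Qed.

Lemma pointwise_lim_linear (F : (operator E -> Prop) -> Prop) :
  ProperFilter F -> cauchy F -> is_linear (pointwise_lim F).
Proof.
intros PF cF.
assert (L := pointwise_lim_spec F PF cF).
set (l := pointwise_lim F) in *.
apply Build_is_linear.
- intros x y; apply eq_of_norm_small; intros e.
  assert (p : 0 < e / 3) by (assert (h := cond_pos e); lra).
  destruct (filter_ex _ (filter_and _ _ (L (plus x y) (mkposreal _ p))
              (filter_and _ _ (L x (mkposreal _ p)) (L y (mkposreal _ p))))) as [A [H1 [H2 H3]]].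
  rewrite norm_minus_sym in H1.
  apply Rle_trans with (1 := norm_minus_trans (A (plus x y)) _ _).
  assert (h : norm (minus (A (plus x y)) (plus (l x) (l y))) <=
              norm (minus (A x) (l x)) + norm (minus (A y) (l y))).
    apply Rle_trans with (2 := norm_plus_le (minus (A x) (l x)) (minus (A y) (l y))).
    right; f_equal; rewrite (linear_plus _ (op_linear A)).
    exact (minus_plus_plus (A x) (A y) (l x) (l y)).
  apply Rle_trans with (e / 3 + (e / 3 + e / 3)); [|lra].
  apply Rplus_le_compat; [left; exact H1|].
  apply Rle_trans with (1 := h).
  apply Rplus_le_compat; left; [exact H2|exact H3].
- intros k x; apply eq_of_norm_small; intros e.
  set (m := abs k).
  assert (k0 : 0 <= m) by exact (abs_ge_0 k).
  assert (p : 0 < e / (m + 1))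
    by (apply Rdiv_lt_0_compat; [apply cond_pos|lra]).
  destruct (filter_ex _ (filter_and _ _ (L (scal k x) (mkposreal _ p))
              (L x (mkposreal _ p)))) as [A [H1 H2]].
  rewrite norm_minus_sym in H1.
  apply Rle_trans with (1 := norm_minus_trans (A (scal k x)) _ _).
  assert (h : norm (minus (A (scal k x)) (scal k (l x))) <=
              m * norm (minus (A x) (l x))).
    apply Rle_trans with (2 := norm_scal k (minus (A x) (l x))).
    right; f_equal; rewrite (linear_scal _ (op_linear A)).
    symmetry; exact (scal_minus_distr_l k (A x) (l x)).
  replace (pos e) with (e / (m + 1) + m * (e / (m + 1))) by (field; lra).
  apply Rplus_le_compat; [left; exact H1|].
  apply Rle_trans with (1 := h).
  apply Rmult_le_compat_l; [exact k0|left; exact H2].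
- destruct (cF (mkposreal 1 Rlt_0_1)) as [A HA].
  exists (opnorm A + 1); split; [assert (h := opnorm_ge0 A); lra|].
  intros x.
  assert (h1 := pointwise_lim_near F PF cF A 1 HA x); fold l in h1.
  assert (h2 := opnorm_ub A x).
  replace (l x) with (plus (minus (l x) (A x)) (A x)).
    apply Rle_trans with (1 := norm_plus_le _ _); lra.
  unfold minus; rewrite <- plus_assoc, plus_opp_l; apply plus_zero_r.
Qed.

Definition op_lim (F : (operator E -> Prop) -> Prop) : operator E :=
  choose_or op_zero (fun L => forall x, L x = pointwise_lim F x).

Definition operator_CompleteSpace_mixin :
  CompleteSpace.mixin_of operator_UniformSpace.
Proof.
apply (CompleteSpace.Mixin operator_UniformSpace op_lim).
- intros F PF cF eps.
  assert (L : forall x, op_lim F x = pointwise_lim F x).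
    apply (choose_or_spec op_zero (fun L => forall x, L x = pointwise_lim F x)).
    now exists (Operator _ (pointwise_lim_linear F PF cF)).
  assert (p : 0 < eps / 3) by (assert (h := cond_pos eps); lra).
  destruct (cF (mkposreal _ p)) as [A HA].
  assert (N := pointwise_lim_near F PF cF A (eps / 3) HA).
  revert HA; apply filter_imp; intros B HB.
  change (opnorm (minus B A) < eps / 3) in HB.
  change (opnorm (minus B (op_lim F)) < eps).
  rewrite (minus_trans A).
  apply Rle_lt_trans with (1 := opnorm_plus _ _).
  assert (h : opnorm (minus A (op_lim F)) <= eps / 3); [|lra].
  rewrite <- (opp_minus (op_lim F) A), opnorm_opp.
  apply opnorm_le; [lra|]; intros x.
  change (norm (minus (op_lim F x) (A x)) <= eps / 3 * norm x).
  rewrite L; apply N.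
- intros F1 F2 h1 h2.
  replace F2 with F1; [apply close_refl|].
  apply functional_extensionality; intros P.
  apply propositional_extensionality; split; [apply h2|apply h1].
Defined.

Canonical operator_CompleteSpace :=
  CompleteSpace.Pack (operator E)
    (CompleteSpace.Class _ _ operator_CompleteSpace_mixin) (operator E).

Canonical operator_CompleteNormedModule :=
  CompleteNormedModule.Pack R_AbsRing (operator E)
    (CompleteNormedModule.Class R_AbsRing (operator E)
       (NormedModule.class R_AbsRing operator_NormedModule)
       operator_CompleteSpace_mixin) (operator E).

(** * Spectrum and resolvent *)

Definition is_inverse A B : Prop :=
  op_comp A B = op_one /\ op_comp B A = op_one.

Definition spectrum (T : operator E) (z : C) : Prop :=
  ~ exists B, is_inverse (minus (op_scal z op_one) T) B.

Definition resolvent (T : operator E) (z : C) : operator E :=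
  choose_or op_zero (is_inverse (minus (op_scal z op_one) T)).

End OperatorSpace.

(** * Cycles in the plane *)

(* A C^1 arc [0,1] -> C.  It is given by a C^1 function on the whole line, which
   is no restriction: C^1 functions on [0,1] extend, affinely on both sides. *)
Record arc := Arc {
  arc_fun :> R -> C;
  arc_der : R -> C;
  arc_is_derive : forall t : R,
    is_derive (K := R_AbsRing) (V := C_R_NormedModule) arc_fun t (arc_der t);
  arc_der_continuous : forall t : R, continuous arc_der t }.

(* A piecewise C^1 path is the list of its successive arcs, and a cycle a finite
   formal sum of closed paths (arcs may be reversed, so signs are not needed). *)
Fixpoint joins (z w : C) (p : list arc) : Prop :=
  match p with
  | nil => z = w
  | a :: p' => a 0 = z /\ joins (a 1) w p'
  end.

Definition closed_path (p : list arc) : Prop := exists z, joins z z p.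

Definition trace (G : list (list arc)) (z : C) : Prop :=
  exists p a t, In p G /\ In a p /\ 0 <= t <= 1 /\ z = arc_fun a t.

Definition sum_arcs {V : AbelianMonoid} (I : arc -> V)
    (G : list (list arc)) : V :=
  fold_right (fun a s => plus (I a) s) zero (concat G).

Definition winding (G : list (list arc)) (z : C) : C :=
  (/ (RtoC (2 * PI) * Ci) *
   sum_arcs (fun a : arc => RInt (V := C_R_CompleteNormedModule)
     (fun t => arc_der a t / (arc_fun a t - z)) 0 1 : C_R_CompleteNormedModule) G)%C.

Definition surrounds (Omega K : C -> Prop) (G : list (list arc)) : Prop :=
  (forall p, In p G -> closed_path p) /\
  (forall z, trace G z -> Omega z /\ ~ K z) /\
  (forall z, K z -> winding G z = RtoC 1) /\
  (forall z, ~ Omega z -> winding G z = RtoC 0).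

(** * The algebra A(Omega) and the holomorphic functional calculus *)

Definition Cbounded (Omega : C -> Prop) : Prop :=
  exists M : R, forall z, Omega z -> Cmod z <= M.

Definition Cclosure (Omega : C -> Prop) (z : C) : Prop :=
  forall eps : posreal, exists w, Omega w /\ Cmod (w - z) < eps.

(* Membership in A(Omega); values outside the closure of Omega are irrelevant. *)
Definition holo_alg (Omega : C -> Prop) (f : C -> C) : Prop :=
  continuous_on (T := C_UniformSpace) (U := C_UniformSpace) (Cclosure Omega) f /\
  (forall z, Omega z -> ex_derive (K := C_AbsRing) (V := C_NormedModule) f z).

Definition supnorm (Omega : C -> Prop) (f : C -> C) : R :=
  sup (fun r => exists z, Omega z /\ r = Cmod (f z)).

Definition cauchy_integral {E : CompleteNormedModule C_AbsRing}
    (G : list (list arc)) (T : operator E) (f : C -> C) : operator E :=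
  op_scal (/ (RtoC (2 * PI) * Ci))
    (sum_arcs (fun a : arc => RInt (fun t =>
       op_scal (f (arc_fun a t) * arc_der a t)
         (resolvent T (arc_fun a t))) 0 1) G).

(* f(T).  When Omega is open and contains the spectrum of T, a surrounding cycle
   exists and, for f holomorphic on Omega, the integral does not depend on it. *)
Definition holo_calc {E : CompleteNormedModule C_AbsRing} (Omega : C -> Prop)
    (T : operator E) (f : C -> C) : operator E :=
  cauchy_integral (choose_or nil (surrounds Omega (spectrum T))) T f.

(** * Hilbert spaces and adjoints *)

Record HilbertSpace := {
  hilbert_module :> CompleteNormedModule C_AbsRing;
  inner : hilbert_module -> hilbert_module -> C;
  inner_plus_l : forall x y z, inner (plus x y) z = (inner x z + inner y z)%C;
  inner_scal_l : forall (c : C_AbsRing) x y,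
    inner (scal c x) y = (c * inner x y)%C;
  inner_conj : forall x y, inner y x = Cconj (inner x y);
  inner_norm : forall x, inner x x = RtoC (norm x ^ 2) }.
Arguments inner {h}.

Definition is_adjoint {H : HilbertSpace} (A B : operator H) : Prop :=
  forall x y : H, inner (A x) y = inner x (B y).

Definition adjoint {H : HilbertSpace} (A : operator H) : operator H :=
  choose_or op_zero (is_adjoint A).

(* Main.v *)
Require Import Defs.
From Stdlib Require Import Reals Lra List ClassicalEpsilon Classical.
From Coquelicot Require Import Coquelicot.
Open Scope R_scope.

(** Write [F = f(T)], [G = g(T)], [s] for the sup norm of [f], and [F'] for the
    adjoint of [F].  For a vector [x] put [v = F' F x].  As [F' = (F + G')' - G],
    [|v|^2 = <(F + G') v, F x> - <v, G F x>], and the last term is the conjugate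
    of [<F G F x, F x>].  If the functional calculus is multiplicative, [F G F]
    is [(f g f)(T)], where [f g f] has sup norm at most [s^3].  So when
    [|h(T)| <= k |h|] holds for all [h], both terms are controlled and
    [|F|^4 <= (2 k^3 + k^2) s^4] ([crouzeix_palencia]).  The best constant [k]
    therefore satisfies [k^4 <= 2 k^3 + k^2], that is [k <= 1 + sqrt 2]
    ([bootstrap_bound]).  This needs three facts: adjoints exist
    ([riesz_exists]), some finite [k] exists ([cauchy_integral_bound]), and the
    calculus is multiplicative ([cauchy_integral_mult]).  If no cycle surrounds
    the spectrum, then [holo_calc] is zero by convention and the bound is
    trivial.

    Multiplicativity is obtained from a single cycle.  With [R] the resolvent,
    the scalar function [w |-> <R(w) (f(T) - f(w)) x, y>] is holomorphic off the
    spectrum.  By the resolvent identity and Cauchy's formula it coincides near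
    the spectrum with [- 1 / (2 pi i)] times the Cauchy transform of
    [f <R x, y>], hence extends to a holomorphic function on [Omega]
    ([quotient_extends]).  Cauchy's theorem, applied to its product with [g], is
    the identity [g(T) f(T) = (g f)(T)].

    Cauchy's theorem is needed for an arbitrary cycle homologous to zero in an
    arbitrary bounded open set.  It is proved by Dixon's argument
    ([cauchy_dixon]): the integral over the cycle of the divided difference
    [(f(w) - f(z)) / (w - z)] in [w] extends to an entire function of [z] tending
    to zero at infinity, and vanishes by Liouville's theorem.  Divided
    differences also give the local theory.  A function that is continuous on a
    box and differentiable off one point has a primitive there ([goursat],
    [primitive_on_box]); applied to a divided difference of [f] this is Cauchy's
    formula on circles, which in turn shows that divided differences of
    holomorphic functions are holomorphic ([divdiff_holo]). *)

(** * Complex numbers and complex derivatives *)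

(** The plane carries its product uniformity here, the one underlying
    [C_NormedModule]; [locally_Cmod] translates it to the modulus. *)
Notation cderive f z l :=
  (is_derive (K := C_AbsRing) (V := C_NormedModule) f z l).
Notation cdiff f z := (ex_derive (K := C_AbsRing) (V := C_NormedModule) f z).
Notation ccont f z :=
  (continuous (T := C_UniformSpace) (U := C_UniformSpace) f z).
Notation rcont f t :=
  (continuous (T := R_UniformSpace) (U := C_UniformSpace) f t).
Notation CRInt f a b := (RInt (V := C_R_CompleteNormedModule) f a b).
Notation ex_CRInt f a b := (ex_RInt (V := C_R_NormedModule) f a b).
Notation is_CRInt f a b l := (is_RInt (V := C_R_NormedModule) f a b l).

Lemma Cmod_minus_sym (z w : C) : Cmod (z - w) = Cmod (w - z).
Proof. rewrite <- Cmod_opp; f_equal; ring. Qed.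

Lemma Cminus_neq0 (z w : C) : z <> w -> (z - w <> 0)%C.
Proof. intros h e; apply h; replace z with ((z - w) + w)%C by ring; rewrite e; ring. Qed.

Lemma Cmod_minus_pos (z w : C) : z <> w -> 0 < Cmod (z - w).
Proof. intros h; apply Cmod_gt_0, Cminus_neq0, h. Qed.

Lemma Cmod_dist_pos (z w : C) : 0 < Cmod (z - w) -> z <> w.
Proof. intros h ->; replace (w - w)%C with (RtoC 0) in h by ring; rewrite Cmod_0 in h; lra. Qed.

Lemma Cmod_triangle_inv (z w : C) : Rabs (Cmod z - Cmod w) <= Cmod (z - w).
Proof.
assert (h1 := Cmod_triangle (z - w) w); assert (h2 := Cmod_triangle (w - z) z).
replace (z - w + w)%C with z in h1 by ring.
replace (w - z + z)%C with w in h2 by ring.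
rewrite (Cmod_minus_sym w z) in h2; apply Rabs_le; lra.
Qed.

Lemma Cmod_small_eq0 (z : C) (K : R) : 0 <= K ->
  (forall e, 0 < e -> Cmod z <= K * e) -> z = RtoC 0.
Proof.
intros K0 h; apply Cmod_eq_0, Rle_antisym; [|apply Cmod_ge_0].
apply le_epsilon; intros e e0.
apply Rle_trans with (1 := h (e / (K + 1)) ltac:(apply Rdiv_lt_0_compat; lra)).
rewrite Rplus_0_l; apply Rmult_le_reg_r with (K + 1); [lra|].
replace (K * (e / (K + 1)) * (K + 1)) with (K * e) by (field; lra); nra.
Qed.

Lemma Rabs_fst_le (z : C) : Rabs (fst z) <= Cmod z.
Proof. apply Rle_trans with (2 := Rmax_Cmod z), Rmax_l. Qed.

Lemma Rabs_snd_le (z : C) : Rabs (snd z) <= Cmod z.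
Proof. apply Rle_trans with (2 := Rmax_Cmod z), Rmax_r. Qed.

Lemma Cmod_le_sum (x y : R) : Cmod (x, y) <= Rabs x + Rabs y.
Proof.
replace (x, y) with (RtoC x + Ci * RtoC y)%C.
- apply Rle_trans with (1 := Cmod_triangle _ _).
  rewrite Cmod_mult, Cmod_Ci, !Cmod_R; lra.
- unfold RtoC, Ci, Cplus, Cmult; simpl; f_equal; ring.
Qed.

Lemma locally_Cmod (P : C -> Prop) (z : C) :
  locally (T := C_UniformSpace) z P <->
  exists d, 0 < d /\ forall w, Cmod (w - z) < d -> P w.
Proof.
split.
- intros [d Hd]; exists d; split; [apply cond_pos|].
  intros w Hw; apply Hd, C_NormedModule_mixin_compat1; exact Hw.
- intros [d [d0 Hd]].
  assert (p : 0 < d / sqrt 2) by (apply Rdiv_lt_0_compat; [exact d0|apply Rlt_sqrt2_0]).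
  exists (mkposreal _ p); intros w Hw.
  apply Hd; apply C_NormedModule_mixin_compat2 in Hw.
  simpl in Hw; replace (sqrt 2 * (d / sqrt 2)) with d in Hw; [exact Hw|].
  field; apply Rgt_not_eq, Rlt_sqrt2_0.
Qed.

Lemma ccontP (f : C -> C) (z : C) :
  ccont f z <-> forall e, 0 < e -> exists d, 0 < d /\
    forall w, Cmod (w - z) < d -> Cmod (f w - f z) < e.
Proof.
split.
- intros h e e0.
  assert (h1 : locally (T := C_UniformSpace) (f z) (fun y => Cmod (y - f z) < e)).
    apply locally_Cmod; exists e; auto.
  apply h in h1; apply locally_Cmod in h1; exact h1.
- intros h P HP; apply locally_Cmod in HP; destruct HP as [e [e0 He]].
  apply locally_Cmod; destruct (h e e0) as [d [d0 Hd]].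
  exists d; split; [exact d0|]; intros w Hw; apply He, Hd, Hw.
Qed.

Lemma rcontP (f : R -> C) (t : R) :
  rcont f t <-> forall e, 0 < e -> exists d, 0 < d /\
    forall s, Rabs (s - t) < d -> Cmod (f s - f t) < e.
Proof.
split.
- intros h e e0.
  assert (h1 : locally (T := C_UniformSpace) (f t) (fun y => Cmod (y - f t) < e)).
    apply locally_Cmod; exists e; auto.
  apply h in h1; destruct h1 as [d Hd]; exists d; split; [apply cond_pos|exact Hd].
- intros h P HP; apply locally_Cmod in HP; destruct HP as [e [e0 He]].
  destruct (h e e0) as [d [d0 Hd]].
  exists (mkposreal d d0); intros w Hw; apply He, Hd, Hw.
Qed.

Lemma cderiveP (f : C -> C) (z l : C) :
  cderive f z l <-> forall e, 0 < e -> exists d, 0 < d /\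
    forall w, Cmod (w - z) < d ->
      Cmod (f w - f z - (w - z) * l) <= e * Cmod (w - z).
Proof.
split.
- intros [_ h] e e0.
  specialize (h z (fun P H => H) (mkposreal e e0)).
  apply locally_C, locally_Cmod in h; exact h.
- intros h; split; [apply is_linear_scal_l|].
  intros x Hx e.
  assert (ex : z = x) by exact (is_filter_lim_locally_unique (K := C_AbsRing) (V := AbsRing_NormedModule C_AbsRing) z x Hx).
  subst x; apply locally_C, locally_Cmod.
  exact (h e (cond_pos e)).
Qed.

Lemma filterlim_Cmult {X : Type} (F : (X -> Prop) -> Prop) (f g : X -> C) (x y : C) :
  Filter F -> filterlim f F (locally (T := C_UniformSpace) x) ->
  filterlim g F (locally (T := C_UniformSpace) y) ->
  filterlim (fun t => f t * g t)%C F (locally (T := C_UniformSpace) (x * y)%C).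
Proof.
intros FF hf hg.
apply (filterlim_filter_le_2 (F := F) (fun t => f t * g t)%C
  (G := locally (T := AbsRing_UniformSpace C_AbsRing) (x * y)%C)).
  intros P HP; now apply locally_C.
apply (filterlim_comp_2 (G := locally (T := AbsRing_UniformSpace C_AbsRing) x)
  (H := locally (T := AbsRing_UniformSpace C_AbsRing) y) f g Cmult).
- intros P HP; apply hf, locally_C, HP.
- intros P HP; apply hg, locally_C, HP.
- exact (filterlim_mult (K := C_AbsRing) x y).
Qed.

Lemma ccont_id (z : C) : ccont (fun w => w) z.
Proof. apply continuous_id. Qed.

Lemma ccont_minus (g h : C -> C) (z : C) :
  ccont g z -> ccont h z -> ccont (fun w => g w - h w)%C z.
Proof.
exact (continuous_minus (U := C_UniformSpace) (K := R_AbsRing) (V := C_R_NormedModule) g h z).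
Qed.

Lemma ccont_mult (f g : C -> C) (z : C) :
  ccont f z -> ccont g z -> ccont (fun w => f w * g w)%C z.
Proof. apply filterlim_Cmult, _. Qed.

Lemma ccont_const (c z : C) : ccont (fun _ => c) z.
Proof. apply continuous_const. Qed.

Lemma cdiff_cont (f : C -> C) (z : C) : cdiff f z -> ccont f z.
Proof.
intros h P HP; apply locally_C.
exact (ex_derive_continuous (K := C_AbsRing) (V := C_NormedModule) f z h P HP).
Qed.

Lemma cderive_ext_near (f g : C -> C) (z l : C) (d : R) : 0 < d ->
  (forall w, Cmod (w - z) < d -> f w = g w) -> cderive f z l -> cderive g z l.
Proof.
intros d0 h; apply is_derive_ext_loc.
apply locally_C, locally_Cmod; exists d; auto.
Qed.

Lemma cdiff_ext_near (f g : C -> C) (z : C) (d : R) : 0 < d ->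
  (forall w, Cmod (w - z) < d -> f w = g w) -> cdiff f z -> cdiff g z.
Proof. intros d0 h [l hl]; exists l; exact (cderive_ext_near f g z l d d0 h hl). Qed.

Lemma cderive_const (c z : C) : cderive (fun _ => c) z (RtoC 0).
Proof. exact (is_derive_const (K := C_AbsRing) (V := C_NormedModule) c z). Qed.

(** [C_NormedModule] and [AbsRing_NormedModule C_AbsRing] have different uniform
    structures but the same derivatives; the general product and chain rules are
    stated for the latter. *)
Lemma cderive_AbsRing (f : C -> C) (z l : C) : cderive f z l <->
  is_derive (K := C_AbsRing) (V := AbsRing_NormedModule C_AbsRing) f z l.
Proof. split; intros [_ h]; (split; [apply is_linear_scal_l|exact h]). Qed.

Lemma cderive_id (z : C) : cderive (fun w => w) z (RtoC 1).
Proof. apply cderive_AbsRing; exact (is_derive_id (K := C_AbsRing) z). Qed.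

Lemma cderive_minus (f g : C -> C) (z a b : C) :
  cderive f z a -> cderive g z b -> cderive (fun w => f w - g w)%C z (a - b)%C.
Proof.
exact (is_derive_minus (K := C_AbsRing) (V := C_NormedModule) f g z a b).
Qed.

Lemma cderive_mult (f g : C -> C) (z a b : C) :
  cderive f z a -> cderive g z b ->
  cderive (fun w => f w * g w)%C z (a * g z + f z * b)%C.
Proof.
rewrite !cderive_AbsRing; intros hf hg.
exact (is_derive_mult (K := C_AbsRing) f g z a b hf hg Cmult_comm).
Qed.

Lemma cderive_inv_id (z : C) : z <> RtoC 0 -> cderive (fun w => / w)%C z (- / (z * z))%C.
Proof.
intros z0; apply cderiveP; intros e e0.
assert (p := proj1 (Cmod_gt_0 z) z0).
set (m := Cmod z) in *.
exists (Rmin (m / 2) (e * (m * m * m) / 2)); split.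
  apply Rmin_glb_lt; [lra|].
  assert (0 < m * m * m) by (repeat apply Rmult_lt_0_compat; lra); nra.
intros w Hw.
assert (h1 := Rlt_le_trans _ _ _ Hw (Rmin_l _ _)).
assert (h2 := Rlt_le_trans _ _ _ Hw (Rmin_r _ _)).
assert (hw : m / 2 <= Cmod w).
  assert (h := Cmod_triangle w (z - w)).
  replace (w + (z - w))%C with z in h by ring.
  rewrite Cmod_minus_sym in h; fold m in h; lra.
assert (w0 : w <> RtoC 0) by (apply Cmod_gt_0; lra).
replace (/ w - / z - (w - z) * - / (z * z))%C
  with ((w - z) * ((w - z) * (/ w * / (z * z))))%C by (field; split; assumption).
assert (zz : (z * z)%C <> RtoC 0) by now apply Cmult_neq_0.
rewrite !Cmod_mult, !Cmod_inv, Cmod_mult; try assumption.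
fold m; set (D := Cmod (w - z)) in *.
assert (D0 : 0 <= D) by apply Cmod_ge_0.
rewrite (Rmult_comm e D); apply Rmult_le_compat_l; [exact D0|].
assert (k : / Cmod w <= 2 / m).
  replace (2 / m) with (/ (m / 2)) by (field; lra).
  apply Rinv_le_contravar; lra.
apply Rle_trans with (e * (m * m * m) / 2 * (2 / m * / (m * m))).
- apply Rmult_le_compat; [exact D0| |lra|].
  + apply Rmult_le_pos; left; apply Rinv_0_lt_compat; [lra|nra].
  + apply Rmult_le_compat_r; [left; apply Rinv_0_lt_compat; nra|exact k].
- right; field; lra.
Qed.

Lemma cderive_comp (f g : C -> C) (z a b : C) :
  cderive f (g z) a -> cderive g z b -> cderive (fun w => f (g w)) z (b * a)%C.
Proof.
intros hf hg; apply (cderive_AbsRing g) in hg.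
exact (is_derive_comp (K := C_AbsRing) (V := C_NormedModule) f g z a b hf hg).
Qed.

Lemma cdiff_const (c z : C) : cdiff (fun _ => c) z.
Proof. eexists; apply cderive_const. Qed.

Lemma cdiff_id (z : C) : cdiff (fun w => w) z.
Proof. eexists; apply cderive_id. Qed.

Lemma cdiff_minus (f g : C -> C) (z : C) :
  cdiff f z -> cdiff g z -> cdiff (fun w => f w - g w)%C z.
Proof. intros [a ha] [b hb]; eexists; exact (cderive_minus f g z a b ha hb). Qed.

Lemma cdiff_mult (f g : C -> C) (z : C) :
  cdiff f z -> cdiff g z -> cdiff (fun w => f w * g w)%C z.
Proof. intros [a ha] [b hb]; eexists; exact (cderive_mult f g z a b ha hb). Qed.

Lemma cdiff_inv (f : C -> C) (z : C) :
  cdiff f z -> f z <> RtoC 0 -> cdiff (fun w => / f w)%C z.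
Proof.
intros [a ha] h; eexists.
exact (cderive_comp (fun w => / w)%C f z _ _ (cderive_inv_id _ h) ha).
Qed.

Lemma cdiff_div (f g : C -> C) (z : C) :
  cdiff f z -> cdiff g z -> g z <> RtoC 0 -> cdiff (fun w => f w / g w)%C z.
Proof. intros hf hg h; apply cdiff_mult; [exact hf|now apply cdiff_inv]. Qed.

(** * Integrals of complex functions of a real variable *)

Lemma Riemann_sum_linear {U V : NormedModule R_AbsRing} (l : U -> V) (f : R -> U)
    (ptd : SF_seq) :
  is_linear l -> Riemann_sum (fun t => l (f t)) ptd = l (Riemann_sum f ptd).
Proof.
intros Hl; induction ptd as [x|h s IH] using SF_cons_ind.
- symmetry; exact (linear_zero l Hl).
- rewrite !Riemann_sum_cons, IH, (linear_plus l Hl), (linear_scal l Hl); reflexivity.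
Qed.

(** Bounded linear maps commute with Riemann integrals because they commute with
    Riemann sums; used for multiplication by a complex number and for [A |-> <A
    x, y>]. *)
Lemma is_RInt_linear {U V : NormedModule R_AbsRing} (l : U -> V) (f : R -> U)
    (a b : R) (I : U) :
  is_linear l -> is_RInt f a b I -> is_RInt (fun t => l (f t)) a b (l I).
Proof.
intros Hl HI; unfold is_RInt in *.
apply filterlim_ext with (fun ptd => l (scal (sign (b - a)) (Riemann_sum f ptd))).
  intros ptd; rewrite (linear_scal l Hl), (Riemann_sum_linear l f ptd Hl); reflexivity.
apply filterlim_comp with (1 := HI), (linear_cont l I Hl).
Qed.

Lemma Cmod_norm_R (x : C) : norm (V := C_R_NormedModule) x = Cmod x.
Proof. symmetry; exact (Cmod_norm x). Qed.

Lemma Cmult_linear (c : C) :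
  is_linear (U := C_R_NormedModule) (V := C_R_NormedModule) (fun z => c * z)%C.
Proof.
apply Build_is_linear.
- intros x y; exact (Cmult_plus_distr_l c x y).
- intros k x; destruct c as [c1 c2], x as [x1 x2].
  unfold scal; simpl; unfold prod_scal, Cmult; simpl.
  unfold scal; simpl; unfold mult; simpl; f_equal; ring.
- exists (Cmod c + 1); assert (h := Cmod_ge_0 c); split; [lra|].
  intros x; rewrite !Cmod_norm_R, Cmod_mult; assert (h' := Cmod_ge_0 x); nra.
Qed.

Lemma rcont_const (c : C) (t : R) : rcont (fun _ => c) t.
Proof. apply continuous_const. Qed.

Lemma rcont_mult (f g : R -> C) (t : R) :
  rcont f t -> rcont g t -> rcont (fun s => f s * g s)%C t.
Proof. apply filterlim_Cmult, _. Qed.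

Lemma rcont_comp (f : C -> C) (u : R -> C) (t : R) :
  rcont u t -> ccont f (u t) -> rcont (fun s => f (u s)) t.
Proof. intros hu hf; exact (continuous_comp u f t hu hf). Qed.

Lemma ex_CRInt_cont (f : R -> C) (a b : R) :
  (forall t, Rmin a b <= t <= Rmax a b -> rcont f t) -> ex_CRInt f a b.
Proof. exact (ex_RInt_continuous (V := C_R_CompleteNormedModule) f a b). Qed.

Lemma CRInt_correct (f : R -> C) (a b : R) :
  ex_CRInt f a b -> is_CRInt f a b (CRInt f a b).
Proof. exact (RInt_correct (V := C_R_CompleteNormedModule) f a b). Qed.

Lemma CRInt_unique (f : R -> C) (a b : R) (l : C) :
  is_CRInt f a b l -> CRInt f a b = l.
Proof. exact (is_RInt_unique (V := C_R_CompleteNormedModule) f a b l). Qed.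

Lemma CRInt_ext (f g : R -> C) (a b : R) :
  (forall t, Rmin a b <= t <= Rmax a b -> f t = g t) -> CRInt f a b = CRInt g a b.
Proof.
intros h; apply (RInt_ext (V := C_R_CompleteNormedModule)).
intros t [h1 h2]; apply h; lra.
Qed.

Lemma CRInt_plus (f g : R -> C) (a b : R) :
  ex_CRInt f a b -> ex_CRInt g a b ->
  CRInt (fun t => f t + g t)%C a b = (CRInt f a b + CRInt g a b)%C.
Proof. exact (RInt_plus (V := C_R_CompleteNormedModule) f g a b). Qed.

Lemma CRInt_minus (f g : R -> C) (a b : R) :
  ex_CRInt f a b -> ex_CRInt g a b ->
  CRInt (fun t => f t - g t)%C a b = (CRInt f a b - CRInt g a b)%C.
Proof. exact (RInt_minus (V := C_R_CompleteNormedModule) f g a b). Qed.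

Lemma is_CRInt_scal (c : C) (f : R -> C) (a b : R) (l : C) :
  is_CRInt f a b l -> is_CRInt (fun t => c * f t)%C a b (c * l)%C.
Proof. exact (is_RInt_linear _ f a b l (Cmult_linear c)). Qed.

Lemma CRInt_scal (c : C) (f : R -> C) (a b : R) :
  ex_CRInt f a b -> CRInt (fun t => c * f t)%C a b = (c * CRInt f a b)%C.
Proof. intros h; apply CRInt_unique, is_CRInt_scal, CRInt_correct, h. Qed.

Lemma CRInt_bound (f : R -> C) (a b M : R) :
  (forall t, Rmin a b <= t <= Rmax a b -> Cmod (f t) <= M) ->
  ex_CRInt f a b -> Cmod (CRInt f a b) <= Rabs (b - a) * M.
Proof.
intros h hf; rewrite <- Cmod_norm_R.
apply (norm_RInt_le_const_abs (V := C_R_NormedModule) f a b).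
- intros t Ht; rewrite Cmod_norm_R; now apply h.
- now apply CRInt_correct.
Qed.

Lemma CRInt_const (c : C) (a b : R) : CRInt (fun _ => c) a b = (RtoC (b - a) * c)%C.
Proof.
apply CRInt_unique.
replace (RtoC (b - a) * c)%C with (scal (b - a) c : C_R_NormedModule).
- apply (is_RInt_const (V := C_R_NormedModule)).
- destruct c as [c1 c2]; unfold scal; simpl; unfold prod_scal, Cmult; simpl.
  unfold scal; simpl; unfold mult; simpl; f_equal; ring.
Qed.

Lemma CRInt_Chasles (f : R -> C) (a b c : R) :
  ex_CRInt f a b -> ex_CRInt f b c ->
  (CRInt f a b + CRInt f b c)%C = CRInt f a c.
Proof. exact (RInt_Chasles (V := C_R_CompleteNormedModule) f a b c). Qed.

Lemma CRInt_swap (f : R -> C) (a b : R) :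
  ex_CRInt f a b -> CRInt f b a = (- CRInt f a b)%C.
Proof. intros h; symmetry; exact (opp_RInt_swap (V := C_R_CompleteNormedModule) f a b h). Qed.

Definition rderive (f : R -> C) (t : R) (l : C) : Prop :=
  is_derive (K := R_AbsRing) (V := C_R_NormedModule) f t l.

Lemma rderiveP (f : R -> C) (t : R) (l : C) :
  rderive f t l <-> forall e, 0 < e -> exists d, 0 < d /\
    forall s, Rabs (s - t) < d ->
      Cmod (f s - f t - RtoC (s - t) * l) <= e * Rabs (s - t).
Proof.
assert (E : forall s, minus (minus (f s) (f t)) (scal (minus s t) l : C_R_NormedModule)
    = (f s - f t - RtoC (s - t) * l)%C).
  intros s; unfold Cminus at 1; apply (f_equal2 Cplus); [reflexivity|].
  destruct l as [c1 c2]; unfold scal, opp; simpl; unfold prod_opp, prod_scal, Cmult, Copp; simpl.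
  unfold scal, opp, minus, plus, opp; simpl; unfold mult; simpl; f_equal; ring.
split.
- intros [_ h] e e0.
  specialize (h t (fun P H => H) (mkposreal e e0)).
  destruct h as [d Hd]; exists d; split; [apply cond_pos|].
  intros s Hs; rewrite <- E, <- Cmod_norm_R; exact (Hd s Hs).
- intros h; split; [apply is_linear_scal_l|].
  intros x Hx e.
  assert (ex : t = x) by exact (is_filter_lim_locally_unique (K := R_AbsRing) (V := R_NormedModule) t x Hx).
  subst x; destruct (h e (cond_pos e)) as [d [d0 Hd]].
  exists (mkposreal d d0); intros s Hs.
  apply Rle_trans with (Cmod (f s - f t - RtoC (s - t) * l)); [|exact (Hd s Hs)].
  rewrite <- E, <- Cmod_norm_R; apply Rle_refl.
Qed.

Lemma rderive_cont (f : R -> C) (t : R) (l : C) : rderive f t l -> rcont f t.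
Proof.
intros h; apply (ex_derive_continuous (K := R_AbsRing) (V := C_R_NormedModule)).
now exists l.
Qed.

Lemma rderive_comp (f : C -> C) (u : R -> C) (t : R) (a b : C) :
  cderive f (u t) a -> rderive u t b -> rderive (fun s => f (u s)) t (b * a)%C.
Proof.
intros hf hg.
assert (cg := rderive_cont _ _ _ hg).
apply rderiveP; intros e e0.
assert (pa := Cmod_ge_0 a); assert (pb := Cmod_ge_0 b).
set (e1 := Rmin 1 (e / (1 + Cmod a + Cmod b))).
assert (e1p : 0 < e1) by (apply Rmin_glb_lt; [lra|apply Rdiv_lt_0_compat; lra]).
destruct (proj1 (cderiveP f _ a) hf e1 e1p) as [d1 [d10 H1]].
destruct (proj1 (rcontP u t) cg d1 d10) as [d2 [d20 H2]].
destruct (proj1 (rderiveP u t b) hg e1 e1p) as [d3 [d30 H3]].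
exists (Rmin d2 d3); split; [now apply Rmin_glb_lt|].
intros w Hw.
assert (h1 := H1 (u w) (H2 w (Rlt_le_trans _ _ _ Hw (Rmin_l _ _)))).
assert (h3 := H3 w (Rlt_le_trans _ _ _ Hw (Rmin_r _ _))).
replace (f (u w) - f (u t) - RtoC (w - t) * (b * a))%C with
  ((f (u w) - f (u t) - (u w - u t) * a) + (u w - u t - RtoC (w - t) * b) * a)%C by ring.
apply Rle_trans with (1 := Cmod_triangle _ _); rewrite Cmod_mult.
assert (h4 : Cmod (u w - u t) <= e1 * Rabs (w - t) + Rabs (w - t) * Cmod b).
  replace (u w - u t)%C with ((u w - u t - RtoC (w - t) * b) + RtoC (w - t) * b)%C by ring.
  apply Rle_trans with (1 := Cmod_triangle _ _); rewrite Cmod_mult, Cmod_R; lra.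
set (D := Rabs (w - t)) in *.
assert (D0 : 0 <= D) by apply Rabs_pos.
assert (e11 : e1 <= 1) by apply Rmin_l.
assert (k5 : e1 * (1 + Cmod a + Cmod b) <= e).
  apply Rle_trans with (e / (1 + Cmod a + Cmod b) * (1 + Cmod a + Cmod b)).
    apply Rmult_le_compat_r; [lra|apply Rmin_r].
  right; field; lra.
assert (k7 : Cmod (u w - u t) <= D * (1 + Cmod b)) by nra.
assert (k8 : e1 * Cmod (u w - u t) <= e1 * (D * (1 + Cmod b))) by nra.
assert (k9 : Cmod (u w - u t - RtoC (w - t) * b) * Cmod a <= e1 * D * Cmod a) by nra.
assert (k10 : e1 * (1 + Cmod a + Cmod b) * D <= e * D) by nra.
nra.
Qed.

Lemma CRInt_derive (f df : R -> C) (a b : R) :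
  (forall t, Rmin a b <= t <= Rmax a b -> rderive f t (df t)) ->
  (forall t, Rmin a b <= t <= Rmax a b -> rcont df t) ->
  CRInt df a b = (f b - f a)%C.
Proof.
intros h1 h2; apply CRInt_unique.
exact (is_RInt_derive (V := C_R_CompleteNormedModule) f df a b h1 h2).
Qed.

Lemma rcont_bounded (f : R -> C) :
  (forall t, 0 <= t <= 1 -> rcont f t) ->
  exists M, 0 <= M /\ forall t, 0 <= t <= 1 -> Cmod (f t) <= M.
Proof.
intros h.
destruct (continuity_ab_maj (fun t => Cmod (f t)) 0 1) as [m [Hm m01]].
- lra.
- intros t Ht; apply continuity_pt_locally; intros e.
  destruct (proj1 (rcontP f t) (h t Ht) e (cond_pos e)) as [d [d0 Hd]].
  exists (mkposreal d d0); intros s Hs.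
  apply Rle_lt_trans with (2 := Hd s Hs); apply Cmod_triangle_inv.
- exists (Cmod (f m)); split; [apply Cmod_ge_0|exact Hm].
Qed.

(** * Goursat's theorem *)

Lemma CRInt_near_const (f : R -> C) (c : C) (a b M : R) :
  (forall t, Rmin a b <= t <= Rmax a b -> Cmod (f t - c) <= M) ->
  ex_CRInt f a b -> Cmod (CRInt f a b - RtoC (b - a) * c) <= Rabs (b - a) * M.
Proof.
intros h hf; rewrite <- CRInt_const.
assert (hc : ex_CRInt (fun _ => c) a b)
  by (apply ex_CRInt_cont; intros; apply rcont_const).
rewrite <- CRInt_minus by assumption.
apply CRInt_bound; [exact h|].
exact (ex_RInt_minus (V := C_R_NormedModule) _ _ _ _ hf hc).
Qed.

Lemma nested_intervals (a b : nat -> R) :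
  (forall n, a n <= a (S n)) -> (forall n, b (S n) <= b n) ->
  (forall n, a n <= b n) -> exists u, forall n, a n <= u <= b n.
Proof.
intros ha hb hab.
assert (am : forall n k, a n <= a (n + k)%nat).
  intros n k; induction k as [|k IH]; [rewrite Nat.add_0_r; lra|].
  rewrite Nat.add_succ_r; apply Rle_trans with (1 := IH), ha.
assert (bm : forall n k, b (n + k)%nat <= b n).
  intros n k; induction k as [|k IH]; [rewrite Nat.add_0_r; lra|].
  rewrite Nat.add_succ_r; apply Rle_trans with (2 := IH), hb.
assert (ub : forall n m, a m <= b n).
  intros n m; apply Rle_trans with (1 := am m n); rewrite Nat.add_comm.
  apply Rle_trans with (1 := hab _), bm.
destruct (completeness (fun r => exists n, r = a n)) as [u [U1 U2]].
- exists (b 0%nat); intros r [n ->]; apply ub.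
- now exists (a 0%nat), 0%nat.
- exists u; intros n; split; [apply U1; now exists n|].
  apply U2; intros r [m ->]; apply ub.
Qed.

(** If the property failed, it would fail on one quarter, then on a quarter of
    that quarter, and so on; these rectangles shrink to a point [(u, v)], around
    which the property holds at small scale. All rectangles have the shape [(l
    A) x (l B)], so that perimeter and diameter stay comparable to [l]; [A] or
    [B] may vanish. *)
Lemma bisection (P : R -> R -> R -> Prop) (A B x0 y0 : R) : 0 <= A -> 0 <= B ->
  (forall x y l, 0 < l ->
    P x y (l / 2) -> P (x + l / 2 * A) y (l / 2) ->
    P x (y + l / 2 * B) (l / 2) -> P (x + l / 2 * A) (y + l / 2 * B) (l / 2) ->
    P x y l) ->
  (forall u v, x0 <= u <= x0 + A -> y0 <= v <= y0 + B ->
    exists d, 0 < d /\ forall x y l, 0 < l < d ->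
      x <= u <= x + l * A -> y <= v <= y + l * B -> P x y l) ->
  P x0 y0 1.
Proof.
intros A0 B0 quarter local; apply NNPP; intros bad.
(* [good l p q]: [q] is the lower left corner of a bad quarter of the rectangle
   at [p]. *)
set (good := fun (l : R) (p q : R * R) =>
  ~ P (fst q) (snd q) (l / 2) /\
  fst p <= fst q /\ fst q + l / 2 * A <= fst p + l * A /\
  snd p <= snd q /\ snd q + l / 2 * B <= snd p + l * B).
assert (step : forall l p, 0 < l -> ~ P (fst p) (snd p) l -> exists q, good l p q).
  intros l [x y] l0 h; simpl in h.
  assert (lA : 0 <= l * A) by nra; assert (lB : 0 <= l * B) by nra.
  apply NNPP; intros no; apply h, quarter; [exact l0| | | |];
    apply NNPP; intros n; apply no;
    [exists (x, y)|exists (x + l / 2 * A, y)|exists (x, y + l / 2 * B)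
    |exists (x + l / 2 * A, y + l / 2 * B)];
    (split; [exact n|simpl; lra]).
set (sq := fix sq (n : nat) : R * R := match n with
  | O => (x0, y0) | S m => choose_or (x0, y0) (good ((/ 2) ^ m) (sq m)) end).
assert (lp : forall n, 0 < (/ 2) ^ n) by (intros n; apply pow_lt; lra).
assert (half : forall n, (/ 2) ^ S n = (/ 2) ^ n / 2) by (intros n; simpl; field).
assert (inv : forall n, ~ P (fst (sq n)) (snd (sq n)) ((/ 2) ^ n)).
  induction n as [|n IH]; [exact bad|].
  rewrite half; exact (proj1 (choose_or_spec (x0, y0) _ (step _ _ (lp n) IH))).
assert (st : forall n, good ((/ 2) ^ n) (sq n) (sq (S n))).
  intros n; exact (choose_or_spec (x0, y0) _ (step _ _ (lp n) (inv n))).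
destruct (nested_intervals (fun n => fst (sq n)) (fun n => fst (sq n) + (/ 2) ^ n * A))
  as [u Hu].
- intros n; apply (st n).
- intros n; rewrite half; apply (st n).
- intros n; assert (h := lp n); nra.
- destruct (nested_intervals (fun n => snd (sq n)) (fun n => snd (sq n) + (/ 2) ^ n * B))
    as [v Hv].
  + intros n; apply (st n).
  + intros n; rewrite half; apply (st n).
  + intros n; assert (h := lp n); nra.
  + assert (h1 := Hu 0%nat); assert (h2 := Hv 0%nat); simpl in h1, h2.
    rewrite Rmult_1_l in h1, h2.
    destruct (local u v h1 h2) as [d [d0 Hd]].
    destruct (pow_lt_1_zero (/ 2)) with (y := d) as [N HN];
      [rewrite Rabs_pos_eq; lra|exact d0|].
    specialize (HN N (Nat.le_refl N)); rewrite Rabs_pos_eq in HN by (left; apply lp).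
    apply (inv N), Hd; [|apply Hu|apply Hv].
    split; [apply lp|exact HN].
Qed.

Definition box (a : C) (r : R) (z : C) : Prop :=
  Rabs (fst z - fst a) < r /\ Rabs (snd z - snd a) < r.

(** The integral of [f dz] around a rectangle. Opposite sides are grouped so
    that an affine [f] gives constant integrands. *)
Definition rect_int (f : C -> C) (x1 x2 y1 y2 : R) : C :=
  (CRInt (fun s => f (s, y1) - f (s, y2))%C x1 x2 +
   Ci * CRInt (fun t => f (x2, t) - f (x1, t))%C y1 y2)%C.

Lemma rcont_hor (y t : R) : rcont (fun s => (s, y) : C) t.
Proof.
apply rcontP; intros e e0; exists e; split; [exact e0|]; intros s Hs.
change (Cmod ((s, y) - (t, y)) < e).
replace ((s, y) - (t, y))%C with (RtoC (s - t)).
  now rewrite Cmod_R.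
unfold RtoC, Cminus, Cplus, Copp; simpl; f_equal; ring.
Qed.

Lemma rcont_ver (x t : R) : rcont (fun s => (x, s) : C) t.
Proof.
apply rcontP; intros e e0; exists e; split; [exact e0|]; intros s Hs.
change (Cmod ((x, s) - (x, t)) < e).
replace ((x, s) - (x, t))%C with (Ci * RtoC (s - t))%C.
  now rewrite Cmod_mult, Cmod_Ci, Rmult_1_l, Cmod_R.
unfold Ci, RtoC, Cminus, Cmult, Cplus, Copp; simpl; f_equal; ring.
Qed.

Lemma Rabs_between (c r x1 x2 t : R) : Rabs (x1 - c) < r -> Rabs (x2 - c) < r ->
  Rmin x1 x2 <= t <= Rmax x1 x2 -> Rabs (t - c) < r.
Proof.
intros h1 h2 h; apply Rabs_def2 in h1; apply Rabs_def2 in h2.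
apply Rabs_def1; unfold Rmin, Rmax in h; destruct (Rle_dec x1 x2); lra.
Qed.

Section Box.

Variables (f : C -> C) (a : C) (r : R).
Hypothesis f_cont : forall z, box a r z -> ccont f z.

Let in1 (x : R) := Rabs (x - fst a) < r.
Let in2 (y : R) := Rabs (y - snd a) < r.

Lemma rcont_hor_box (y t : R) : in1 t -> in2 y -> rcont (fun s => f (s, y)) t.
Proof.
intros h1 h2; apply (rcont_comp f (fun s => (s, y)) t); [apply rcont_hor|].
apply f_cont; now split.
Qed.

Lemma rcont_ver_box (x t : R) : in1 x -> in2 t -> rcont (fun s => f (x, s)) t.
Proof.
intros h1 h2; apply (rcont_comp f (fun s => (x, s)) t); [apply rcont_ver|].
apply f_cont; now split.
Qed.

Lemma ex_CRInt_hor (y x1 x2 : R) : in1 x1 -> in1 x2 -> in2 y ->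
  ex_CRInt (fun s => f (s, y)) x1 x2.
Proof.
intros h1 h2 h3; apply ex_CRInt_cont; intros t Ht.
apply rcont_hor_box; [exact (Rabs_between _ _ _ _ _ h1 h2 Ht)|exact h3].
Qed.

Lemma ex_CRInt_ver (x y1 y2 : R) : in1 x -> in2 y1 -> in2 y2 ->
  ex_CRInt (fun s => f (x, s)) y1 y2.
Proof.
intros h1 h2 h3; apply ex_CRInt_cont; intros t Ht.
apply rcont_ver_box; [exact h1|exact (Rabs_between _ _ _ _ _ h2 h3 Ht)].
Qed.

Lemma rect_int_edges (x1 x2 y1 y2 : R) : in1 x1 -> in1 x2 -> in2 y1 -> in2 y2 ->
  rect_int f x1 x2 y1 y2 =
  (CRInt (fun s => f (s, y1)) x1 x2 - CRInt (fun s => f (s, y2)) x1 x2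
   + Ci * (CRInt (fun t => f (x2, t)) y1 y2 - CRInt (fun t => f (x1, t)) y1 y2))%C.
Proof.
intros h1 h2 h3 h4; unfold rect_int.
rewrite CRInt_minus, CRInt_minus; auto using ex_CRInt_hor, ex_CRInt_ver.
Qed.

Lemma rect_int_split_x (x1 x2 x3 y1 y2 : R) :
  in1 x1 -> in1 x2 -> in1 x3 -> in2 y1 -> in2 y2 ->
  rect_int f x1 x3 y1 y2 = (rect_int f x1 x2 y1 y2 + rect_int f x2 x3 y1 y2)%C.
Proof.
intros h1 h2 h3 h4 h5; rewrite !rect_int_edges by assumption.
rewrite <- (CRInt_Chasles (fun s => f (s, y1)) x1 x2 x3) by auto using ex_CRInt_hor.
rewrite <- (CRInt_Chasles (fun s => f (s, y2)) x1 x2 x3) by auto using ex_CRInt_hor.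
ring.
Qed.

Lemma rect_int_split_y (x1 x2 y1 y2 y3 : R) :
  in1 x1 -> in1 x2 -> in2 y1 -> in2 y2 -> in2 y3 ->
  rect_int f x1 x2 y1 y3 = (rect_int f x1 x2 y1 y2 + rect_int f x1 x2 y2 y3)%C.
Proof.
intros h1 h2 h3 h4 h5; rewrite !rect_int_edges by assumption.
rewrite <- (CRInt_Chasles (fun s => f (x1, s)) y1 y2 y3) by auto using ex_CRInt_ver.
rewrite <- (CRInt_Chasles (fun s => f (x2, s)) y1 y2 y3) by auto using ex_CRInt_ver.
ring.
Qed.

Lemma rect_int_swap_x (x1 x2 y1 y2 : R) : in1 x1 -> in1 x2 -> in2 y1 -> in2 y2 ->
  rect_int f x2 x1 y1 y2 = (- rect_int f x1 x2 y1 y2)%C.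
Proof.
intros h1 h2 h3 h4; rewrite !rect_int_edges by assumption.
rewrite (CRInt_swap (fun s => f (s, y1)) x1 x2) by auto using ex_CRInt_hor.
rewrite (CRInt_swap (fun s => f (s, y2)) x1 x2) by auto using ex_CRInt_hor.
ring.
Qed.

Lemma rect_int_swap_y (x1 x2 y1 y2 : R) : in1 x1 -> in1 x2 -> in2 y1 -> in2 y2 ->
  rect_int f x1 x2 y2 y1 = (- rect_int f x1 x2 y1 y2)%C.
Proof.
intros h1 h2 h3 h4; rewrite !rect_int_edges by assumption.
rewrite (CRInt_swap (fun s => f (x1, s)) y1 y2) by auto using ex_CRInt_ver.
rewrite (CRInt_swap (fun s => f (x2, s)) y1 y2) by auto using ex_CRInt_ver.
ring.
Qed.

(** Affine functions have integral zero around a rectangle, so an affine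
    approximation of [f] can be subtracted for free; this is where
    differentiability enters [goursat]. *)
Lemma rect_int_bound (c m : C) (x1 x2 y1 y2 M : R) :
  in1 x1 -> in1 x2 -> in2 y1 -> in2 y2 ->
  (forall s t, Rmin x1 x2 <= s <= Rmax x1 x2 -> Rmin y1 y2 <= t <= Rmax y1 y2 ->
    Cmod (f (s, t) - c - (s, t) * m) <= M) ->
  Cmod (rect_int f x1 x2 y1 y2) <= (Rabs (x2 - x1) + Rabs (y2 - y1)) * (2 * M).
Proof.
intros h1 h2 h3 h4 h.
assert (E : rect_int f x1 x2 y1 y2 =
  ((CRInt (fun s => f (s, y1) - f (s, y2))%C x1 x2
     - RtoC (x2 - x1) * (((0, y1) - (0, y2)) * m)) +
   Ci * (CRInt (fun t => f (x2, t) - f (x1, t))%C y1 y2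
     - RtoC (y2 - y1) * (((x2, 0) - (x1, 0)) * m)))%C).
  unfold rect_int.
  replace ((0, y1) - (0, y2))%C with (Ci * RtoC (y1 - y2))%C
    by (unfold Ci, RtoC, Cminus, Cmult, Cplus, Copp; simpl; f_equal; ring).
  replace ((x2, 0) - (x1, 0))%C with (RtoC (x2 - x1))
    by (unfold Ci, RtoC, Cminus, Cmult, Cplus, Copp; simpl; f_equal; ring).
  rewrite !RtoC_minus; ring.
rewrite E; apply Rle_trans with (1 := Cmod_triangle _ _).
rewrite Cmod_mult, Cmod_Ci, Rmult_1_l, Rmult_plus_distr_r.
assert (my : forall u v, Rmin u v <= u <= Rmax u v /\ Rmin u v <= v <= Rmax u v).
  intros u v; unfold Rmin, Rmax; destruct (Rle_dec u v); lra.
destruct (my x1 x2) as [mx1 mx2]; destruct (my y1 y2) as [my1 my2].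
apply Rplus_le_compat; apply CRInt_near_const.
- intros s Hs.
  replace (f (s, y1) - f (s, y2) - ((0, y1) - (0, y2)) * m)%C with
    ((f (s, y1) - c - (s, y1) * m) - (f (s, y2) - c - (s, y2) * m))%C.
  + unfold Cminus at 1; apply Rle_trans with (1 := Cmod_triangle _ _).
    rewrite Cmod_opp; assert (k1 := h s y1 Hs my1); assert (k2 := h s y2 Hs my2); lra.
  + replace ((0, y1) - (0, y2))%C with ((s, y1) - (s, y2))%C; [ring|].
    unfold Cminus, Cplus, Copp; simpl; f_equal; ring.
- apply (ex_RInt_minus (V := C_R_NormedModule)); auto using ex_CRInt_hor.
- intros t Ht.
  replace (f (x2, t) - f (x1, t) - ((x2, 0) - (x1, 0)) * m)%C with
    ((f (x2, t) - c - (x2, t) * m) - (f (x1, t) - c - (x1, t) * m))%C.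
  + unfold Cminus at 1; apply Rle_trans with (1 := Cmod_triangle _ _).
    rewrite Cmod_opp; assert (k1 := h x1 t mx1 Ht); assert (k2 := h x2 t mx2 Ht); lra.
  + replace ((x2, 0) - (x1, 0))%C with ((x2, t) - (x1, t))%C; [ring|].
    unfold Cminus, Cplus, Copp; simpl; f_equal; ring.
- apply (ex_RInt_minus (V := C_R_NormedModule)); auto using ex_CRInt_ver.
Qed.

(** Goursat's bisection argument: around a point the error of the affine
    approximation is at most [e] times the diameter, so the integral around a
    small rectangle is of order [e] times the square of its size, and such
    bounds add up under bisection. *)
Lemma goursat (x1 x2 y1 y2 : R) : in1 x1 -> in1 x2 -> in2 y1 -> in2 y2 ->
  x1 <= x2 -> y1 <= y2 ->
  (forall s t, x1 <= s <= x2 -> y1 <= t <= y2 -> cdiff f (s, t)) ->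
  rect_int f x1 x2 y1 y2 = RtoC 0.
Proof.
intros h1 h2 h3 h4 hx hy hd.
set (A := x2 - x1); set (B := y2 - y1).
assert (A0 : 0 <= A) by (unfold A; lra); assert (B0 : 0 <= B) by (unfold B; lra).
apply Cmod_small_eq0 with (K := 2 * (A + B) ^ 2); [nra|]; intros e e0.
set (P := fun x y l => x1 <= x /\ x + l * A <= x2 -> y1 <= y /\ y + l * B <= y2 ->
  Cmod (rect_int f x (x + l * A) y (y + l * B)) <= 2 * (A + B) ^ 2 * e * l ^ 2).
assert (sub1 : forall x, x1 <= x <= x2 -> in1 x).
  intros x Hx; unfold in1 in *; apply Rabs_def2 in h1; apply Rabs_def2 in h2.
  apply Rabs_def1; lra.
assert (sub2 : forall y, y1 <= y <= y2 -> in2 y).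
  intros y Hy; unfold in2 in *; apply Rabs_def2 in h3; apply Rabs_def2 in h4.
  apply Rabs_def1; lra.
assert (main : P x1 y1 1).
  apply (bisection P A B x1 y1 A0 B0).
  - intros x y l l0 q1 q2 q3 q4 Hx Hy.
    assert (lA : 0 <= l * A) by nra; assert (lB : 0 <= l * B) by nra.
    rewrite (rect_int_split_x x (x + l / 2 * A) (x + l * A)) by (first [apply sub1|apply sub2]; lra).
    rewrite !(rect_int_split_y _ _ y (y + l / 2 * B) (y + l * B)) by (first [apply sub1|apply sub2]; lra).
    specialize (q1 ltac:(lra) ltac:(lra)); specialize (q2 ltac:(lra) ltac:(lra)).
    specialize (q3 ltac:(lra) ltac:(lra)); specialize (q4 ltac:(lra) ltac:(lra)).
    replace (x + l / 2 * A + l / 2 * A) with (x + l * A) in q2, q4 by lra.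
    replace (y + l / 2 * B + l / 2 * B) with (y + l * B) in q3, q4 by lra.
    apply Rle_trans with (1 := Cmod_triangle _ _).
    eapply Rle_trans; [apply Rplus_le_compat; apply Cmod_triangle|].
    nra.
  - intros u v Hu Hv.
    destruct (hd u v) as [m Hm]; [unfold A in Hu; lra|unfold B in Hv; lra|].
    destruct (proj1 (cderiveP f (u, v) m) Hm e e0) as [d [d0 Hd]].
    exists (d / (A + B + 1)); split; [apply Rdiv_lt_0_compat; lra|].
    intros x y l Hl Hx Hy Gx Gy.
    assert (lA : 0 <= l * A) by nra; assert (lB : 0 <= l * B) by nra.
    assert (ld : l * (A + B) < d).
      assert (k : l * (A + B + 1) < d).
        apply Rmult_lt_reg_r with (/ (A + B + 1)); [apply Rinv_0_lt_compat; lra|].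
        rewrite Rmult_assoc, Rinv_r by lra; unfold Rdiv in Hl; lra.
      nra.
    apply Rle_trans with ((Rabs (x + l * A - x) + Rabs (y + l * B - y)) * (2 * (e * (l * (A + B))))).
    + apply rect_int_bound with (c := (f (u, v) - (u, v) * m)%C) (m := m);
        try (first [apply sub1|apply sub2]; lra).
      intros s t Hs Ht.
      rewrite Rmin_left, Rmax_right in Hs by lra; rewrite Rmin_left, Rmax_right in Ht by lra.
      replace (f (s, t) - (f (u, v) - (u, v) * m) - (s, t) * m)%C with
        (f (s, t) - f (u, v) - ((s, t) - (u, v)) * m)%C by ring.
      assert (near : Cmod ((s, t) - (u, v)) <= l * (A + B)).
        change ((s, t) - (u, v))%C with (s - u, t - v).
        apply Rle_trans with (1 := Cmod_le_sum _ _).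
        assert (Rabs (s - u) <= l * A) by (apply Rabs_le; lra).
        assert (Rabs (t - v) <= l * B) by (apply Rabs_le; lra).
        lra.
      apply Rle_trans with (1 := Hd (s, t) ltac:(lra)).
      apply Rmult_le_compat_l; lra.
    + replace (x + l * A - x) with (l * A) by ring.
      replace (y + l * B - y) with (l * B) by ring.
      rewrite !Rabs_pos_eq by assumption; right; ring.
unfold P, A, B in main.
replace (x1 + 1 * (x2 - x1)) with x2 in main by ring.
replace (y1 + 1 * (y2 - y1)) with y2 in main by ring.
fold A B in main; specialize (main ltac:(lra) ltac:(lra)); lra.
Qed.

End Box.

(** * Primitives on boxes *)

Lemma box_open (a : C) (r : R) (z : C) : box a r z ->
  exists d, 0 < d /\ forall w, Cmod (w - z) < d -> box a r w.
Proof.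
intros [h1 h2].
exists (Rmin (r - Rabs (fst z - fst a)) (r - Rabs (snd z - snd a))).
split; [apply Rmin_glb_lt; lra|]; intros w Hw.
assert (k1 := Rlt_le_trans _ _ _ Hw (Rmin_l _ _)).
assert (k2 := Rlt_le_trans _ _ _ Hw (Rmin_r _ _)).
assert (k3 := Rabs_fst_le (w - z)); assert (k4 := Rabs_snd_le (w - z)).
change (fst (w - z)%C) with (fst w - fst z) in k3.
change (snd (w - z)%C) with (snd w - snd z) in k4.
split.
- replace (fst w - fst a) with ((fst w - fst z) + (fst z - fst a)) by ring.
  apply Rle_lt_trans with (1 := Rabs_triang _ _); lra.
- replace (snd w - snd a) with ((snd w - snd z) + (snd z - snd a)) by ring.
  apply Rle_lt_trans with (1 := Rabs_triang _ _); lra.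
Qed.

Section Primitive.

Variables (f : C -> C) (a : C) (r : R) (p : C).
Hypothesis f_cont : forall z, box a r z -> ccont f z.
Hypothesis f_diff : forall z, box a r z -> z <> p -> cdiff f z.
Hypothesis p_box : box a r p.

Let in1 (x : R) := Rabs (x - fst a) < r.
Let in2 (y : R) := Rabs (y - snd a) < r.

Lemma goursat_signed (x1 x2 y1 y2 : R) :
  in1 x1 -> in1 x2 -> in2 y1 -> in2 y2 ->
  (forall s t, Rmin x1 x2 <= s <= Rmax x1 x2 -> Rmin y1 y2 <= t <= Rmax y1 y2 ->
     (s, t) <> p) ->
  rect_int f x1 x2 y1 y2 = RtoC 0.
Proof.
intros h1 h2 h3 h4 avoid.
assert (D : forall s t, Rmin x1 x2 <= s <= Rmax x1 x2 ->
    Rmin y1 y2 <= t <= Rmax y1 y2 -> cdiff f (s, t)).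
  intros s t Hs Ht; apply f_diff; [|now apply avoid]; split;
    [exact (Rabs_between _ _ _ _ _ h1 h2 Hs)|exact (Rabs_between _ _ _ _ _ h3 h4 Ht)].
assert (o : RtoC 0 = (- RtoC 0)%C) by ring.
destruct (Rle_dec x1 x2) as [hx|hx]; destruct (Rle_dec y1 y2) as [hy|hy].
- rewrite Rmin_left, Rmax_right, (Rmin_left y1), (Rmax_right y1) in D by lra.
  now apply (goursat f a r).
- rewrite Rmin_left, Rmax_right, (Rmin_right y1), (Rmax_left y1) in D by lra.
  rewrite (rect_int_swap_y f a r f_cont x1 x2 y2 y1) by assumption; rewrite o; f_equal.
  apply (goursat f a r); try assumption; lra.
- rewrite Rmin_right, Rmax_left, (Rmin_left y1), (Rmax_right y1) in D by lra.
  rewrite (rect_int_swap_x f a r f_cont x2 x1 y1 y2) by assumption; rewrite o; f_equal.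
  apply (goursat f a r); try assumption; lra.
- rewrite Rmin_right, Rmax_left, (Rmin_right y1), (Rmax_left y1) in D by lra.
  rewrite (rect_int_swap_x f a r f_cont x2 x1 y1 y2) by assumption; rewrite o; f_equal.
  rewrite (rect_int_swap_y f a r f_cont x2 x1 y2 y1) by assumption; rewrite o; f_equal.
  apply (goursat f a r); try assumption; lra.
Qed.

Lemma toward_between (u v e t : R) : 0 < e < 1 -> u <> v ->
  Rmin (u + e * (v - u)) v <= t <= Rmax (u + e * (v - u)) v -> t <> u.
Proof.
intros e01 n h E; subst t.
unfold Rmin, Rmax in h; destruct (Rle_dec (u + e * (v - u)) v);
  destruct (Rtotal_order u v) as [k|[k|k]]; nra.
Qed.

(** An exceptional point at the corner is harmless: cutting off a small
    rectangle at that corner leaves two rectangles that avoid it, and the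
    integral around the small one tends to zero because [f] is bounded near [p].
    *)
Lemma goursat_corner (x y : R) : in1 x -> in2 y ->
  rect_int f (fst p) x (snd p) y = RtoC 0.
Proof.
assert (Ep : p = (fst p, snd p)) by apply surjective_pairing.
set (p1 := fst p) in *; set (p2 := snd p) in *.
assert (b1 : in1 p1) by apply p_box; assert (b2 : in2 p2) by apply p_box.
intros h1 h2.
assert (nul : forall z : C, z = (- z)%C -> z = RtoC 0).
  intros z hz; assert (k : (RtoC 2 * z = 0)%C).
    replace (RtoC 2 * z)%C with (z + z)%C
      by (replace (RtoC 2) with (RtoC 1 + RtoC 1)%C by (rewrite <- RtoC_plus; f_equal; ring); ring).
    rewrite hz at 1; ring.
  destruct (Ceq_dec z 0) as [e|n]; [exact e|].
  exfalso; apply (Cmult_neq_0 (RtoC 2) z); [|exact n|exact k].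
  intros q; injection q; lra.
destruct (Req_dec x p1) as [->|nx].
  apply nul, (rect_int_swap_x f a r); assumption.
destruct (Req_dec y p2) as [->|ny].
  apply nul, (rect_int_swap_y f a r); assumption.
destruct (proj1 (ccontP f (p1, p2)) (f_cont (p1, p2) (conj b1 b2)) 1 Rlt_0_1) as [d [d0 Hd]].
set (S := Rabs (x - p1) + Rabs (y - p2)).
assert (S0 : 0 < S).
  assert (k := Rabs_pos_lt (x - p1) ltac:(lra)); assert (k' := Rabs_pos (y - p2)); unfold S; lra.
set (M := Cmod (f (p1, p2)) + 1).
assert (M0 : 0 < M) by (assert (k := Cmod_ge_0 (f (p1, p2))); unfold M; lra).
set (e0 := Rmin (/ 2) (d / (2 * S))).
assert (e00 : 0 < e0) by (apply Rmin_glb_lt; [lra|apply Rdiv_lt_0_compat; lra]).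
assert (bnd : forall e, 0 < e <= e0 -> Cmod (rect_int f p1 x p2 y) <= 2 * S * M * e).
  intros e He.
  assert (e1 : e <= / 2) by (apply Rle_trans with (1 := proj2 He), Rmin_l).
  assert (eS : e * S < d).
    assert (k : e <= d / (2 * S)) by (apply Rle_trans with (1 := proj2 He), Rmin_r).
    apply (Rmult_le_compat_r S) in k; [|lra].
    replace (d / (2 * S) * S) with (d / 2) in k by (field; lra); lra.
  set (x' := p1 + e * (x - p1)); set (y' := p2 + e * (y - p2)).
  assert (bx : Rmin p1 x <= x' <= Rmax p1 x).
    unfold x', Rmin, Rmax; destruct (Rle_dec p1 x); nra.
  assert (by' : Rmin p2 y <= y' <= Rmax p2 y).
    unfold y', Rmin, Rmax; destruct (Rle_dec p2 y); nra.
  assert (ix := Rabs_between _ _ _ _ _ b1 h1 bx).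
  assert (iy := Rabs_between _ _ _ _ _ b2 h2 by').
  rewrite (rect_int_split_x f a r f_cont p1 x' x) by assumption.
  rewrite (rect_int_split_y f a r f_cont p1 x' p2 y' y) by assumption.
  rewrite (goursat_signed p1 x' y' y), (goursat_signed x' x p2 y); try assumption.
  + replace (rect_int f p1 x' p2 y' + 0 + 0)%C with (rect_int f p1 x' p2 y') by ring.
    apply Rle_trans with ((Rabs (x' - p1) + Rabs (y' - p2)) * (2 * M)).
    * apply (rect_int_bound f a r f_cont (RtoC 0) (RtoC 0)); try assumption.
      intros s t Hs Ht; replace (f (s, t) - 0 - (s, t) * 0)%C with (f (s, t)) by ring.
      assert (near : Cmod ((s, t) - (p1, p2)) < d).
        apply Rle_lt_trans with (2 := eS).
        change ((s, t) - (p1, p2))%C with (s - p1, t - p2).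
        apply Rle_trans with (1 := Cmod_le_sum _ _).
        assert (k1 : Rabs (s - p1) <= e * Rabs (x - p1)).
          rewrite <- (Rabs_pos_eq e) by lra; rewrite <- Rabs_mult.
          replace (e * (x - p1)) with (x' - p1) by (unfold x'; ring).
          unfold Rmin, Rmax in Hs; destruct (Rle_dec p1 x').
            rewrite !Rabs_pos_eq; lra.
          rewrite !Rabs_left1; lra.
        assert (k2 : Rabs (t - p2) <= e * Rabs (y - p2)).
          rewrite <- (Rabs_pos_eq e) by lra; rewrite <- Rabs_mult.
          replace (e * (y - p2)) with (y' - p2) by (unfold y'; ring).
          unfold Rmin, Rmax in Ht; destruct (Rle_dec p2 y').
            rewrite !Rabs_pos_eq; lra.
          rewrite !Rabs_left1; lra.
        unfold S; lra.
      assert (k := Hd (s, t) near); assert (k' := Cmod_triangle_inv (f (s, t)) (f (p1, p2))).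
      apply Rabs_le_between in k'; unfold M; lra.
    * replace (x' - p1) with (e * (x - p1)) by (unfold x'; ring).
      replace (y' - p2) with (e * (y - p2)) by (unfold y'; ring).
      rewrite !Rabs_mult, (Rabs_pos_eq e) by lra; right; unfold S; ring.
  + intros s t Hs _ E; rewrite Ep in E; injection E as E1 E2; revert E1; apply (toward_between p1 x e); auto; lra.
  + intros s t _ Ht E; rewrite Ep in E; injection E as E1 E2; revert E2; apply (toward_between p2 y e); auto; lra.
apply Cmod_small_eq0 with (K := 2 * S * M); [repeat apply Rmult_le_pos; lra|].
intros e He; apply Rle_trans with (1 := bnd (Rmin e e0) (conj (Rmin_glb_lt _ _ _ He e00) (Rmin_r _ _))).
apply Rmult_le_compat_l; [repeat apply Rmult_le_pos; lra|apply Rmin_l].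
Qed.

(** The primitive at [w] is the integral from [p] to [w], first horizontally and
    then vertically. Starting at the exceptional point makes every rectangle
    involved have [p] as a corner, and [goursat_corner] allows the two legs to
    be exchanged. *)
Lemma primitive_on_box : exists F : C -> C, forall z, box a r z -> cderive F z (f z).
Proof.
set (p1 := fst p); set (p2 := snd p).
set (F := fun w : C => (CRInt (fun s => f (s, p2)) p1 (fst w) +
  Ci * CRInt (fun t => f (fst w, t)) p2 (snd w))%C).
assert (b1 : in1 p1) by apply p_box; assert (b2 : in2 p2) by apply p_box.
assert (other : forall x y, in1 x -> in2 y -> F (x, y) =
  (CRInt (fun s => f (s, y)) p1 x + Ci * CRInt (fun t => f (p1, t)) p2 y)%C).
  intros x y hx hy; assert (h := goursat_corner x y hx hy); fold p1 p2 in h.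
  rewrite (rect_int_edges f a r f_cont) in h by assumption.
  unfold F; simpl; rewrite <- (Cplus_0_r (_ + Ci * CRInt (fun t => f (p1, t)) p2 y)), <- h; ring.
exists F; intros [x y] [hx hy]; simpl in hx, hy.
apply cderiveP; intros e e0.
assert (bxy : box a r (x, y)) by (split; assumption).
destruct (proj1 (ccontP f (x, y)) (f_cont _ bxy) (e / 2) ltac:(lra)) as [d1 [d10 H1]].
destruct (box_open a r (x, y) bxy) as [d2 [d20 H2]].
exists (Rmin (d1 / 2) d2); split; [apply Rmin_glb_lt; lra|].
intros [x' y'] Hw.
assert (k1 := Rlt_le_trans _ _ _ Hw (Rmin_l _ _)).
assert (k2 := Rlt_le_trans _ _ _ Hw (Rmin_r _ _)).
destruct (H2 _ k2) as [hx' hy']; simpl in hx', hy'.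
assert (m1 := Rabs_fst_le ((x', y') - (x, y))); assert (m2 := Rabs_snd_le ((x', y') - (x, y))).
simpl in m1, m2; change (x' + - x) with (x' - x) in m1; change (y' + - y) with (y' - y) in m2.
set (D := Cmod ((x', y') - (x, y))) in *.
assert (E : (F (x', y') - F (x, y) - ((x', y') - (x, y)) * f (x, y) =
  (CRInt (fun s => f (s, y')) x x' - RtoC (x' - x) * f (x, y)) +
  Ci * (CRInt (fun t => f (x, t)) y y' - RtoC (y' - y) * f (x, y)))%C).
  assert (e1 : F (x', y') = (F (x, y') + CRInt (fun s => f (s, y')) x x')%C).
    rewrite (other x' y'), (other x y') by assumption.
    rewrite <- (CRInt_Chasles (fun s => f (s, y')) p1 x x') by (apply (ex_CRInt_hor f a r); assumption).
    ring.
  assert (e2 : F (x, y') = (F (x, y) + Ci * CRInt (fun t => f (x, t)) y y')%C).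
    unfold F; simpl.
    rewrite <- (CRInt_Chasles (fun t => f (x, t)) p2 y y') by (apply (ex_CRInt_ver f a r); assumption).
    ring.
  rewrite e1, e2.
  replace ((x', y') - (x, y))%C with (RtoC (x' - x) + Ci * RtoC (y' - y))%C; [ring|].
  unfold Ci, RtoC, Cminus, Cmult, Cplus, Copp; simpl; f_equal; ring.
rewrite E; apply Rle_trans with (1 := Cmod_triangle _ _).
rewrite Cmod_mult, Cmod_Ci, Rmult_1_l.
assert (near : forall s t, Rabs (s - x) <= D -> Rabs (t - y) <= D ->
    Cmod (f (s, t) - f (x, y)) <= e / 2).
  intros s t h3 h4; left; apply H1.
  change ((s, t) - (x, y))%C with (s - x, t - y).
  apply Rle_lt_trans with (1 := Cmod_le_sum _ _); lra.
assert (D0 : 0 <= D) by apply Cmod_ge_0.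
assert (btw : forall u v s, Rmin u v <= s <= Rmax u v -> Rabs (s - u) <= Rabs (v - u)).
  intros u v s h; unfold Rmin, Rmax in h; destruct (Rle_dec u v).
    rewrite !Rabs_pos_eq; lra.
  rewrite !Rabs_left1; lra.
apply Rle_trans with (Rabs (x' - x) * (e / 2) + Rabs (y' - y) * (e / 2)); [|nra].
apply Rplus_le_compat; apply CRInt_near_const.
- intros s Hs; apply near; [apply Rle_trans with (2 := m1); now apply btw|exact m2].
- apply (ex_CRInt_hor f a r); assumption.
- intros s Hs; apply near; [rewrite Rminus_diag, Rabs_R0; exact D0|].
  apply Rle_trans with (2 := m2); now apply btw.
- apply (ex_CRInt_ver f a r); assumption.
Qed.

End Primitive.

(** * Integrals along lists of arcs *)

Definition arc_int (a : arc) (h : C -> C) : C :=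
  CRInt (fun t => h (arc_fun a t) * arc_der a t)%C 0 1.

Definition line_int (L : list arc) (h : C -> C) : C :=
  fold_right (fun a s => (arc_int a h + s)%C) (RtoC 0) L.

(** The analogue of [trace] for a flat list of arcs; integrals do not see how
    the arcs are grouped into closed paths. *)
Definition on_arcs (L : list arc) (z : C) : Prop :=
  exists a t, In a L /\ 0 <= t <= 1 /\ z = arc_fun a t.

Definition cont_on (L : list arc) (h : C -> C) : Prop := forall z, on_arcs L z -> ccont h z.

Lemma on_arcs_head (a : arc) (L : list arc) (t : R) : 0 <= t <= 1 -> on_arcs (a :: L) (arc_fun a t).
Proof. intros h; exists a, t; split; [now left|split; [exact h|reflexivity]]. Qed.

Lemma on_arcs_tail (a : arc) (L : list arc) (z : C) : on_arcs L z -> on_arcs (a :: L) z.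
Proof. intros [b [t [h1 h2]]]; exists b, t; split; [now right|exact h2]. Qed.

Lemma cont_on_tail (a : arc) (L : list arc) (h : C -> C) : cont_on (a :: L) h -> cont_on L h.
Proof. intros hc z hz; apply hc, on_arcs_tail, hz. Qed.

Lemma arc_rcont (a : arc) (t : R) : rcont (arc_fun a) t.
Proof. exact (rderive_cont _ _ _ (arc_is_derive a t)). Qed.

Lemma arc_der_rcont (a : arc) (t : R) : rcont (arc_der a) t.
Proof. exact (arc_der_continuous a t). Qed.

Lemma integrand_rcont (a : arc) (L : list arc) (h : C -> C) (t : R) :
  cont_on (a :: L) h -> 0 <= t <= 1 ->
  rcont (fun t => h (arc_fun a t) * arc_der a t)%C t.
Proof.
intros hc ht; apply rcont_mult; [|apply arc_der_rcont].
apply rcont_comp; [apply arc_rcont|apply hc, on_arcs_head, ht].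
Qed.

Lemma unit_interval (t : R) : Rmin 0 1 <= t <= Rmax 0 1 -> 0 <= t <= 1.
Proof. rewrite Rmin_left, Rmax_right by lra; auto. Qed.

Lemma arc_int_ex (a : arc) (L : list arc) (h : C -> C) : cont_on (a :: L) h ->
  ex_CRInt (fun t => h (arc_fun a t) * arc_der a t)%C 0 1.
Proof.
intros hc; apply ex_CRInt_cont; intros t Ht.
apply (integrand_rcont a L); [exact hc|now apply unit_interval].
Qed.

Lemma line_int_ext (L : list arc) (g h : C -> C) :
  (forall z, on_arcs L z -> g z = h z) -> line_int L g = line_int L h.
Proof.
induction L as [|a L IH]; intros e; [reflexivity|]; simpl; f_equal.
- apply CRInt_ext; intros t Ht; rewrite (e (arc_fun a t)); [reflexivity|].
  apply on_arcs_head, unit_interval, Ht.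
- apply IH; intros z hz; apply e, on_arcs_tail, hz.
Qed.

Lemma line_int_plus (L : list arc) (g h : C -> C) : cont_on L g -> cont_on L h ->
  line_int L (fun z => g z + h z)%C = (line_int L g + line_int L h)%C.
Proof.
induction L as [|a L IH]; intros hg hh; simpl; [ring|].
rewrite IH by (eapply cont_on_tail; eassumption).
replace (arc_int a (fun z => g z + h z)%C) with (arc_int a g + arc_int a h)%C; [ring|].
unfold arc_int; rewrite <- CRInt_plus by (eapply arc_int_ex; eassumption).
apply CRInt_ext; intros t _; ring.
Qed.

Lemma line_int_minus (L : list arc) (g h : C -> C) : cont_on L g -> cont_on L h ->
  line_int L (fun z => g z - h z)%C = (line_int L g - line_int L h)%C.
Proof.
induction L as [|a L IH]; intros hg hh; simpl; [ring|].
rewrite IH by (eapply cont_on_tail; eassumption).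
replace (arc_int a (fun z => g z - h z)%C) with (arc_int a g - arc_int a h)%C; [ring|].
unfold arc_int; rewrite <- CRInt_minus by (eapply arc_int_ex; eassumption).
apply CRInt_ext; intros t _; ring.
Qed.

Lemma line_int_scal (L : list arc) (c : C) (h : C -> C) : cont_on L h ->
  line_int L (fun z => c * h z)%C = (c * line_int L h)%C.
Proof.
induction L as [|a L IH]; intros hh; simpl; [ring|].
rewrite IH by (eapply cont_on_tail; eassumption).
replace (arc_int a (fun z => c * h z)%C) with (c * arc_int a h)%C; [ring|].
unfold arc_int; rewrite <- CRInt_scal by (eapply arc_int_ex; eassumption).
apply CRInt_ext; intros t _; ring.
Qed.

(** The constant depends on the arcs only, so that it serves for all integrands
    at once. *)
Lemma line_int_bound (L : list arc) : exists B, 0 <= B /\ forall h M, 0 <= M ->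
  cont_on L h -> (forall z, on_arcs L z -> Cmod (h z) <= M) -> Cmod (line_int L h) <= B * M.
Proof.
induction L as [|a L [B [B0 IH]]].
- exists 0; split; [lra|]; intros h M M0 _ _; simpl; rewrite Cmod_0; lra.
- destruct (rcont_bounded (arc_der a)) as [D [D0 HD]]; [intros; apply arc_der_rcont|].
  exists (D + B); split; [lra|]; intros h M M0 hc hM; simpl.
  apply Rle_trans with (1 := Cmod_triangle _ _); rewrite Rmult_plus_distr_r.
  apply Rplus_le_compat.
  + replace (D * M) with (Rabs (1 - 0) * (M * D)) by (rewrite Rminus_0_r, Rabs_R1; ring).
    apply CRInt_bound; [|exact (arc_int_ex a L h hc)].
    intros t Ht; apply unit_interval in Ht; rewrite Cmod_mult.
    apply Rmult_le_compat; try apply Cmod_ge_0; [|now apply HD].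
    apply hM, on_arcs_head, Ht.
  + apply IH; [exact M0|eapply cont_on_tail; eassumption|].
    intros z hz; apply hM, on_arcs_tail, hz.
Qed.

Lemma cont_on_bounded (L : list arc) (h : C -> C) : cont_on L h ->
  exists M, 0 <= M /\ forall z, on_arcs L z -> Cmod (h z) <= M.
Proof.
induction L as [|a L IH]; intros hc.
- exists 0; split; [lra|]; intros z [b [t [[] _]]].
- destruct (IH (cont_on_tail _ _ _ hc)) as [M [M0 HM]].
  destruct (rcont_bounded (fun t => h (arc_fun a t))) as [N [N0 HN]].
    intros t Ht; apply rcont_comp; [apply arc_rcont|apply hc, on_arcs_head, Ht].
  exists (M + N); split; [lra|]; intros z [b [t [[<-|hb] [ht ->]]]].
  + specialize (HN t ht); lra.
  + assert (k : Cmod (h (arc_fun b t)) <= M) by (apply HM; exists b, t; auto); lra.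
Qed.

(** The reciprocal [1 / (w - z)] is continuous, hence bounded, on the arcs. *)
Lemma on_arcs_dist (L : list arc) (z : C) : ~ on_arcs L z ->
  exists d, 0 < d /\ forall w, on_arcs L w -> d <= Cmod (w - z).
Proof.
intros nz.
assert (ne : forall w, on_arcs L w -> w <> z) by (intros w hw ->; exact (nz hw)).
destruct (cont_on_bounded L (fun w => / (w - z))%C) as [M [M0 HM]].
  intros w hw; apply cdiff_cont, cdiff_inv; [|apply Cminus_neq0, ne, hw].
  apply cdiff_minus; [apply cdiff_id|apply cdiff_const].
exists (/ (M + 1)); split; [apply Rinv_0_lt_compat; lra|]; intros w hw.
specialize (HM w hw); rewrite Cmod_inv in HM by (apply Cminus_neq0, ne, hw).
assert (p := Cmod_minus_pos _ _ (ne w hw)).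
rewrite <- (Rinv_inv (Cmod (w - z))); apply Rinv_le_contravar; [|lra].
now apply Rinv_0_lt_compat.
Qed.

Lemma line_int_app (L1 L2 : list arc) (h : C -> C) :
  line_int (L1 ++ L2) h = (line_int L1 h + line_int L2 h)%C.
Proof. induction L1 as [|a L IH]; simpl; [|rewrite IH]; ring. Qed.

Lemma line_int_primitive_path (F h : C -> C) (L : list arc) (z w : C) : cont_on L h ->
  (forall u, on_arcs L u -> cderive F u (h u)) -> joins z w L -> line_int L h = (F w - F z)%C.
Proof.
revert z; induction L as [|a L IH]; simpl; intros z hc hF.
- intros ->; ring.
- intros [ez j]; rewrite (IH (arc_fun a 1)); [|eapply cont_on_tail; eassumption| |exact j].
  + replace (arc_int a h) with (F (arc_fun a 1) - F (arc_fun a 0))%C; [rewrite ez; ring|].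
    symmetry; unfold arc_int.
    rewrite (CRInt_ext _ (fun t => arc_der a t * h (arc_fun a t))%C) by (intros; ring).
    apply (CRInt_derive (fun t => F (arc_fun a t))); intros t Ht; apply unit_interval in Ht.
    * apply rderive_comp; [apply hF, on_arcs_head, Ht|exact (arc_is_derive a t)].
    * apply rcont_mult; [apply arc_der_rcont|].
      apply rcont_comp; [apply arc_rcont|apply hc, on_arcs_head, Ht].
  + intros u hu; apply hF, on_arcs_tail, hu.
Qed.

Lemma line_int_primitive (F h : C -> C) (G : list (list arc)) : cont_on (concat G) h ->
  (forall u, on_arcs (concat G) u -> cderive F u (h u)) ->
  (forall p, In p G -> closed_path p) -> line_int (concat G) h = RtoC 0.
Proof.
induction G as [|p G IH]; simpl; intros hc hF cl; [reflexivity|].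
assert (l : forall u, on_arcs p u -> on_arcs (p ++ concat G) u).
  intros u [a [t [h1 h2]]]; exists a, t; split; [apply in_or_app; now left|exact h2].
assert (r : forall u, on_arcs (concat G) u -> on_arcs (p ++ concat G) u).
  intros u [a [t [h1 h2]]]; exists a, t; split; [apply in_or_app; now right|exact h2].
rewrite line_int_app, IH; [|intros u hu; apply hc, r, hu|intros u hu; apply hF, r, hu|auto].
destruct (cl p (or_introl eq_refl)) as [z j].
rewrite (line_int_primitive_path F h p z z); [ring| | |exact j].
- intros u hu; apply hc, l, hu.
- intros u hu; apply hF, l, hu.
Qed.

(** Differentiation under the integral sign, from a Taylor estimate of order two
    that is uniform along the arcs. A quadratic remainder is available in both
    uses, namely for the Cauchy kernel and for divided differences. *)
Lemma line_int_param_derive (L : list arc) (phi : C -> C -> C) (psi : C -> C)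
    (z : C) (d M : R) : 0 < d ->
  (forall z', Cmod (z' - z) < d -> cont_on L (phi z')) -> cont_on L psi ->
  (forall z' w, Cmod (z' - z) < d -> on_arcs L w ->
    Cmod (phi z' w - phi z w - (z' - z) * psi w) <= M * Cmod (z' - z) ^ 2) ->
  cderive (fun u => line_int L (phi u)) z (line_int L psi).
Proof.
intros d0 hphi hpsi hM.
destruct (line_int_bound L) as [B [B0 HB]].
set (N := Rmax M 0).
assert (N0 : 0 <= N) by apply Rmax_r.
apply cderiveP; intros e e0.
exists (Rmin d (e / (B * N + 1))); split.
  apply Rmin_glb_lt; [exact d0|]; apply Rdiv_lt_0_compat; nra.
intros z' hz.
assert (h1 := Rlt_le_trans _ _ _ hz (Rmin_l _ _)).
assert (h2 := Rlt_le_trans _ _ _ hz (Rmin_r _ _)).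
assert (cz : cont_on L (phi z)).
  apply hphi; replace (z - z)%C with (RtoC 0) by ring; now rewrite Cmod_0.
assert (c1 : cont_on L (fun w => phi z' w - phi z w)%C)
  by (intros w hw; apply ccont_minus; [now apply hphi|now apply cz]).
assert (c2 : cont_on L (fun w => (z' - z) * psi w)%C)
  by (intros w hw; apply ccont_mult; [apply ccont_const|now apply hpsi]).
replace (line_int L (phi z') - line_int L (phi z) - (z' - z) * line_int L psi)%C with
  (line_int L (fun w => phi z' w - phi z w - (z' - z) * psi w)%C).
- set (D := Cmod (z' - z)) in *.
  assert (D0 : 0 <= D) by apply Cmod_ge_0.
  apply Rle_trans with (B * (N * D ^ 2)).
  + apply HB; [apply Rmult_le_pos; [exact N0|apply pow_le, D0]| |].
    * intros w hw; apply ccont_minus; [now apply c1|now apply c2].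
    * intros w hw; apply Rle_trans with (1 := hM z' w h1 hw).
      apply Rmult_le_compat_r; [apply pow_le, D0|apply Rmax_l].
  + assert (k : (B * N + 1) * D <= e).
      apply (Rmult_lt_compat_r (B * N + 1)) in h2; [|nra].
      replace (e / (B * N + 1) * (B * N + 1)) with e in h2 by (field; nra); lra.
    replace (B * (N * D ^ 2)) with ((B * N * D) * D) by ring.
    apply Rmult_le_compat_r; lra.
- rewrite !line_int_minus, line_int_scal; auto.
Qed.

Lemma cauchy_kernel_cont (L : list arc) (mu : C -> C) (z : C) : cont_on L mu -> ~ on_arcs L z ->
  cont_on L (fun w => mu w / (w - z))%C.
Proof.
intros hc nz w hw; apply ccont_mult; [now apply hc|].
apply cdiff_cont, cdiff_inv; [apply cdiff_minus; [apply cdiff_id|apply cdiff_const]|].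
apply Cminus_neq0; intros ->; exact (nz hw).
Qed.

Definition cauchy_transform (L : list arc) (mu : C -> C) (z : C) : C :=
  line_int L (fun w => mu w / (w - z))%C.

Lemma not_on_arcs_open (L : list arc) (z : C) : ~ on_arcs L z ->
  exists d, 0 < d /\ forall w, Cmod (w - z) < d -> ~ on_arcs L w.
Proof.
intros nz; destruct (on_arcs_dist L z nz) as [d [d0 Hd]].
exists d; split; [exact d0|]; intros w hw ow; specialize (Hd w ow); lra.
Qed.

Lemma cauchy_transform_derive (L : list arc) (mu : C -> C) (z : C) :
  cont_on L mu -> ~ on_arcs L z ->
  cderive (cauchy_transform L mu) z (cauchy_transform L (fun w => mu w / (w - z))%C z).
Proof.
intros hc nz; destruct (on_arcs_dist L z nz) as [d [d0 Hd]].
destruct (cont_on_bounded L mu hc) as [M [M0 HM]].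
assert (ne : forall z' w, Cmod (z' - z) < d / 2 -> on_arcs L w -> d / 2 <= Cmod (w - z')).
  intros z' w hz hw; specialize (Hd w hw).
  assert (k := Cmod_triangle (w - z') (z' - z)).
  replace (w - z' + (z' - z))%C with (w - z)%C in k by ring; lra.
apply (line_int_param_derive L _ _ z (d / 2) (M * (2 / d * (2 / d) * (2 / d)))); [lra| | |].
- intros z' hz; apply cauchy_kernel_cont; [exact hc|].
  intros oz; specialize (ne z' z' hz oz).
  replace (z' - z')%C with (RtoC 0) in ne by ring; rewrite Cmod_0 in ne; lra.
- apply cauchy_kernel_cont; [apply cauchy_kernel_cont|]; assumption.
- intros z' w hz hw.
  assert (k1 := ne z' w hz hw).
  assert (k2 : d / 2 <= Cmod (w - z)) by (specialize (Hd w hw); lra).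
  assert (n1 : (w - z')%C <> RtoC 0) by (apply Cmod_gt_0; lra).
  assert (n2 : (w - z)%C <> RtoC 0) by (apply Cmod_gt_0; lra).
  replace (mu w / (w - z') - mu w / (w - z) - (z' - z) * (mu w / (w - z) / (w - z)))%C
    with (mu w * (/ (w - z') * / (w - z) * / (w - z)) * ((z' - z) * (z' - z)))%C
    by (field; split; assumption).
  rewrite !Cmod_mult, !Cmod_inv by assumption.
  replace (Cmod (z' - z) ^ 2) with (Cmod (z' - z) * Cmod (z' - z)) by ring.
  assert (i : forall x, d / 2 <= x -> 0 <= / x <= 2 / d).
    intros x hx; split; [left; apply Rinv_0_lt_compat; lra|].
    replace (2 / d) with (/ (d / 2)) by (field; lra); apply Rinv_le_contravar; lra.
  destruct (i _ k1) as [i1 i2]; destruct (i _ k2) as [j1 j2].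
  assert (D0 : 0 <= Cmod (z' - z)) by apply Cmod_ge_0.
  apply Rmult_le_compat_r; [nra|].
  apply Rmult_le_compat; [apply Cmod_ge_0| |now apply HM|].
    repeat apply Rmult_le_pos; assumption.
  repeat apply Rmult_le_compat; try assumption; apply Rmult_le_pos; assumption.
Qed.

Lemma cauchy_transform_infty (L : list arc) (mu : C -> C) : cont_on L mu ->
  forall e, 0 < e -> exists r, 0 < r /\ forall z, r <= Cmod z ->
    ~ on_arcs L z /\ Cmod (cauchy_transform L mu z) <= e.
Proof.
intros hc e e0.
destruct (line_int_bound L) as [B [B0 HB]].
destruct (cont_on_bounded L mu hc) as [M [M0 HM]].
destruct (cont_on_bounded L (fun w => w)) as [N [N0 HN]]; [intros w _; apply ccont_id|].
assert (BM : 0 <= B * M / e).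
  apply Rmult_le_pos; [nra|left; now apply Rinv_0_lt_compat].
exists (N + B * M / e + 1); split; [lra|]; intros z hz.
assert (nz : ~ on_arcs L z) by (intros oz; specialize (HN z oz); lra).
split; [exact nz|].
assert (far : forall w, on_arcs L w -> B * M / e + 1 <= Cmod (w - z)).
  intros w hw; specialize (HN w hw).
  assert (k := Cmod_triangle (z - w) w); replace (z - w + w)%C with z in k by ring.
  rewrite (Cmod_minus_sym z w) in k; lra.
apply Rle_trans with (B * (M * / (B * M / e + 1))).
- apply HB; [|now apply cauchy_kernel_cont|].
    apply Rmult_le_pos; [exact M0|left; apply Rinv_0_lt_compat; lra].
  intros w hw; specialize (far w hw).
  assert (n : (w - z)%C <> RtoC 0) by (apply Cmod_gt_0; lra).
  unfold Cdiv; rewrite Cmod_mult, Cmod_inv by exact n.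
  apply Rmult_le_compat; [apply Cmod_ge_0| |now apply HM|apply Rinv_le_contravar; lra].
  left; apply Rinv_0_lt_compat; lra.
- apply Rmult_le_reg_r with (B * M / e + 1); [lra|].
  replace (B * (M * / (B * M / e + 1)) * (B * M / e + 1)) with (B * M).
    replace (e * (B * M / e + 1)) with (B * M + e) by (field; lra); lra.
  field; split; [lra|]; intros h.
  assert (k : B * M / e + 1 = 0); [|lra].
  replace (B * M / e + 1) with ((B * M + e) / e) by (field; lra); rewrite h; field; lra.
Qed.

Lemma zero_derive_const (f : C -> C) (z : C) (d : R) :
  (forall w, Cmod (w - z) < d -> cderive f w (RtoC 0)) ->
  forall w, Cmod (w - z) < d -> f w = f z.
Proof.
intros h w hw.
assert (k : CRInt (fun t => (w - z) * 0)%C 0 1 =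
  (f (z + RtoC 1 * (w - z)) - f (z + RtoC 0 * (w - z)))%C).
  apply (CRInt_derive (fun t => f (z + RtoC t * (w - z))%C)); intros t Ht.
  - apply unit_interval in Ht.
    apply (rderive_comp f (fun t => z + RtoC t * (w - z))%C).
    + apply h; replace (z + RtoC t * (w - z) - z)%C with (RtoC t * (w - z))%C by ring.
      rewrite Cmod_mult, Cmod_R, Rabs_pos_eq by lra; assert (k := Cmod_ge_0 (w - z)); nra.
    + apply rderiveP; intros e e0; exists 1; split; [lra|]; intros s _.
      replace (z + RtoC s * (w - z) - (z + RtoC t * (w - z)) - RtoC (s - t) * (w - z))%C with (RtoC 0).
        rewrite Cmod_0; assert (k := Rabs_pos (s - t)); nra.
      rewrite RtoC_minus; ring.
  - apply rcont_const.
rewrite CRInt_const in k.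
replace (z + RtoC 1 * (w - z))%C with w in k by ring.
replace (z + RtoC 0 * (w - z))%C with z in k by ring.
replace (f w) with (f w - f z + f z)%C by ring; rewrite <- k; ring.
Qed.

(** The Cauchy transform of 1 is [2 pi i] times the winding number. Its
    derivative is the integral of [1 / (u - w)^2], which has the primitive [- 1
    / (u - w)]. *)
Lemma index_locally_const (G : list (list arc)) (z : C) (d : R) :
  (forall p, In p G -> closed_path p) ->
  (forall w, Cmod (w - z) < d -> ~ on_arcs (concat G) w) ->
  forall w, Cmod (w - z) < d ->
  cauchy_transform (concat G) (fun _ => RtoC 1) w = cauchy_transform (concat G) (fun _ => RtoC 1) z.
Proof.
intros cl off; apply zero_derive_const; intros w hw.
assert (nw := off w hw).
assert (c1 : cont_on (concat G) (fun _ => RtoC 1)) by (intros u _; apply ccont_const).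
assert (D := cauchy_transform_derive (concat G) (fun _ => RtoC 1) w c1 nw).
replace (RtoC 0) with (cauchy_transform (concat G) (fun u => 1 / (u - w))%C w); [exact D|].
apply (line_int_primitive (fun u => - / (u - w))%C); [| |exact cl].
- apply cauchy_kernel_cont; [apply cauchy_kernel_cont|]; assumption.
- intros u hu.
  assert (n : (u - w)%C <> RtoC 0) by (apply Cminus_neq0; intros ->; exact (nw hu)).
  assert (k := cderive_comp (fun v => / v)%C (fun v => v - w)%C u _ _
    (cderive_inv_id _ n) (cderive_minus _ _ u _ _ (cderive_id u) (cderive_const w u))).
  assert (k' := cderive_mult (fun _ => (- (1))%C) _ u _ _ (cderive_const _ u) k).
  simpl in k'; clear k D.
  replace (1 / (u - w) / (u - w))%C with
    (0 * / (u - w) + - (1) * ((1 - 0) * - / ((u - w) * (u - w))))%C by (field; exact n).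
  revert k'; apply (cderive_ext_near _ _ u _ 1 Rlt_0_1); intros v _; ring.
Qed.

(** * Cauchy's formula and divided differences *)

Lemma rderive_pair (u v : R -> R) (t u' v' : R) :
  is_derive u t u' -> is_derive v t v' -> rderive (fun s => (u s, v s)) t (u', v').
Proof.
intros [_ hu] [_ hv]; apply rderiveP; intros e e0.
assert (p : 0 < e / 2) by lra.
specialize (hu t (fun P H => H) (mkposreal _ p)); specialize (hv t (fun P H => H) (mkposreal _ p)).
destruct (filter_and _ _ hu hv) as [d Hd].
exists d; split; [apply cond_pos|]; intros s Hs.
destruct (Hd s Hs) as [k1 k2].
replace ((u s, v s) - (u t, v t) - RtoC (s - t) * (u', v'))%C with
  (u s - u t - (s - t) * u', v s - v t - (s - t) * v')
  by (unfold RtoC, Cminus, Cmult, Cplus, Copp; simpl; f_equal; ring).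
apply Rle_trans with (1 := Cmod_le_sum _ _).
replace (e * Rabs (s - t)) with (e / 2 * Rabs (s - t) + e / 2 * Rabs (s - t)) by field.
apply Rplus_le_compat; [exact k1|exact k2].
Qed.

Definition circle_fun (a : C) (r t : R) : C :=
  (a + (r * cos (2 * PI * t), r * sin (2 * PI * t))%R)%C.

Definition circle_der (r t : R) : C :=
  (- (2 * PI * r * sin (2 * PI * t)), 2 * PI * r * cos (2 * PI * t)).

Lemma circle_is_derive (a : C) (r t : R) : rderive (circle_fun a r) t (circle_der r t).
Proof.
unfold circle_fun, circle_der, Cplus; simpl; apply rderive_pair; auto_derive; auto; ring.
Qed.

Lemma circle_der_continuous (r t : R) : rcont (circle_der r) t.
Proof.
apply rderive_cont with
  (l := (- (2 * PI * r * (2 * PI * cos (2 * PI * t))), 2 * PI * r * - (2 * PI * sin (2 * PI * t)))).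
unfold circle_der; apply rderive_pair; auto_derive; auto; ring.
Qed.

Definition circle (a : C) (r : R) : arc :=
  Arc (circle_fun a r) (circle_der r) (circle_is_derive a r) (circle_der_continuous r).

Lemma Cmod_polar (r t : R) : 0 <= r -> Cmod (r * cos t, r * sin t) = r.
Proof.
intros r0; unfold Cmod; simpl.
replace (r * cos t * (r * cos t * 1) + r * sin t * (r * sin t * 1))
  with (r * r * (Rsqr (sin t) + Rsqr (cos t))) by (unfold Rsqr; ring).
rewrite sin2_cos2, Rmult_1_r; now apply sqrt_square.
Qed.

Lemma circle_dist (a : C) (r t : R) : 0 <= r -> Cmod (circle_fun a r t - a) = r.
Proof.
intros r0; unfold circle_fun.
transitivity (Cmod (r * cos (2 * PI * t), r * sin (2 * PI * t))); [|now apply Cmod_polar].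
apply (f_equal Cmod); ring.
Qed.

Lemma on_circle (a : C) (r : R) (z : C) : 0 <= r -> on_arcs (circle a r :: nil) z -> Cmod (z - a) = r.
Proof. intros r0 [b [t [[<-|[]] [_ ->]]]]; now apply circle_dist. Qed.

Lemma circle_der_norm (r t : R) : 0 <= r -> Cmod (circle_der r t) = 2 * PI * r.
Proof.
intros r0; assert (p := PI_RGT_0).
transitivity (Cmod (2 * PI * r * cos (2 * PI * t), 2 * PI * r * sin (2 * PI * t)));
  [|apply Cmod_polar; nra].
unfold circle_der, Cmod; simpl; apply (f_equal sqrt); ring.
Qed.

Lemma circle_closed (a : C) (r : R) :
  forall p, In p ((circle a r :: nil) :: nil) -> closed_path p.
Proof.
intros p [<-|[]]; exists (circle_fun a r 0); simpl; split; [reflexivity|].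
unfold circle_fun; rewrite Rmult_1_r, Rmult_0_r.
rewrite cos_2PI, sin_2PI, cos_0, sin_0; reflexivity.
Qed.

Definition two_pi_i : C := (RtoC (2 * PI) * Ci)%C.

Lemma two_pi_i_neq0 : two_pi_i <> RtoC 0.
Proof.
assert (p := PI_RGT_0).
apply Cmult_neq_0; intros h; injection h; lra.
Qed.

Lemma Cmod_two_pi_i : Cmod two_pi_i = 2 * PI.
Proof.
assert (p := PI_RGT_0).
unfold two_pi_i; rewrite Cmod_mult, Cmod_R, Cmod_Ci, Rabs_pos_eq; lra.
Qed.

Lemma circle_index (a z : C) (r : R) : Cmod (z - a) < r ->
  cauchy_transform (circle a r :: nil) (fun _ => RtoC 1) z = two_pi_i.
Proof.
intros hz; assert (r0 : 0 < r) by (assert (h := Cmod_ge_0 (z - a)); lra).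
assert (k := index_locally_const ((circle a r :: nil) :: nil) a r (circle_closed a r)).
change (concat ((circle a r :: nil) :: nil)) with (circle a r :: nil) in k.
rewrite k; [| |exact hz].
- unfold cauchy_transform; simpl; rewrite Cplus_0_r; unfold arc_int.
  rewrite (CRInt_ext _ (fun _ => two_pi_i)).
    rewrite CRInt_const, Rminus_0_r; ring.
  intros t _; simpl.
  assert (n : (circle_fun a r t - a)%C <> RtoC 0).
    apply Cmod_gt_0; rewrite circle_dist; lra.
  replace (circle_der r t) with (two_pi_i * (circle_fun a r t - a))%C; [field; exact n|].
  unfold two_pi_i, circle_fun, circle_der, Ci, RtoC, Cminus, Cmult, Cplus, Copp; simpl.
  f_equal; ring.
- intros w hw ow; apply on_circle in ow; lra.
Qed.

Definition divdiff (f : C -> C) (z w : C) : C :=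
  if Ceq_dec w z then C_derive f z else ((f w - f z) / (w - z))%C.

Lemma divdiff_neq (f : C -> C) (z w : C) : w <> z -> divdiff f z w = ((f w - f z) / (w - z))%C.
Proof. intros n; unfold divdiff; destruct (Ceq_dec w z); [contradiction|reflexivity]. Qed.

Lemma divdiff_eq (f : C -> C) (z : C) : divdiff f z z = C_derive f z.
Proof. unfold divdiff; destruct (Ceq_dec z z) as [_|n]; [reflexivity|now destruct n]. Qed.

Lemma divdiff_cont (f : C -> C) (z : C) : cdiff f z -> ccont (divdiff f z) z.
Proof.
intros h; assert (D := C_derive_correct f z (RtoC 0) h); apply ccontP; intros e e0.
destruct (proj1 (cderiveP f z _) D (e / 2) ltac:(lra)) as [d [d0 Hd]].
exists d; split; [exact d0|]; intros w hw; rewrite divdiff_eq.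
destruct (Ceq_dec w z) as [->|n].
  rewrite divdiff_eq; replace (C_derive f z - C_derive f z)%C with (RtoC 0) by ring; now rewrite Cmod_0.
rewrite divdiff_neq by exact n; specialize (Hd w hw).
assert (n' := Cminus_neq0 _ _ n); assert (p := Cmod_minus_pos _ _ n).
replace ((f w - f z) / (w - z) - C_derive f z)%C with
  ((f w - f z - (w - z) * C_derive f z) / (w - z))%C by (field; exact n').
rewrite Cmod_div by exact n'.
apply Rle_lt_trans with (e / 2); [|lra].
apply Rmult_le_reg_r with (Cmod (w - z)); [exact p|].
unfold Rdiv at 1; rewrite Rmult_assoc, Rinv_l; lra.
Qed.

Lemma divdiff_diff_off (f : C -> C) (z w : C) : w <> z -> cdiff f w -> cdiff (divdiff f z) w.
Proof.
intros n h.
apply (cdiff_ext_near (fun u => (f u - f z) / (u - z))%C _ w (Cmod (w - z)) (Cmod_minus_pos _ _ n)).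
- intros u hu; symmetry; apply divdiff_neq; intros ->; rewrite Cmod_minus_sym in hu; lra.
- apply cdiff_div; [| |now apply Cminus_neq0].
  + apply cdiff_minus; [exact h|apply cdiff_const].
  + apply cdiff_minus; [apply cdiff_id|apply cdiff_const].
Qed.

Lemma disc_in_box (a z : C) (r R : R) : Cmod (z - a) <= r -> r < R -> box a R z.
Proof.
intros h hr; split.
- assert (k := Rabs_fst_le (z - a)); change (fst (z - a)%C) with (fst z - fst a) in k; lra.
- assert (k := Rabs_snd_le (z - a)); change (snd (z - a)%C) with (snd z - snd a) in k; lra.
Qed.

Lemma box_in_disc (a z : C) (R : R) : box a R z -> Cmod (z - a) < 2 * R.
Proof.
intros [h1 h2]; rewrite (surjective_pairing (z - a)%C).
apply Rle_lt_trans with (1 := Cmod_le_sum _ _).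
change (fst (z - a)%C) with (fst z - fst a); change (snd (z - a)%C) with (snd z - snd a); lra.
Qed.

(** The divided difference [divdiff f z] is continuous and differentiable off
    [z], so it has a primitive on the box and integrates to zero around the
    circle. *)
Lemma cauchy_formula (f : C -> C) (a z : C) (r R : R) : r < R ->
  (forall w, box a R w -> cdiff f w) -> Cmod (z - a) < r ->
  cauchy_transform (circle a r :: nil) f z = (two_pi_i * f z)%C.
Proof.
intros rR hf hz; assert (r0 : 0 < r) by (assert (h := Cmod_ge_0 (z - a)); lra).
assert (bz : box a R z) by (apply disc_in_box with r; lra).
destruct (primitive_on_box (divdiff f z) a R z) as [Q HQ]; [| |exact bz|].
- intros w hw; destruct (Ceq_dec w z) as [->|n].
    now apply divdiff_cont, hf.
  now apply cdiff_cont, divdiff_diff_off, hf.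
- intros w hw n; now apply divdiff_diff_off, hf.
- assert (ob : forall u, on_arcs (circle a r :: nil) u -> box a R u).
    intros u hu; apply on_circle in hu; [|lra]; apply disc_in_box with r; lra.
  assert (ne : forall u, on_arcs (circle a r :: nil) u -> u <> z).
    intros u hu ->; apply on_circle in hu; lra.
  assert (cf : cont_on (circle a r :: nil) f) by (intros u hu; apply cdiff_cont, hf, ob, hu).
  assert (nz : ~ on_arcs (circle a r :: nil) z) by (intros hz'; exact (ne z hz' eq_refl)).
  assert (cq : cont_on (circle a r :: nil) (divdiff f z)).
    intros u hu; apply cdiff_cont, divdiff_diff_off; [now apply ne|apply hf, ob, hu].
  assert (c1 : cont_on (circle a r :: nil) (fun u => 1 / (u - z))%C).
    apply cauchy_kernel_cont; [intros u _; apply ccont_const|exact nz].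
  assert (I : line_int (circle a r :: nil) (divdiff f z) = RtoC 0).
    apply (line_int_primitive Q _ ((circle a r :: nil) :: nil)).
    + exact cq.
    + intros u hu; apply HQ, ob, hu.
    + apply circle_closed.
  assert (K := circle_index a z r hz); unfold cauchy_transform in K |- *.
  rewrite (line_int_ext _ (fun w => f w / (w - z))%C
    (fun w => divdiff f z w + f z * (1 / (w - z)))%C).
  + rewrite line_int_plus, line_int_scal, I, K; [ring| | |]; try assumption.
    intros u hu; apply ccont_mult; [apply ccont_const|now apply c1].
  + intros w hw; rewrite divdiff_neq by now apply ne.
    field; apply Cminus_neq0, ne, hw.
Qed.

Lemma mean_value_bound (f : C -> C) (a : C) (r R M : R) : 0 < r < R -> 0 <= M ->
  (forall w, box a R w -> cdiff f w) -> (forall w, Cmod (w - a) = r -> Cmod (f w) <= M) ->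
  Cmod (f a) <= M.
Proof.
intros [r0 rR] M0 hf hM; assert (p := PI_RGT_0).
assert (h : Cmod (a - a) < r) by (replace (a - a)%C with (RtoC 0) by ring; now rewrite Cmod_0).
assert (E := cauchy_formula f a a r R rR hf h).
assert (B : Cmod (cauchy_transform (circle a r :: nil) f a) <= 2 * PI * M).
  unfold cauchy_transform; simpl; rewrite Cplus_0_r.
  replace (2 * PI * M) with (Rabs (1 - 0) * (2 * PI * M)) by (rewrite Rminus_0_r, Rabs_R1; ring).
  apply CRInt_bound.
  - intros t _; simpl; assert (k := circle_dist a r t (Rlt_le _ _ r0)).
    assert (n : (circle_fun a r t - a)%C <> RtoC 0) by (apply Cmod_gt_0; lra).
    rewrite Cmod_mult, Cmod_div, circle_der_norm, k by (assumption || lra).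
    specialize (hM _ k).
    replace (Cmod (f (circle_fun a r t)) / r * (2 * PI * r)) with (2 * PI * Cmod (f (circle_fun a r t)))
      by (field; lra).
    apply Rmult_le_compat_l; lra.
  - apply (arc_int_ex (circle a r) nil (fun w => f w / (w - a))%C), cauchy_kernel_cont.
    + intros u hu; apply on_circle in hu; [|lra].
      apply cdiff_cont, hf, disc_in_box with r; lra.
    + intros oa; apply on_circle in oa; lra.
rewrite E, Cmod_mult, Cmod_two_pi_i in B.
apply Rmult_le_reg_l with (2 * PI); lra.
Qed.

(** By Cauchy's formula, [divdiff f z] agrees near [z] with the Cauchy transform
    of [f u / (u - z)], which is differentiable. *)
Lemma divdiff_diff_at (f : C -> C) (z : C) (d : R) : 0 < d ->
  (forall w, Cmod (w - z) < d -> cdiff f w) -> cdiff (divdiff f z) z.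
Proof.
intros d0 hf.
set (L := circle z (d / 4) :: nil).
assert (hb : forall w, box z (d / 2) w -> cdiff f w).
  intros w hw; apply hf; apply box_in_disc in hw; lra.
assert (cf : cont_on L f).
  intros u hu; apply on_circle in hu; [|lra]; apply cdiff_cont, hf; lra.
(* The circle has radius [d / 4] and lies in the box of half-width [d / 2],
   which is inside the disc of radius [d]. *)
assert (off : forall w, Cmod (w - z) < d / 4 -> ~ on_arcs L w).
  intros w hw ow; apply on_circle in ow; lra.
assert (z0 : Cmod (z - z) < d / 4).
  replace (z - z)%C with (RtoC 0) by ring; rewrite Cmod_0; lra.
assert (E : forall w, Cmod (w - z) < d / 4 -> f w = (/ two_pi_i * cauchy_transform L f w)%C).
  intros w hw; unfold L; rewrite (cauchy_formula f z w (d / 4) (d / 2)) by (assumption || lra).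
  field; apply two_pi_i_neq0.
assert (ck : cont_on L (fun u => f u / (u - z))%C) by (apply cauchy_kernel_cont; auto).
apply (cdiff_ext_near
  (fun w => / two_pi_i * cauchy_transform L (fun u => f u / (u - z)) w)%C _ z (d / 4)); [lra| |].
- intros w hw; destruct (Ceq_dec w z) as [->|n].
  + rewrite divdiff_eq; symmetry; apply is_C_derive_unique.
    assert (k := cderive_mult (fun _ => (/ two_pi_i)%C) _ z _ _ (cderive_const _ z)
      (cauchy_transform_derive L f z cf (off z z0))).
    simpl in k; rewrite Cmult_0_l, Cplus_0_l in k; revert k.
    apply (cderive_ext_near _ _ z _ (d / 4)); [lra|]; intros w hw'; symmetry; now apply E.
  + rewrite divdiff_neq, (E w), (E z) by assumption.
    unfold cauchy_transform.
    replace (line_int L (fun u => f u / (u - z) / (u - w))%C) with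
      (/ (w - z) * (line_int L (fun u => f u / (u - w)) - line_int L (fun u => f u / (u - z))))%C.
      field; split; [apply two_pi_i_neq0|now apply Cminus_neq0].
    assert (cw : cont_on L (fun u => f u / (u - w))%C) by (apply cauchy_kernel_cont; auto).
    rewrite <- line_int_minus, <- line_int_scal; [|  |exact cw|exact ck].
    * apply line_int_ext; intros u hu.
      field; repeat split; apply Cminus_neq0; auto; intros ->;
        [apply (off z z0 hu)|apply (off w hw hu)].
    * intros u hu; apply ccont_minus; [now apply cw|now apply ck].
- apply cdiff_mult; [apply cdiff_const|].
  eexists; apply cauchy_transform_derive; auto.
Qed.

Definition is_open (U : C -> Prop) : Prop :=
  forall z, U z -> exists d, 0 < d /\ forall w, Cmod (w - z) < d -> U w.

Definition holo (U : C -> Prop) (f : C -> C) : Prop := forall z, U z -> cdiff f z.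

Lemma divdiff_holo (U : C -> Prop) (f : C -> C) (z : C) :
  is_open U -> holo U f -> U z -> holo U (divdiff f z).
Proof.
intros op hf hz w hw; destruct (Ceq_dec w z) as [->|n].
- destruct (op z hz) as [d [d0 Hd]]; apply (divdiff_diff_at f z d d0).
  intros w hw'; apply hf, Hd, hw'.
- apply divdiff_diff_off; auto.
Qed.

Lemma liouville (f : C -> C) : (forall z, cdiff f z) ->
  (forall e, 0 < e -> exists r, 0 < r /\ forall z, r <= Cmod z -> Cmod (f z) <= e) ->
  forall z, f z = RtoC 0.
Proof.
intros hf h z; apply Cmod_small_eq0 with (K := 1); [lra|]; intros e e0; rewrite Rmult_1_l.
destruct (h e e0) as [r [r0 Hr]]; assert (k := Cmod_ge_0 z).
apply (mean_value_bound f z (r + Cmod z) (r + Cmod z + 1)); [lra|lra|auto|].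
intros w hw; apply Hr.
assert (t := Cmod_triangle w (- z)); rewrite Cmod_opp in t.
change (w + - z)%C with (w - z)%C in t; lra.
Qed.

(** Used to extend algebraic identities between divided differences to the
    diagonal. *)
Lemma ccont_punctured_eq (f g : C -> C) (z : C) (d : R) : 0 < d -> ccont f z -> ccont g z ->
  (forall w, w <> z -> Cmod (w - z) < d -> f w = g w) -> f z = g z.
Proof.
intros d0 cf cg h.
assert (k : (f z - g z)%C = RtoC 0).
  apply Cmod_small_eq0 with (K := 2); [lra|]; intros e e0.
  destruct (proj1 (ccontP f z) cf e e0) as [d1 [d10 H1]].
  destruct (proj1 (ccontP g z) cg e e0) as [d2 [d20 H2]].
  (* A point close to [z] and different from it, at distance [s]. *)
  set (s := Rmin d (Rmin d1 d2) / 2).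
  assert (m0 : 0 < Rmin d (Rmin d1 d2)) by (repeat apply Rmin_glb_lt; assumption).
  assert (m1 : Rmin d (Rmin d1 d2) <= d) by apply Rmin_l.
  assert (m2 : Rmin d (Rmin d1 d2) <= d1) by (apply Rle_trans with (1 := Rmin_r _ _), Rmin_l).
  assert (m3 : Rmin d (Rmin d1 d2) <= d2) by (apply Rle_trans with (1 := Rmin_r _ _), Rmin_r).
  assert (E : Cmod (z + RtoC s - z) = s).
    replace (z + RtoC s - z)%C with (RtoC s) by ring.
    rewrite Cmod_R, Rabs_pos_eq; unfold s; lra.
  assert (E' : Cmod (z + RtoC s - z) < Rmin d (Rmin d1 d2)) by (rewrite E; unfold s; lra).
  assert (n : (z + RtoC s)%C <> z) by (apply Cmod_dist_pos; rewrite E; unfold s; lra).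
  specialize (H1 (z + RtoC s)%C ltac:(lra)); specialize (H2 (z + RtoC s)%C ltac:(lra)).
  rewrite (h _ n ltac:(lra)) in H1.
  replace (f z - g z)%C with ((g (z + RtoC s) - g z) - (g (z + RtoC s) - f z))%C by ring.
  apply Rle_trans with (1 := Cmod_triangle _ _); rewrite Cmod_opp; lra.
replace (f z) with ((f z - g z) + g z)%C by ring; rewrite k; ring.
Qed.

(** The Taylor step for divided differences. Iterated twice, it expands [divdiff
    f z' w] to order two in [z' - z], with a remainder that is again a divided
    difference. *)
Lemma divdiff_step (U : C -> Prop) (f : C -> C) (z z' w : C) : is_open U -> holo U f ->
  U z -> U z' -> U w ->
  (divdiff f z' w - divdiff f z w)%C = ((z' - z) * divdiff (divdiff f z) z' w)%C.
Proof.
intros op hf hz hz' hw.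
destruct (Ceq_dec z' z) as [->|n]; [ring|].
assert (gen : forall u, u <> z -> u <> z' ->
    (divdiff f z' u - divdiff f z u)%C = ((z' - z) * divdiff (divdiff f z) z' u)%C).
  intros u n1 n2; rewrite (divdiff_neq _ z' u), (divdiff_neq (divdiff f z) z' u), !(divdiff_neq f z) by assumption.
  field; repeat split; apply Cminus_neq0; assumption.
assert (c : forall v, U v -> ccont (fun u => divdiff f z' u - divdiff f z u)%C v /\
    ccont (fun u => (z' - z) * divdiff (divdiff f z) z' u)%C v).
  intros v hv; split; apply cdiff_cont.
  - apply cdiff_minus; apply (divdiff_holo U); assumption.
  - apply cdiff_mult; [apply cdiff_const|].
    apply (divdiff_holo U); [| |assumption|assumption]; [assumption|now apply divdiff_holo].
assert (p := Cmod_minus_pos _ _ n).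
destruct (Ceq_dec w z) as [->|n1]; [|destruct (Ceq_dec w z') as [->|n2]; [|now apply gen]].
- destruct (c z hz) as [c1 c2].
  apply (ccont_punctured_eq _ _ z _ p c1 c2); intros u h1 h2; apply gen; [exact h1|].
  intros ->; lra.
- destruct (c z' hz') as [c1 c2].
  apply (ccont_punctured_eq _ _ z' _ p c1 c2); intros u h1 h2; apply gen; [|exact h1].
  intros ->; rewrite Cmod_minus_sym in h2; lra.
Qed.

(** For [w] away from [z] the quotient is bounded directly. For [w] close to [z]
    the mean value inequality on a circle around [w] moves the evaluation to
    points that are away from [z']. *)
Lemma divdiff_uniform_bound (U : C -> Prop) (g : C -> C) (z : C) (L : list arc) :
  is_open U -> holo U g -> U z -> (forall w, on_arcs L w -> U w) ->
  exists d M, 0 < d /\ 0 <= M /\ (forall z', Cmod (z' - z) < d -> U z') /\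
    forall z' w, Cmod (z' - z) < d -> on_arcs L w -> Cmod (divdiff g z' w) <= M.
Proof.
intros op hg hz hL.
destruct (op z hz) as [d1 [d10 H1]].
destruct (proj1 (ccontP g z) (cdiff_cont _ _ (hg z hz)) 1 Rlt_0_1) as [d2 [d20 H2]].
destruct (cont_on_bounded L g) as [N [N0 HN]]; [intros w hw; apply cdiff_cont, hg, hL, hw|].
(* [K] bounds [g] both on the disc of radius [p] around [z] and on the arcs. *)
set (p := Rmin d1 d2); set (K := N + Cmod (g z) + 1).
assert (K0 := Cmod_ge_0 (g z)).
assert (p0 : 0 < p) by now apply Rmin_glb_lt.
assert (pU : forall w, Cmod (w - z) < p -> U w).
  intros w hw; apply H1; apply Rlt_le_trans with (1 := hw), Rmin_l.
assert (pK : forall w, Cmod (w - z) < p -> Cmod (g w) <= K).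
  intros w hw; assert (k := H2 w (Rlt_le_trans _ _ _ hw (Rmin_r _ _))).
  assert (t := Cmod_triangle_inv (g w) (g z)); apply Rabs_le_between in t; unfold K; lra.
assert (quot : forall u v, p / 8 <= Cmod (v - u) -> Cmod (g u) <= K -> Cmod (g v) <= K ->
    Cmod (divdiff g u v) <= 2 * K * (8 / p)).
  intros u v h hu hv.
  assert (n : v <> u) by (apply Cmod_dist_pos; lra).
  rewrite divdiff_neq by exact n; unfold Cdiv.
  rewrite Cmod_mult, Cmod_inv by (apply Cminus_neq0, n).
  apply Rmult_le_compat; [apply Cmod_ge_0|left; apply Rinv_0_lt_compat; lra| |].
  - unfold Cminus; apply Rle_trans with (1 := Cmod_triangle _ _); rewrite Cmod_opp; lra.
  - replace (8 / p) with (/ (p / 8)) by (field; lra); apply Rinv_le_contravar; lra.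
exists (p / 8), (2 * K * (8 / p)); split; [lra|].
assert (M0 : 0 <= 2 * K * (8 / p)).
  apply Rmult_le_pos; [unfold K; lra|left; apply Rdiv_lt_0_compat; lra].
split; [exact M0|]; split; [intros z' hz'; apply pU; lra|].
intros z' w hz' hw.
assert (Kw : Cmod (g w) <= K) by (assert (k := HN w hw); unfold K; lra).
destruct (Rle_dec (p / 8) (Cmod (w - z'))) as [far|near]; [apply quot; auto; apply pK; lra|].
assert (wz : Cmod (w - z) < p / 4).
  replace (w - z)%C with ((w - z') + (z' - z))%C by ring.
  apply Rle_lt_trans with (1 := Cmod_triangle _ _); lra.
assert (tri : forall u, Cmod (u - z) <= Cmod (u - w) + Cmod (w - z)).
  intros u; replace (u - z)%C with ((u - w) + (w - z))%C by ring; apply Cmod_triangle.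
(* With [|w - z| < p / 4] and [|z' - w| < p / 8], the circle of radius [p / 4]
   around [w] stays at distance [p / 8] from [z'], and the box of half-width [p
   / 3] stays in the disc of radius [p] around [z]. *)
apply (mean_value_bound (divdiff g z') w (p / 4) (p / 3)); [lra|exact M0| |].
- intros u hu; apply (divdiff_holo U); auto; apply pU; [lra|].
  apply box_in_disc in hu; specialize (tri u); lra.
- intros u hu; apply quot.
  + assert (t := Cmod_triangle (u - z') (z' - w)).
    replace (u - z' + (z' - w))%C with (u - w)%C in t by ring.
    rewrite (Cmod_minus_sym z' w) in t; lra.
  + apply pK; lra.
  + apply pK; specialize (tri u); lra.
Qed.

(** * Cauchy's theorem for cycles homologous to zero *)

Lemma divdiff_line_int_derive (U : C -> Prop) (f : C -> C) (L : list arc) (z : C) :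
  is_open U -> holo U f -> (forall w, on_arcs L w -> U w) -> U z ->
  cdiff (fun u => line_int L (divdiff f u)) z.
Proof.
intros op hf hL hz.
assert (h1 : holo U (divdiff f z)) by now apply divdiff_holo.
assert (h2 : holo U (divdiff (divdiff f z) z)) by now apply divdiff_holo.
destruct (divdiff_uniform_bound U _ z L op h2 hz hL) as [d [M [d0 [M0 [dU HM]]]]].
exists (line_int L (divdiff (divdiff f z) z)).
apply (line_int_param_derive L (divdiff f) _ z d M d0).
- intros z' hz' w hw; apply cdiff_cont, (divdiff_holo U); auto.
- intros w hw; apply cdiff_cont, h2, hL, hw.
- intros z' w hz' hw.
  assert (s1 := divdiff_step U f z z' w op hf hz (dU z' hz') (hL w hw)).
  assert (s2 := divdiff_step U _ z z' w op h1 hz (dU z' hz') (hL w hw)).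
  replace (divdiff f z' w - divdiff f z w - (z' - z) * divdiff (divdiff f z) z w)%C with
    ((z' - z) * ((z' - z) * divdiff (divdiff (divdiff f z) z) z' w))%C by (rewrite s1, <- s2; ring).
  rewrite !Cmod_mult; assert (k := HM z' w hz' hw); assert (k' := Cmod_ge_0 (z' - z)).
  nra.
Qed.

(** Dixon's proof. Off the arcs, the integral of [divdiff f z] is the Cauchy
    transform of [f] minus [f z] times the Cauchy transform of 1; the latter
    vanishes near a point outside [U], so the two formulas for [E] agree there
    and [E] is entire. *)
Lemma cauchy_dixon (U : C -> Prop) (G : list (list arc)) (f : C -> C) :
  is_open U -> Cbounded U -> (forall p, In p G -> closed_path p) ->
  (forall z, on_arcs (concat G) z -> U z) ->
  (forall z, ~ U z -> cauchy_transform (concat G) (fun _ => RtoC 1) z = RtoC 0) ->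
  holo U f ->
  (forall z, ~ U z -> cauchy_transform (concat G) f z = RtoC 0) /\
  (forall z, U z -> ~ on_arcs (concat G) z -> cauchy_transform (concat G) f z =
     (f z * cauchy_transform (concat G) (fun _ => RtoC 1) z)%C).
Proof.
set (L := concat G); intros op [B HB] cl hL ind hf.
assert (cf : cont_on L f) by (intros w hw; apply cdiff_cont, hf, hL, hw).
assert (c1 : cont_on L (fun _ => RtoC 1)) by (intros w _; apply ccont_const).
assert (link : forall z, U z -> ~ on_arcs L z -> line_int L (divdiff f z) =
    (cauchy_transform L f z - f z * cauchy_transform L (fun _ => RtoC 1) z)%C).
  intros z hz nz; unfold cauchy_transform.
  assert (k1 := cauchy_kernel_cont L f z cf nz).
  assert (k2 := cauchy_kernel_cont L (fun _ => RtoC 1) z c1 nz).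
  rewrite <- line_int_scal, <- line_int_minus; try assumption.
  - apply line_int_ext; intros w hw.
    assert (n : w <> z) by (intros ->; exact (nz hw)).
    rewrite divdiff_neq by exact n; field; now apply Cminus_neq0.
  - intros w hw; apply ccont_mult; [apply ccont_const|now apply k2].
set (E := fun z => if excluded_middle_informative (U z)
  then line_int L (divdiff f z) else cauchy_transform L f z).
assert (Ein : forall z, U z -> E z = line_int L (divdiff f z)).
  intros z hz; unfold E; destruct (excluded_middle_informative (U z)); [reflexivity|contradiction].
assert (Eout : forall z, ~ U z -> E z = cauchy_transform L f z).
  intros z hz; unfold E; destruct (excluded_middle_informative (U z)); [contradiction|reflexivity].
assert (E0 : forall z, E z = RtoC 0).
  apply liouville.
  - intros z; destruct (classic (U z)) as [hz|hz].
    + destruct (op z hz) as [d [d0 Hd]].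
      apply (cdiff_ext_near (fun u => line_int L (divdiff f u)) E z d d0).
        intros w hw; symmetry; apply Ein, Hd, hw.
      now apply (divdiff_line_int_derive U).
    + assert (nz : ~ on_arcs L z) by (intros oz; exact (hz (hL z oz))).
      destruct (not_on_arcs_open L z nz) as [d [d0 Hd]].
      apply (cdiff_ext_near (cauchy_transform L f) E z d d0).
        intros w hw; destruct (classic (U w)) as [uw|uw]; [|now rewrite Eout].
        rewrite Ein, link by auto.
        unfold L at 3; rewrite (index_locally_const G z d cl Hd w hw), ind by exact hz; ring.
      eexists; now apply cauchy_transform_derive.
  - intros e e0; destruct (cauchy_transform_infty L f cf e e0) as [r [r0 Hr]].
    exists (r + Rabs B + 1); assert (b := Rle_abs B); assert (b' := Rabs_pos B).
    split; [lra|]; intros z hz.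
    rewrite Eout; [apply Hr; lra|].
    intros uz; specialize (HB z uz); lra.
split.
- intros z hz; rewrite <- Eout by exact hz; apply E0.
- intros z hz nz; assert (k := link z hz nz); rewrite <- Ein, E0 in k by exact hz.
  set (I := cauchy_transform L f z) in *; set (W := cauchy_transform L (fun _ => RtoC 1) z) in *.
  replace I with ((I - f z * W) + f z * W)%C by ring; rewrite <- k; ring.
Qed.

(** Apply [cauchy_dixon] at a point [z] outside [U] to [f] and to [w f w], and
    use [f w = (w f w - z f w) / (w - z)]. *)
Lemma global_cauchy (U : C -> Prop) (G : list (list arc)) (f : C -> C) :
  is_open U -> Cbounded U -> (forall p, In p G -> closed_path p) ->
  (forall z, on_arcs (concat G) z -> U z) ->
  (forall z, ~ U z -> cauchy_transform (concat G) (fun _ => RtoC 1) z = RtoC 0) ->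
  holo U f -> line_int (concat G) f = RtoC 0.
Proof.
intros op bU cl hL ind hf.
(* A point outside [U], where the Cauchy transforms vanish. *)
assert (out : exists z, ~ U z).
  destruct bU as [B HB]; exists (RtoC (Rabs B + 1)); intros h; specialize (HB _ h).
  rewrite Cmod_R, Rabs_pos_eq in HB; assert (b := Rle_abs B); assert (b' := Rabs_pos B); lra.
destruct out as [z hz].
assert (hf' : holo U (fun w => w * f w)%C).
  intros w hw; apply cdiff_mult; [apply cdiff_id|now apply hf].
destruct (cauchy_dixon U G f op bU cl hL ind hf) as [I1 _].
destruct (cauchy_dixon U G _ op bU cl hL ind hf') as [I2 _].
specialize (I1 z hz); specialize (I2 z hz).
assert (nz : ~ on_arcs (concat G) z) by (intros oz; exact (hz (hL z oz))).
assert (c1 : cont_on (concat G) (fun w => f w / (w - z))%C).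
  apply cauchy_kernel_cont; [intros w hw; apply cdiff_cont, hf, hL, hw|exact nz].
assert (c2 : cont_on (concat G) (fun w => w * f w / (w - z))%C).
  apply cauchy_kernel_cont; [intros w hw; apply cdiff_cont, hf', hL, hw|exact nz].
unfold cauchy_transform in I1, I2.
rewrite (line_int_ext _ f (fun w => w * f w / (w - z) - z * (f w / (w - z)))%C).
- rewrite line_int_minus, line_int_scal, I1, I2; [ring|exact c1|exact c2|].
  intros w hw; apply ccont_mult; [apply ccont_const|now apply c1].
- intros w hw; field; apply Cminus_neq0; intros ->; exact (nz hw).
Qed.

(** * Adjoints in Hilbert spaces *)

Lemma plus_minus_cancel {G : AbelianGroup} (x y : G) : plus x (minus y x) = y.
Proof. unfold minus; rewrite (plus_comm y), plus_assoc, plus_opp_r; apply plus_zero_l. Qed.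

Lemma Cconj_R (r : R) : Cconj (RtoC r) = RtoC r.
Proof. unfold Cconj, RtoC; simpl; f_equal; ring. Qed.

Section Hilbert.

Context {H : HilbertSpace}.
Implicit Types x y z u v h : H.

Lemma inner_plus_r x y z : inner x (plus y z) = (inner x y + inner x z)%C.
Proof.
rewrite inner_conj, inner_plus_l, Cplus_conj, <- !inner_conj; reflexivity.
Qed.

Lemma inner_scal_r (c : C) x y :
  inner x (scal (c : C_AbsRing) y) = (Cconj c * inner x y)%C.
Proof. rewrite inner_conj, inner_scal_l, Cmult_conj, <- inner_conj; reflexivity. Qed.

Lemma inner_opp_l x y : inner (opp x) y = (- inner x y)%C.
Proof.
replace (opp x) with (scal ((- (1))%C : C_AbsRing) x) by exact (scal_opp_one x).
rewrite inner_scal_l; ring.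
Qed.

Lemma inner_opp_r x y : inner x (opp y) = (- inner x y)%C.
Proof. rewrite inner_conj, inner_opp_l, Copp_conj, <- inner_conj; reflexivity. Qed.

Lemma inner_minus_l x y z : inner (minus x y) z = (inner x z - inner y z)%C.
Proof. unfold minus; rewrite inner_plus_l, inner_opp_l; reflexivity. Qed.

Lemma inner_minus_r x y z : inner x (minus y z) = (inner x y - inner x z)%C.
Proof. unfold minus; rewrite inner_plus_r, inner_opp_r; reflexivity. Qed.

Lemma inner_zero_r x : inner x zero = RtoC 0.
Proof.
transitivity (inner x (minus x x)); [|rewrite inner_minus_r; ring].
apply f_equal; symmetry; exact (minus_eq_zero x).
Qed.

(** Expand the squared norm of [|y|^2 x - <x, y> y]. *)
Lemma cauchy_schwarz x y : Cmod (inner x y) <= norm x * norm y.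
Proof.
assert (nx := norm_ge_0 x); assert (ny := norm_ge_0 y).
destruct (Req_dec (norm y) 0) as [y0|y0].
  rewrite y0, Rmult_0_r, (norm_eq_zero y y0), inner_zero_r, Cmod_0; lra.
set (c := inner x y); set (n := norm y ^ 2).
assert (n0 : 0 < n) by (unfold n; simpl; nra).
set (w := minus (scal (RtoC n : C_AbsRing) x) (scal (c : C_AbsRing) y) : H).
assert (E : inner w w = RtoC (n * n * norm x ^ 2 - n * Cmod c ^ 2)).
  unfold w; rewrite !inner_minus_l, !inner_minus_r, !inner_scal_l, !inner_scal_r.
  rewrite !inner_norm, (inner_conj H x y); fold c; fold n.
  rewrite RtoC_minus, !RtoC_mult.
  rewrite Cmod2_conj; rewrite Cconj_R; ring.
rewrite inner_norm in E; apply RtoC_inj in E.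
assert (w0 := pow2_ge_0 (norm w)).
assert (k : Cmod c ^ 2 <= (norm x * norm y) ^ 2).
  apply Rmult_le_reg_l with n; [exact n0|].
  rewrite E in w0; rewrite Rpow_mult_distr; fold n; nra.
apply Rsqr_incr_0_var; [rewrite !Rsqr_pow2; exact k|nra].
Qed.

Lemma Re_le_Cmod (c : C) : Re c <= Cmod c.
Proof. apply Rle_trans with (1 := Rle_abs _), re_le_Cmod. Qed.

Lemma norm_plus_sq x y : norm (plus x y) ^ 2 = norm x ^ 2 + 2 * Re (inner x y) + norm y ^ 2.
Proof.
apply RtoC_inj; rewrite <- inner_norm, !inner_plus_l, !inner_plus_r, !inner_norm, (inner_conj H x y).
rewrite !RtoC_plus, RtoC_mult; destruct (inner x y) as [p q].
unfold Cplus, Cmult, Cconj, RtoC; simpl; f_equal; ring.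
Qed.

Section Riesz.

Variables (phi : H -> C) (M : R).
Hypothesis phi_plus : forall x y, phi (plus x y) = (phi x + phi y)%C.
Hypothesis phi_scal : forall (c : C) x, phi (scal (c : C_AbsRing) x) = (c * phi x)%C.
Hypothesis phi_bound : forall x, Cmod (phi x) <= M * norm x.

Let J x := norm x ^ 2 - 2 * Re (phi x).

(** The energy [|x|^2 - 2 Re (phi x)] is minimised by the vector that represents
    [phi]. *)
Lemma energy_lower_bound x : - (M * M) <= J x.
Proof.
unfold J; assert (k := Re_le_Cmod (phi x)); assert (k' := phi_bound x).
assert (s := pow2_ge_0 (norm x - M)); nra.
Qed.

Lemma energy_shift x h (t : R) :
  J (plus x (scal (RtoC t : C_AbsRing) h)) =
  J x + 2 * t * (Re (inner x h) - Re (phi h)) + t ^ 2 * norm h ^ 2.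
Proof.
unfold J; rewrite norm_plus_sq, phi_plus, phi_scal, inner_scal_r, Cconj_R.
assert (E : norm (scal (RtoC t : C_AbsRing) h) ^ 2 = t ^ 2 * norm h ^ 2).
  apply RtoC_inj; rewrite <- inner_norm, inner_scal_l, inner_scal_r, inner_norm, Cconj_R.
  rewrite !RtoC_mult; simpl; rewrite !RtoC_mult; ring.
rewrite E; destruct (phi x) as [a b], (phi h) as [c d], (inner x h) as [e f]; simpl; ring.
Qed.

Lemma energy_inf : exists m, (forall x, m <= J x) /\
  forall e, 0 < e -> exists x, J x < m + e.
Proof.
destruct (completeness (fun r => exists x, r = - J x)) as [s [S1 S2]].
- exists (M * M); intros r [x ->]; assert (k := energy_lower_bound x); lra.
- now exists (- J zero), zero.
- exists (- s); split.
  + intros x; assert (k := S1 (- J x) (ex_intro _ x eq_refl)); lra.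
  + intros e e0; apply NNPP; intros no.
    assert (k : s <= s - e); [|lra].
    apply S2; intros r [x ->].
    destruct (Rle_dec (- J x) (s - e)) as [h|h]; [exact h|].
    destruct no; exists x; lra.
Qed.

(** Near-minimisers of the energy form a Cauchy filter, by the parallelogram
    identity in the form of [energy_shift]. A small energy excess forces a small
    slope in each direction, so at the limit the slope is zero, which is the
    representation of the real part of [phi]; replacing [h] by [i h] gives the
    imaginary part. *)
Lemma riesz_exists : exists u, forall h, phi h = inner h u.
Proof.
destruct energy_inf as [m [m1 m2]].
assert (slope : forall x h e, J x <= m + e -> (Re (inner x h) - Re (phi h)) ^ 2 <= e * norm h ^ 2).
  intros x h e hx.
  set (q := Re (inner x h) - Re (phi h)).
  assert (n := norm_ge_0 h).
  (* A quadratic in [t] that is nonnegative; it is evaluated at its minimum or,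
     when [h] is null, where its linear term is [- (e + 1)]. *)
  assert (k : forall t, 0 <= e + 2 * t * q + t ^ 2 * norm h ^ 2).
    intros t; assert (k := m1 (plus x (scal (RtoC t : C_AbsRing) h))).
    rewrite energy_shift in k; fold q in k; lra.
  destruct (Req_dec (norm h) 0) as [h0|h0].
  - assert (k' := k (- (e + 1) * / (2 * q))).
    destruct (Req_dec q 0) as [->|q0]; [rewrite h0; simpl; lra|].
    rewrite h0 in k'; replace (2 * (- (e + 1) * / (2 * q)) * q) with (- (e + 1)) in k' by (field; exact q0).
    simpl in k'; lra.
  - assert (k' := k (- q / norm h ^ 2)).
    assert (p : 0 < norm h ^ 2) by (apply pow_lt; lra).
    apply (Rmult_le_compat_r (norm h ^ 2)) in k'; [|lra].
    replace ((e + 2 * (- q / norm h ^ 2) * q + (- q / norm h ^ 2) ^ 2 * norm h ^ 2) * norm h ^ 2)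
      with (e * norm h ^ 2 - q ^ 2) in k' by (field; lra).
    lra.
assert (close : forall x y e, J x <= m + e -> J y <= m + e -> norm (minus y x) ^ 2 <= 4 * e).
  intros x y e hx hy.
  assert (k := energy_shift x (minus y x) (/ 2)).
  assert (k' := m1 (plus x (scal (RtoC (/ 2) : C_AbsRing) (minus y x)))).
  assert (k2 := energy_shift x (minus y x) 1).
  replace (plus x (scal (RtoC 1 : C_AbsRing) (minus y x))) with y in k2.
    simpl in *; lra.
  change (RtoC 1 : C_AbsRing) with (one : C_AbsRing); rewrite (scal_one (minus y x)).
  symmetry; exact (plus_minus_cancel x y).
(* The filter of sublevel sets of the energy above its infimum. *)
set (F := fun P : H -> Prop => exists e, 0 < e /\ forall x, J x < m + e -> P x).
assert (PF : ProperFilter F).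
  constructor; [|constructor].
  - intros P [e [e0 He]]; destruct (m2 e e0) as [x hx]; exists x; now apply He.
  - exists 1; split; [lra|auto].
  - intros P Q [e [e0 He]] [d [d0 Hd]]; exists (Rmin e d); split; [now apply Rmin_glb_lt|].
    intros x hx; assert (l := Rmin_l e d); assert (l' := Rmin_r e d); split; [apply He|apply Hd]; lra.
  - intros P Q PQ [e [e0 He]]; exists e; split; [exact e0|auto].
assert (cF : cauchy F).
  intros e.
  assert (p : 0 < e ^ 2 / 8) by (assert (k := cond_pos e); apply Rdiv_lt_0_compat; [apply pow_lt|]; lra).
  destruct (m2 _ p) as [x hx]; exists x, (e ^ 2 / 8); split; [exact p|]; intros y hy.
  apply (norm_compat1 (V := H)).
  assert (k := close x y (e ^ 2 / 8) ltac:(lra) ltac:(lra)).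
  apply Rsqr_incrst_0; [|apply norm_ge_0|left; apply cond_pos].
  assert (k' := pow_lt e 2 (cond_pos e)).
  rewrite !Rsqr_pow2; apply Rle_lt_trans with (1 := k); lra.
assert (lim_near := complete_cauchy (T := H) F PF cF).
set (u := lim F) in lim_near; exists u.
assert (re : forall h, Re (phi h) = Re (inner h u)).
  intros h; set (n := norm h); assert (n0 : 0 <= n) by apply norm_ge_0.
  assert (k : forall e, 0 < e -> Rabs (Re (inner u h) - Re (phi h)) <= e * (2 * n)).
    intros e e0.
    set (c := @norm_factor _ H); assert (c0 : 0 < c) by apply norm_factor_gt_0.
    assert (p : 0 < e / c) by (apply Rdiv_lt_0_compat; lra).
    destruct (lim_near (mkposreal _ p)) as [d [d0 Hd]].
    assert (e2 : 0 < e ^ 2) by (apply pow_lt; lra).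
    destruct (m2 (Rmin d (e ^ 2)) ltac:(now apply Rmin_glb_lt)) as [x hx].
    assert (l := Rmin_l d (e ^ 2)); assert (l' := Rmin_r d (e ^ 2)).
    assert (b := Hd x ltac:(lra)).
    apply (norm_compat2 (V := H)) in b; simpl in b; fold c in b.
    replace (c * (e / c)) with e in b by (field; lra).
    assert (s := slope x h (e ^ 2) ltac:(lra)); fold n in s.
    assert (s1 : Rabs (Re (inner x h) - Re (phi h)) <= e * n).
      apply Rsqr_incr_0_var; [|nra].
      rewrite <- Rsqr_abs, !Rsqr_pow2; nra.
    assert (s2 : Rabs (Re (inner x h) - Re (inner u h)) <= e * n).
      replace (Re (inner x h) - Re (inner u h)) with (Re (inner (minus x u) h)).
        apply Rle_trans with (1 := re_le_Cmod _), Rle_trans with (1 := cauchy_schwarz _ _).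
        apply Rmult_le_compat_r; [exact n0|left; exact b].
      rewrite inner_minus_l; reflexivity.
    apply Rabs_le_between in s1; apply Rabs_le_between in s2; apply Rabs_le; lra.
  assert (z : Rabs (Re (inner u h) - Re (phi h)) <= 0).
    apply le_epsilon; intros e e0; rewrite Rplus_0_l.
    assert (p : 0 < e / (2 * n + 1)) by (apply Rdiv_lt_0_compat; lra).
    apply Rle_trans with (1 := k _ p).
    apply Rmult_le_reg_r with (2 * n + 1); [lra|].
    replace (e / (2 * n + 1) * (2 * n) * (2 * n + 1)) with (e * (2 * n)) by (field; lra); nra.
  assert (z' := Rabs_pos (Re (inner u h) - Re (phi h))).
  assert (zz : Re (inner u h) - Re (phi h) = 0).
    destruct (Req_dec (Re (inner u h) - Re (phi h)) 0) as [e|n']; [exact e|].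
    apply Rabs_pos_lt in n'; lra.
  rewrite (inner_conj H u h); unfold Re, Cconj in *; simpl in *; lra.
intros h; assert (r1 := re h); assert (r2 := re (scal (Ci : C_AbsRing) h)).
rewrite phi_scal, inner_scal_l in r2.
destruct (phi h) as [a b], (inner h u) as [c d]; simpl in *; f_equal; lra.
Qed.

End Riesz.

Lemma inner_ext x y : (forall z, inner z x = inner z y) -> x = y.
Proof.
intros e.
assert (k : norm (minus x y) ^ 2 = 0).
  apply RtoC_inj; rewrite <- inner_norm, inner_minus_r, e; ring.
assert (z : norm (minus x y) = 0) by (destruct (Req_dec (norm (minus x y)) 0) as [h|h]; [exact h|]; apply (pow_nonzero _ 2) in h; contradiction).
apply (plus_reg_r (opp y)); rewrite plus_opp_r; exact (norm_eq_zero (minus x y) z).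
Qed.

Lemma adjoint_exists (A : operator H) : exists B, is_adjoint A B.
Proof.
assert (A0 := opnorm_ge0 A).
assert (ex : forall y, exists u, forall x, inner (A x) y = inner x u).
  intros y; apply (riesz_exists (fun x => inner (A x) y) (opnorm A * norm y)).
  - intros x x'; rewrite (linear_plus _ (op_linear A)); apply inner_plus_l.
  - intros c x; rewrite (linear_scal _ (op_linear A)); apply inner_scal_l.
  - intros x; apply Rle_trans with (1 := cauchy_schwarz _ _).
    assert (k := opnorm_ub A x); assert (n := norm_ge_0 y); nra.
set (b := fun y => choose_or zero (fun u => forall x, inner (A x) y = inner x u)).
assert (hb : forall x y, inner (A x) y = inner x (b y)).
  intros x y; exact (choose_or_spec zero _ (ex y) x).
assert (lb : is_linear b).
  apply Build_is_linear.
  - intros y z; apply inner_ext; intros x.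
    rewrite <- hb, !inner_plus_r, !hb; reflexivity.
  - intros c y; apply inner_ext; intros x.
    rewrite <- hb, !inner_scal_r, hb; reflexivity.
  - exists (opnorm A + 1); split; [lra|]; intros y.
    assert (n := norm_ge_0 (b y)); assert (n' := norm_ge_0 y).
    assert (k : norm (b y) ^ 2 <= opnorm A * norm (b y) * norm y).
      apply Rle_trans with (Cmod (inner (A (b y)) y)).
        rewrite hb, inner_norm, Cmod_R; apply Rle_abs.
      apply Rle_trans with (1 := cauchy_schwarz _ _).
      apply Rmult_le_compat_r; [exact n'|apply opnorm_ub].
    destruct (Req_dec (norm (b y)) 0) as [e|e]; [rewrite e; nra|].
    apply Rmult_le_reg_l with (norm (b y)); [lra|]; simpl in k; nra.
now exists (Operator b lb).
Qed.

Lemma adjointP (A : operator H) x y : inner (A x) y = inner x (adjoint A y).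
Proof. exact (choose_or_spec op_zero _ (adjoint_exists A) x y). Qed.

Lemma opnorm_le_inner (A : operator H) (M : R) : 0 <= M ->
  (forall x y, Cmod (inner (A x) y) <= M * norm x * norm y) -> opnorm A <= M.
Proof.
intros M0 hM; apply opnorm_le; [exact M0|]; intros x.
assert (n := norm_ge_0 (A x)); assert (nx := norm_ge_0 x).
assert (k := hM x (A x)); rewrite inner_norm, Cmod_R, Rabs_pos_eq in k by apply pow2_ge_0.
destruct (Req_dec (norm (A x)) 0) as [e|e]; [rewrite e; nra|].
apply Rmult_le_reg_r with (norm (A x)); [lra|]; simpl in k; nra.
Qed.

Lemma opnorm_adjoint_le (A : operator H) : opnorm (adjoint A) <= opnorm A.
Proof.
apply opnorm_le_inner; [apply opnorm_ge0|]; intros x y.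
rewrite inner_conj, Cmod_conj, <- adjointP.
apply Rle_trans with (1 := cauchy_schwarz _ _).
assert (k := opnorm_ub A y); assert (n := norm_ge_0 x); nra.
Qed.

End Hilbert.

(** * The resolvent set *)

Lemma minus_plus_cancel {G : AbelianGroup} (a b c : G) :
  minus (plus a b) (plus a c) = minus b c.
Proof. rewrite minus_plus_plus, minus_eq_zero; apply plus_zero_l. Qed.

Lemma plus_minus_l {G : AbelianGroup} (a b : G) : minus (plus a b) a = b.
Proof.
unfold minus; rewrite (plus_comm a b).
transitivity (plus b (plus a (opp a))); [symmetry; apply plus_assoc|].
transitivity (plus b zero); [exact (f_equal (plus b) (plus_opp_r a))|apply plus_zero_r].
Qed.

Section Neumann.

Context {E : CompleteNormedModule C_AbsRing}.
Implicit Types A B N : operator E.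

Lemma opnorm_comp A B : opnorm (op_comp A B) <= opnorm A * opnorm B.
Proof.
assert (a := opnorm_ge0 A); assert (b := opnorm_ge0 B).
apply opnorm_le; [nra|]; intros x; simpl.
apply Rle_trans with (1 := opnorm_ub A (B x)).
rewrite Rmult_assoc; apply Rmult_le_compat_l; [exact a|apply opnorm_ub].
Qed.

Lemma opnorm_minus_sym A B : opnorm (minus A B) = opnorm (minus B A).
Proof. rewrite <- (opp_minus B A); apply (opnorm_opp (minus B A)). Qed.

Lemma opnorm_triangle B A D : opnorm (minus A D) <= opnorm (minus A B) + opnorm (minus B D).
Proof. rewrite (minus_trans B A D); apply opnorm_plus. Qed.

Lemma operator_eq_small A B : (forall e, 0 < e -> opnorm (minus A B) <= e) -> A = B.
Proof.
intros h; assert (z : opnorm (minus A B) = 0).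
  apply Rle_antisym; [|apply opnorm_ge0]; apply le_epsilon; intros e e0.
  rewrite Rplus_0_l; now apply h.
apply opnorm_eq0 in z; apply (plus_reg_r (opp B)).
rewrite plus_opp_r; exact z.
Qed.

Fixpoint op_pow N (n : nat) : operator E :=
  match n with O => op_one | S m => op_comp N (op_pow N m) end.

Lemma op_pow_comm N n : op_comp N (op_pow N n) = op_comp (op_pow N n) N.
Proof.
induction n as [|n IH]; apply operator_eq; intros x; [reflexivity|].
assert (k := f_equal (fun A : operator E => A x) IH); simpl in *; now rewrite k.
Qed.

Lemma opnorm_pow N n : opnorm N <= / 2 -> opnorm (op_pow N n) <= (/ 2) ^ n.
Proof.
intros h; induction n as [|n IH]; simpl.
- apply opnorm_le; [lra|]; intros x; simpl; lra.
- apply Rle_trans with (1 := opnorm_comp _ _).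
  apply Rmult_le_compat; auto using opnorm_ge0.
Qed.

Lemma op_comp_plus_r A B D : op_comp A (plus B D) = plus (op_comp A B) (op_comp A D).
Proof. apply operator_eq; intros x; exact (linear_plus _ (op_linear A) _ _). Qed.

Lemma op_comp_plus_l A B D : op_comp (plus A B) D = plus (op_comp A D) (op_comp B D).
Proof. apply operator_eq; reflexivity. Qed.

Lemma op_comp_minus_r A B D : op_comp A (minus B D) = minus (op_comp A B) (op_comp A D).
Proof.
apply operator_eq; intros x.
transitivity (plus (A (B x)) (A (opp (D x)))).
- exact (linear_plus _ (op_linear A) (B x) (opp (D x))).
- exact (f_equal (plus (A (B x))) (linear_opp _ (D x) (op_linear A))).
Qed.

Lemma op_comp_minus_l A B D : op_comp (minus A B) D = minus (op_comp A D) (op_comp B D).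
Proof. apply operator_eq; reflexivity. Qed.

Lemma geometric_sum N n :
  sum_n (op_pow N) (S n) = plus op_one (op_comp N (sum_n (op_pow N) n)) /\
  sum_n (op_pow N) (S n) = plus op_one (op_comp (sum_n (op_pow N) n) N).
Proof.
induction n as [|n [IH1 IH2]].
- rewrite sum_Sn, sum_O; split; apply operator_eq; reflexivity.
- rewrite sum_Sn; split.
  + rewrite IH1 at 1; rewrite (sum_Sn _ n), op_comp_plus_r, plus_assoc; reflexivity.
  + rewrite IH2 at 1; rewrite (sum_Sn _ n), op_comp_plus_l, plus_assoc.
    f_equal; apply (op_pow_comm N (S n)).
Qed.

(** The Neumann series, written with the two fixed point equations that a
    geometric sum satisfies. *)
Lemma neumann N : opnorm N <= / 2 ->
  exists S, plus op_one (op_comp N S) = S /\ plus op_one (op_comp S N) = S.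
Proof.
intros h.
destruct (ex_series_le (K := R_AbsRing) (V := @operator_CompleteNormedModule E)
  (op_pow N) (fun n => (/ 2) ^ n)) as [S HS].
- intros n; exact (opnorm_pow N n h).
- exists (/ (1 - / 2)); apply is_series_geom; rewrite Rabs_pos_eq; lra.
- exists S.
  assert (near : forall e, 0 < e -> exists n,
    opnorm (minus (sum_n (op_pow N) n) S) < e /\
    opnorm (minus (sum_n (op_pow N) (Datatypes.S n)) S) < e).
    intros e e0.
    destruct (HS (fun A => opnorm (minus A S) < e)) as [n Hn].
      exists (mkposreal e e0); intros A HA; exact HA.
    exists n; split; apply Hn; auto.
  assert (n0 := opnorm_ge0 N).
  split; apply operator_eq_small; intros e e0;
    destruct (near (e / 2) ltac:(lra)) as [n [h1 h2]];
    apply Rle_trans with (1 := opnorm_triangle (sum_n (op_pow N) (Datatypes.S n)) _ _).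
  + destruct (geometric_sum N n) as [g _]; rewrite g at 1.
    replace (minus (plus op_one (op_comp N S)) (plus op_one (op_comp N (sum_n (op_pow N) n))))
      with (op_comp N (minus S (sum_n (op_pow N) n))).
    * rewrite opnorm_minus_sym in h1.
      replace e with (e / 2 + e / 2) by field.
      apply Rplus_le_compat; [|left; exact h2].
      apply Rle_trans with (1 := opnorm_comp _ _), Rle_trans with (/ 2 * (e / 2)); [|lra].
      apply Rmult_le_compat; [exact n0|apply opnorm_ge0|exact h|left; exact h1].
    * rewrite op_comp_minus_r; symmetry.
      exact (minus_plus_cancel (G := @operator_AbelianGroup E) op_one _ _).
  + destruct (geometric_sum N n) as [_ g]; rewrite g at 1.
    replace (minus (plus op_one (op_comp S N)) (plus op_one (op_comp (sum_n (op_pow N) n) N)))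
      with (op_comp (minus S (sum_n (op_pow N) n)) N).
    * rewrite opnorm_minus_sym in h1.
      replace e with (e / 2 + e / 2) by field.
      apply Rplus_le_compat; [|left; exact h2].
      apply Rle_trans with (1 := opnorm_comp _ _), Rle_trans with (e / 2 * / 2); [|lra].
      apply Rmult_le_compat; [apply opnorm_ge0|exact n0|left; exact h1|exact h].
    * rewrite op_comp_minus_l; symmetry.
      exact (minus_plus_cancel (G := @operator_AbelianGroup E) op_one _ _).
Qed.

Variable T : operator E.

Lemma resolventP z : ~ spectrum T z -> is_inverse (minus (op_scal z op_one) T) (resolvent T z).
Proof.
intros h; apply (choose_or_spec op_zero (is_inverse (minus (op_scal z op_one) T))).
apply NNPP; exact h.
Qed.

Lemma resolvent_r z (x : E) : ~ spectrum T z ->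
  minus (scal (z : C_AbsRing) (resolvent T z x)) (T (resolvent T z x)) = x.
Proof.
intros h; destruct (resolventP z h) as [h1 _].
exact (f_equal (fun A : operator E => A x) h1).
Qed.

Lemma resolvent_l z (x : E) : ~ spectrum T z ->
  resolvent T z (minus (scal (z : C_AbsRing) x) (T x)) = x.
Proof.
intros h; destruct (resolventP z h) as [_ h1].
exact (f_equal (fun A : operator E => A x) h1).
Qed.

Lemma scal_shift (z w : C) (x y : E) :
  minus (scal (w : C_AbsRing) x) y =
  plus (minus (scal (z : C_AbsRing) x) y) (scal ((w - z)%C : C_AbsRing) x).
Proof.
replace (scal (w : C_AbsRing) x) with
  (plus (scal (z : C_AbsRing) x) (scal ((w - z)%C : C_AbsRing) x)).
- unfold minus; rewrite <- !plus_assoc; f_equal; apply plus_comm.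
- rewrite <- scal_distr_r; f_equal; change (z + (w - z) = w)%C; ring.
Qed.

Lemma resolvent_identity z w (x : E) : ~ spectrum T z -> ~ spectrum T w ->
  resolvent T z x = plus (resolvent T w x)
    (scal ((w - z)%C : C_AbsRing) (resolvent T z (resolvent T w x))).
Proof.
intros hz hw.
set (u := resolvent T w x).
rewrite <- (resolvent_r w x hw) at 1; fold u.
rewrite (scal_shift z w), (linear_plus _ (op_linear (resolvent T z))).
rewrite (resolvent_l z u hz), (linear_scal _ (op_linear (resolvent T z))); reflexivity.
Qed.

(** With [R] the resolvent at [z], the operator [w - T] is [(z - T)(1 + (w - z)
    R)], and [neumann] inverts the second factor. This gives a right inverse [R
    S] and a left inverse [S R], which then coincide. *)
Lemma resolvent_set_neumann z w : ~ spectrum T z ->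
  opnorm (resolvent T z) * Cmod (w - z) <= / 2 -> ~ spectrum T w.
Proof.
intros hz small.
set (R := resolvent T z) in *.
set (N := op_scal (- (w - z))%C R).
assert (hN : opnorm N <= / 2).
  apply opnorm_le; [lra|]; intros x.
  apply Rle_trans with (1 := norm_scal ((- (w - z))%C : C_AbsRing) (R x)).
  change (abs (- (w - z))%C) with (Cmod (- (w - z))); rewrite Cmod_opp.
  assert (k := opnorm_ub R x); assert (nx := norm_ge_0 x); assert (c := Cmod_ge_0 (w - z)).
  apply Rle_trans with (Cmod (w - z) * (opnorm R * norm x)); [now apply Rmult_le_compat_l|nra].
destruct (neumann N hN) as [S [S1 S2]].
intros sp; apply sp; clear sp.
assert (eN : forall x, N x = scal ((- (w - z))%C : C_AbsRing) (R x)) by reflexivity.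
assert (s1 : forall x, plus x (N (S x)) = S x).
  intros x; exact (f_equal (fun A : operator E => A x) S1).
assert (s2 : forall x, plus x (S (N x)) = S x).
  intros x; exact (f_equal (fun A : operator E => A x) S2).
assert (Rr : forall x, minus (scal (z : C_AbsRing) (R x)) (T (R x)) = x)
  by (intros x; now apply resolvent_r).
assert (Rl : forall x, R (minus (scal (z : C_AbsRing) x) (T x)) = x)
  by (intros x; now apply resolvent_l).
assert (opp_scal : forall x : E, plus (scal ((w - z)%C : C_AbsRing) x) (scal ((- (w - z))%C : C_AbsRing) x) = zero).
  intros x; rewrite <- scal_distr_r.
  transitivity (scal (zero : C_AbsRing) x); [|exact (scal_zero_l x)].
  f_equal; change ((w - z) + (- (w - z)) = 0)%C; ring.
assert (right : forall x, minus (scal (w : C_AbsRing) (R (S x))) (T (R (S x))) = x).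
  intros x; rewrite (scal_shift z w), Rr, <- (s1 x) at 1.
  rewrite eN, <- plus_assoc.
  rewrite (plus_comm (scal ((- (w - z))%C : C_AbsRing) (R (S x)))), opp_scal.
  apply plus_zero_r.
assert (left : forall x, S (R (minus (scal (w : C_AbsRing) x) (T x))) = x).
  intros x; set (v := minus (scal (w : C_AbsRing) x) (T x)).
  assert (Rv : R v = plus x (scal ((w - z)%C : C_AbsRing) (R x))).
    unfold v; rewrite (scal_shift z w), (linear_plus _ (op_linear R)), Rl, (linear_scal _ (op_linear R)).
    reflexivity.
  rewrite Rv, (linear_plus _ (op_linear S)).
  rewrite <- (s2 x), <- plus_assoc, eN, <- (linear_plus _ (op_linear S)).
  rewrite (plus_comm (scal ((- (w - z))%C : C_AbsRing) (R x))), opp_scal.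
  transitivity (plus x (zero : E)); [|exact (plus_zero_r x)].
  f_equal; exact (linear_zero _ (op_linear S)).
exists (op_comp R S); split; apply operator_eq; intros x.
- exact (right x).
- change (R (S (minus (scal (w : C_AbsRing) x) (T x))) = x).
  set (v := minus (scal (w : C_AbsRing) x) (T x)).
  rewrite <- (left (R (S v))), right; apply left.
Qed.

End Neumann.

(** * Multiplicativity of the functional calculus *)

Lemma norm_scal_le {E : CompleteNormedModule C_AbsRing} (c : C) (x : E) :
  norm (scal (c : C_AbsRing) x) <= Cmod c * norm x.
Proof. exact (norm_scal (c : C_AbsRing) x). Qed.

Lemma opnorm_op_scal {E : CompleteNormedModule C_AbsRing} (c : C) (A : operator E) :
  opnorm (op_scal c A) <= Cmod c * opnorm A.
Proof.
assert (p := Cmod_ge_0 c); assert (a := opnorm_ge0 A).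
apply opnorm_le; [nra|]; intros x.
apply Rle_trans with (1 := norm_scal_le c (A x)).
rewrite Rmult_assoc; apply Rmult_le_compat_l; [exact p|apply opnorm_ub].
Qed.

Lemma scal_minus_minus {K : Ring} {V : ModuleSpace K} (c d : K) (a b : V) :
  plus (scal (minus c d) a) (scal d (minus a b)) = minus (scal c a) (scal d b).
Proof.
rewrite scal_minus_distr_r, scal_minus_distr_l; symmetry.
exact (minus_trans (scal d a) (scal c a) (scal d b)).
Qed.

Section Resolvent.

Context {E : CompleteNormedModule C_AbsRing}.
Variable T : operator E.

Lemma resolvent_locally_bounded z : ~ spectrum T z -> exists d, 0 < d /\ forall w, Cmod (w - z) < d ->
  ~ spectrum T w /\ opnorm (resolvent T w) <= 2 * opnorm (resolvent T z).
Proof.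
intros hz; set (r := opnorm (resolvent T z)); assert (r0 : 0 <= r) by apply opnorm_ge0.
exists (/ (2 * (r + 1))); split; [apply Rinv_0_lt_compat; lra|]; intros w hw.
assert (small : r * Cmod (w - z) <= / 2).
  assert (c := Cmod_ge_0 (w - z)).
  apply (Rmult_lt_compat_r (2 * (r + 1))) in hw; [|lra].
  rewrite Rinv_l in hw by lra; nra.
assert (nw : ~ spectrum T w) by exact (resolvent_set_neumann T z w hz small).
split; [exact nw|].
set (q := opnorm (resolvent T w)); assert (q0 : 0 <= q) by apply opnorm_ge0.
assert (k : q <= r + / 2 * q); [|lra].
apply opnorm_le; [lra|]; intros x.
rewrite (resolvent_identity T w z x nw hz).
apply Rle_trans with (1 := norm_plus_le _ _).
assert (k1 := opnorm_ub (resolvent T z) x); fold r in k1.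
assert (k2 := opnorm_ub (resolvent T w) (resolvent T z x)); fold q in k2.
assert (k3 := norm_scal_le (z - w)%C (resolvent T w (resolvent T z x))).
rewrite (Cmod_minus_sym z w) in k3.
assert (n := norm_ge_0 x); assert (c := Cmod_ge_0 (w - z)).
assert (k4 : norm (resolvent T w (resolvent T z x)) <= q * (r * norm x)).
  apply Rle_trans with (1 := k2); now apply Rmult_le_compat_l.
assert (k5 : Cmod (w - z) * norm (resolvent T w (resolvent T z x)) <= / 2 * q * norm x).
  apply Rle_trans with (Cmod (w - z) * (q * (r * norm x))); [now apply Rmult_le_compat_l|].
  assert (0 <= q * norm x) by nra; nra.
rewrite Rmult_plus_distr_r; apply Rplus_le_compat; [exact k1|].
exact (Rle_trans _ _ _ k3 k5).
Qed.

(** The resolvent identity turns the local bound into a Lipschitz estimate. *)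
Lemma resolvent_lipschitz z : ~ spectrum T z -> exists d M, 0 < d /\ 0 <= M /\
  forall w, Cmod (w - z) < d -> ~ spectrum T w /\ opnorm (resolvent T w) <= M /\
    opnorm (minus (resolvent T w) (resolvent T z)) <= M * Cmod (w - z).
Proof.
intros hz; destruct (resolvent_locally_bounded z hz) as [d [d0 Hd]].
set (r := opnorm (resolvent T z)) in *; assert (r0 : 0 <= r) by apply opnorm_ge0.
exists d, (2 * r + 2 * r * r); split; [exact d0|]; split; [nra|]; intros w hw.
destruct (Hd w hw) as [nw hr]; split; [exact nw|]; split; [nra|].
assert (c := Cmod_ge_0 (w - z)).
apply opnorm_le; [apply Rmult_le_pos; nra|]; intros x.
assert (D : minus (resolvent T w) (resolvent T z) x =
  scal ((z - w)%C : C_AbsRing) (resolvent T w (resolvent T z x))).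
  change (minus (resolvent T w x) (resolvent T z x) =
    scal ((z - w)%C : C_AbsRing) (resolvent T w (resolvent T z x))).
  rewrite (resolvent_identity T w z x nw hz) at 1.
  exact (plus_minus_l (resolvent T z x) _).
rewrite D; apply Rle_trans with (1 := norm_scal_le _ _).
rewrite Cmod_minus_sym, (Rmult_comm (2 * r + 2 * r * r)), Rmult_assoc.
apply Rmult_le_compat_l; [exact c|].
apply Rle_trans with (1 := opnorm_ub _ _).
assert (k1 := opnorm_ub (resolvent T z) x); fold r in k1.
assert (n := norm_ge_0 x); assert (q0 := opnorm_ge0 (resolvent T w)).
apply Rle_trans with (2 * r * (r * norm x)); [|nra].
apply Rmult_le_compat; [exact q0|apply norm_ge_0|exact hr|exact k1].
Qed.

End Resolvent.

Section Calculus.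

Context {H : HilbertSpace}.
Variable T : operator H.

Definition matrix_coef (x y : H) (w : C) : C := inner (resolvent T w x) y.

Lemma matrix_coef_bound (x y : H) (w : C) :
  Cmod (matrix_coef x y w) <= opnorm (resolvent T w) * norm x * norm y.
Proof.
apply Rle_trans with (1 := cauchy_schwarz _ _).
apply Rmult_le_compat_r; [apply norm_ge_0|apply opnorm_ub].
Qed.

(** The derivative is [- <R(z) R(z) x, y>]; the resolvent identity reduces it to
    the continuity of [R]. *)
Lemma matrix_coef_diff (x y : H) (z : C) : ~ spectrum T z -> cdiff (matrix_coef x y) z.
Proof.
intros hz; exists (- inner (resolvent T z (resolvent T z x)) y)%C.
destruct (resolvent_lipschitz T z hz) as [d [M [d0 [M0 HM]]]].
set (K := M * norm (resolvent T z x) * norm y).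
assert (K0 : 0 <= K) by (unfold K; repeat apply Rmult_le_pos; (exact M0 || apply norm_ge_0)).
apply cderiveP; intros e e0; exists (Rmin d (e / (K + 1))); split.
  apply Rmin_glb_lt; [exact d0|apply Rdiv_lt_0_compat; lra].
intros w hw.
destruct (HM w (Rlt_le_trans _ _ _ hw (Rmin_l _ _))) as [nw [_ lip]].
assert (h2 := Rlt_le_trans _ _ _ hw (Rmin_r _ _)).
set (u := resolvent T z x) in *.
assert (e1 : matrix_coef x y w = (matrix_coef x y z + (z - w) * inner (resolvent T w u) y)%C).
  unfold matrix_coef at 1; rewrite (resolvent_identity T w z x nw hz); fold u.
  rewrite inner_plus_l, inner_scal_l; reflexivity.
assert (e2 : inner (minus (resolvent T w) (resolvent T z) u) y =
  (inner (resolvent T w u) y - inner (resolvent T z u) y)%C) by apply inner_minus_l.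
replace (matrix_coef x y w - matrix_coef x y z - (w - z) * - inner (resolvent T z u) y)%C
  with ((- (w - z)) * inner (minus (resolvent T w) (resolvent T z) u) y)%C
  by (rewrite e1, e2; ring).
rewrite Cmod_mult, Cmod_opp, Rmult_comm; apply Rmult_le_compat_r; [apply Cmod_ge_0|].
assert (c := Cmod_ge_0 (w - z)).
apply Rle_trans with (K * Cmod (w - z)).
- apply Rle_trans with (1 := cauchy_schwarz _ _).
  assert (k := opnorm_ub (minus (resolvent T w) (resolvent T z)) u).
  replace (K * Cmod (w - z)) with (M * Cmod (w - z) * norm u * norm y) by (unfold K; fold u; ring).
  apply Rmult_le_compat_r; [apply norm_ge_0|].
  apply Rle_trans with (1 := k); apply Rmult_le_compat_r; [apply norm_ge_0|exact lip].
- apply (Rmult_lt_compat_r (K + 1)) in h2; [|lra].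
  replace (e / (K + 1) * (K + 1)) with e in h2 by (field; lra); nra.
Qed.

Lemma inner_linear (x y : H) : is_linear (U := operator_NormedModule) (V := C_R_NormedModule)
  (fun A : operator H => inner (A x) y).
Proof.
apply Build_is_linear.
- intros A B; exact (inner_plus_l H (A x) (B x) y).
- intros k A.
  transitivity (RtoC k * inner (A x) y)%C; [exact (inner_scal_l H (RtoC k) (A x) y)|].
  destruct (inner (A x) y) as [c1 c2]; unfold scal; simpl; unfold prod_scal, Cmult; simpl.
  unfold scal; simpl; unfold mult; simpl; f_equal; ring.
- assert (p : 0 <= norm x * norm y) by (apply Rmult_le_pos; apply norm_ge_0).
  exists (norm x * norm y + 1); split; [lra|]; intros A.
  rewrite Cmod_norm_R; apply Rle_trans with (1 := cauchy_schwarz _ _).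
  change (norm A) with (opnorm A); assert (k := opnorm_ub A x).
  assert (a := opnorm_ge0 A); assert (n := norm_ge_0 y).
  apply Rle_trans with (opnorm A * norm x * norm y); [now apply Rmult_le_compat_r|nra].
Qed.

Lemma resolvent_integrand_continuous (c : R -> C) (u : R -> C) (t : R) :
  rcont c t -> rcont u t -> ~ spectrum T (u t) ->
  continuous (T := R_UniformSpace) (U := operator_UniformSpace)
    (fun s => op_scal (c s) (resolvent T (u s))) t.
Proof.
intros hc hu ns; apply filterlim_locally; intros [e e0].
destruct (resolvent_lipschitz T (u t) ns) as [d [M [d0 [M0 HM]]]].
set (K := 2 + M + Cmod (c t) * M).
assert (ct := Cmod_ge_0 (c t)).
assert (K0 : 0 < K) by (unfold K; nra).
assert (p : 0 < e / K) by (apply Rdiv_lt_0_compat; lra).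
destruct (proj1 (rcontP c t) hc _ p) as [d1 [d10 H1]].
destruct (proj1 (rcontP u t) hu (Rmin d (e / K)) ltac:(now apply Rmin_glb_lt)) as [d2 [d20 H2]].
exists (mkposreal _ (Rmin_glb_lt _ _ _ d10 d20)); intros s hs.
change (Rabs (s - t) < Rmin d1 d2) in hs.
change (opnorm (minus (op_scal (c s) (resolvent T (u s))) (op_scal (c t) (resolvent T (u t)))) < e).
assert (h1 := H1 s (Rlt_le_trans _ _ _ hs (Rmin_l _ _))).
assert (h2 := H2 s (Rlt_le_trans _ _ _ hs (Rmin_r _ _))).
destruct (HM (u s) (Rlt_le_trans _ _ _ h2 (Rmin_l _ _))) as [_ [b1 b2]].
assert (h3 := Rlt_le_trans _ _ _ h2 (Rmin_r _ _)).
replace (minus (op_scal (c s) (resolvent T (u s))) (op_scal (c t) (resolvent T (u t)))) with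
  (plus (op_scal (c s - c t) (resolvent T (u s)))
     (op_scal (c t) (minus (resolvent T (u s)) (resolvent T (u t))))).
- apply Rle_lt_trans with (1 := opnorm_plus _ _).
  assert (k1 := opnorm_op_scal (c s - c t) (resolvent T (u s))).
  assert (k2 := opnorm_op_scal (c t) (minus (resolvent T (u s)) (resolvent T (u t)))).
  assert (k3 : Cmod (c s - c t) * opnorm (resolvent T (u s)) <= e / K * M).
    apply Rmult_le_compat; [apply Cmod_ge_0|apply opnorm_ge0|lra|exact b1].
  assert (k4 : Cmod (c t) * opnorm (minus (resolvent T (u s)) (resolvent T (u t))) <= Cmod (c t) * (M * (e / K))).
    apply Rmult_le_compat_l; [exact ct|].
    apply Rle_trans with (1 := b2), Rmult_le_compat_l; lra.
  apply Rle_lt_trans with (e / K * M + Cmod (c t) * (M * (e / K))).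
    apply Rplus_le_compat; [exact (Rle_trans _ _ _ k1 k3)|exact (Rle_trans _ _ _ k2 k4)].
  assert (hK : e / K * K = e) by (field; lra).
  set (q := e / K) in *; unfold K in hK; nra.
- apply operator_eq; intros x.
  change (plus (scal ((c s - c t)%C : C_AbsRing) (resolvent T (u s) x))
    (scal (c t : C_AbsRing) (minus (resolvent T (u s) x) (resolvent T (u t) x))) =
    minus (scal (c s : C_AbsRing) (resolvent T (u s) x)) (scal (c t : C_AbsRing) (resolvent T (u t) x))).
  exact (scal_minus_minus (c s : C_AbsRing) (c t : C_AbsRing) _ _).
Qed.

(** Reduces the operator-valued integral to scalar ones, for which complex
    analysis is available. *)
Lemma inner_cauchy_integral (G : list (list arc)) (f : C -> C) (x y : H) :
  cont_on (concat G) f -> (forall z, on_arcs (concat G) z -> ~ spectrum T z) ->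
  inner (cauchy_integral G T f x) y =
    (/ two_pi_i * line_int (concat G) (fun w => f w * matrix_coef x y w))%C.
Proof.
intros hf ns; unfold cauchy_integral.
transitivity (/ two_pi_i * inner (sum_arcs (fun a : arc => RInt (V := operator_CompleteNormedModule)
    (fun t => op_scal (f (arc_fun a t) * arc_der a t) (resolvent T (arc_fun a t))) 0 1) G x) y)%C.
  exact (inner_scal_l H _ _ _).
f_equal; unfold sum_arcs; revert hf ns.
induction (concat G) as [|a L IH]; intros hf ns; simpl.
- transitivity (Cconj (inner y (zero : H))); [exact (inner_conj H y zero)|].
  rewrite inner_zero_r; apply Cconj_R.
- rewrite <- IH; [|eapply cont_on_tail; eassumption|intros z hz; apply ns, on_arcs_tail, hz].
  etransitivity; [exact (inner_plus_l H _ _ y)|]; apply (f_equal2 Cplus); [|reflexivity].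
  symmetry; apply CRInt_unique.
  apply (is_RInt_ext (V := C_R_NormedModule) (fun t => inner
    (op_scal (f (arc_fun a t) * arc_der a t) (resolvent T (arc_fun a t)) x) y)).
    intros t _; etransitivity; [exact (inner_scal_l H _ _ _)|].
    unfold matrix_coef; match goal with |- ?u = ?v => change (@eq C u v) end; ring.
  apply (is_RInt_linear (U := operator_NormedModule) (V := C_R_NormedModule)
    (fun A : operator H => inner (A x) y)); [apply inner_linear|].
  apply (RInt_correct (V := operator_CompleteNormedModule)).
  apply (ex_RInt_continuous (V := operator_CompleteNormedModule)); intros t ht.
  apply unit_interval in ht.
  apply (resolvent_integrand_continuous (fun t => f (arc_fun a t) * arc_der a t)%C (arc_fun a)).
  + exact (integrand_rcont a L f t hf ht).
  + apply arc_rcont.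
  + apply ns, on_arcs_head, ht.
Qed.

Lemma cauchy_integral_bound (G : list (list arc)) :
  (forall z, on_arcs (concat G) z -> ~ spectrum T z) ->
  exists K, 0 <= K /\ forall f M, 0 <= M -> cont_on (concat G) f ->
    (forall z, on_arcs (concat G) z -> Cmod (f z) <= M) ->
    opnorm (cauchy_integral G T f) <= K * M.
Proof.
intros ns.
destruct (line_int_bound (concat G)) as [B [B0 HB]].
destruct (cont_on_bounded (concat G) (fun w => RtoC (opnorm (resolvent T w)))) as [N [N0 HN]].
  intros z hz; apply ccontP; intros e e0.
  destruct (resolvent_lipschitz T z (ns z hz)) as [d [M [d0 [M0 HM]]]].
  assert (p : 0 < e / (M + 1)) by (apply Rdiv_lt_0_compat; lra).
  exists (Rmin d (e / (M + 1))); split; [now apply Rmin_glb_lt|]; intros w hw.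
  destruct (HM w (Rlt_le_trans _ _ _ hw (Rmin_l _ _))) as [_ [_ k]].
  assert (h2 := Rlt_le_trans _ _ _ hw (Rmin_r _ _)).
  rewrite <- RtoC_minus, Cmod_R.
  apply Rle_lt_trans with (opnorm (minus (resolvent T w) (resolvent T z))).
  - apply (norm_triangle_inv (K := R_AbsRing) (V := operator_NormedModule) (resolvent T w) (resolvent T z)).
  - apply Rle_lt_trans with (1 := k).
    assert (c := Cmod_ge_0 (w - z)).
    apply (Rmult_lt_compat_r (M + 1)) in h2; [|lra].
    replace (e / (M + 1) * (M + 1)) with e in h2 by (field; lra).
    destruct (Rle_lt_or_eq_dec _ _ c) as [c1|c1]; [nra|rewrite <- c1; lra].
assert (pi := PI_RGT_0).
exists (/ (2 * PI) * B * N); split.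
  repeat apply Rmult_le_pos; try assumption; left; apply Rinv_0_lt_compat; lra.
intros f M M0 hf hM.
assert (i0 : 0 <= / (2 * PI)) by (left; apply Rinv_0_lt_compat; lra).
apply opnorm_le_inner; [repeat apply Rmult_le_pos; assumption|]; intros x y.
rewrite inner_cauchy_integral by assumption.
rewrite Cmod_mult, Cmod_inv, Cmod_two_pi_i by apply two_pi_i_neq0.
replace (/ (2 * PI) * B * N * M * norm x * norm y) with
  (/ (2 * PI) * (B * (M * (N * norm x * norm y)))) by ring.
assert (nx := norm_ge_0 x); assert (ny := norm_ge_0 y).
assert (q : 0 <= N * norm x * norm y) by (repeat apply Rmult_le_pos; assumption).
apply Rmult_le_compat_l; [exact i0|]; apply HB; [now apply Rmult_le_pos| |].
- intros w hw; apply ccont_mult; [now apply hf|apply cdiff_cont, matrix_coef_diff, ns, hw].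
- intros w hw; rewrite Cmod_mult; apply Rmult_le_compat; try apply Cmod_ge_0; [now apply hM|].
  apply Rle_trans with (1 := matrix_coef_bound x y w).
  apply Rmult_le_compat_r; [exact ny|]; apply Rmult_le_compat_r; [exact nx|].
  assert (k := HN w hw); rewrite Cmod_R in k; apply Rle_trans with (2 := k), Rle_abs.
Qed.

Section Multiplicative.

Variables (U : C -> Prop) (G : list (list arc)).
Hypothesis U_open : is_open U.
Hypothesis U_bounded : Cbounded U.
Hypothesis G_closed : forall p, In p G -> closed_path p.
Hypothesis G_in : forall z, on_arcs (concat G) z -> U z.
Hypothesis G_off : forall z, on_arcs (concat G) z -> ~ spectrum T z.
Hypothesis index_out : forall z, ~ U z ->
  cauchy_transform (concat G) (fun _ => RtoC 1) z = RtoC 0.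
Hypothesis index_spec : forall z, spectrum T z ->
  cauchy_transform (concat G) (fun _ => RtoC 1) z = two_pi_i.

Lemma holo_cont_on (f : C -> C) : holo U f -> cont_on (concat G) f.
Proof. intros hf w hw; apply cdiff_cont, hf, G_in, hw. Qed.

Lemma matrix_coef_cont_on (x y : H) : cont_on (concat G) (matrix_coef x y).
Proof. intros w hw; apply cdiff_cont, matrix_coef_diff, G_off, hw. Qed.

(** Moving [R(w)] inside the integral through its adjoint, [R(w) R(u)] is split
    by the resolvent identity into [(R(w) - R(u)) / (u - w)]. *)
Lemma resolvent_calc_off (f : C -> C) (x y : H) (w : C) : holo U f ->
  ~ spectrum T w -> ~ on_arcs (concat G) w ->
  inner (resolvent T w (cauchy_integral G T f x)) y =
    (/ two_pi_i * (matrix_coef x y w * cauchy_transform (concat G) f w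
       - cauchy_transform (concat G) (fun u => f u * matrix_coef x y u) w))%C.
Proof.
intros hf nw noff.
assert (cf := holo_cont_on f hf); assert (cl := matrix_coef_cont_on x y).
assert (k1 : cont_on (concat G) (fun u => f u / (u - w))%C) by now apply cauchy_kernel_cont.
assert (k2 : cont_on (concat G) (fun u => f u * matrix_coef x y u / (u - w))%C).
  apply cauchy_kernel_cont; [|exact noff].
  intros u hu; apply ccont_mult; [now apply cf|now apply cl].
rewrite adjointP, inner_cauchy_integral by assumption; f_equal.
unfold cauchy_transform; rewrite <- line_int_scal, <- line_int_minus; try assumption.
- apply line_int_ext; intros u hu.
  assert (ne : u <> w) by (intros ->; exact (noff hu)).
  assert (n := Cminus_neq0 _ _ ne).
  unfold matrix_coef at 1; rewrite <- adjointP.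
  assert (e : matrix_coef x y w = (matrix_coef x y u + (u - w) * inner (resolvent T w (resolvent T u x)) y)%C).
    unfold matrix_coef at 1; rewrite (resolvent_identity T w u x nw (G_off u hu)).
    rewrite inner_plus_l, inner_scal_l; reflexivity.
  rewrite e; field; exact n.
- intros u hu; apply ccont_mult; [apply ccont_const|now apply k1].
Qed.

(** On the spectrum the extension is defined by the Cauchy transform of [f <R x,
    y>]. The two definitions agree near the spectrum because there the winding
    number is one and the Cauchy transform of [f] is [2 pi i f]. *)
Lemma quotient_extends (f : C -> C) (x y : H) : holo U f -> exists V, holo U V /\
  forall w, ~ spectrum T w -> V w =
    (inner (resolvent T w (cauchy_integral G T f x)) y - f w * matrix_coef x y w)%C.
Proof.
intros hf.
set (V0 := fun w => (matrix_coef (cauchy_integral G T f x) y w - f w * matrix_coef x y w)%C).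
set (V1 := fun w => (- / two_pi_i * cauchy_transform (concat G) (fun u => f u * matrix_coef x y u) w)%C).
set (V := fun w => if excluded_middle_informative (spectrum T w) then V1 w else V0 w).
assert (Voff : forall w, ~ spectrum T w -> V w = V0 w).
  intros w hw; unfold V; destruct (excluded_middle_informative (spectrum T w)); [contradiction|reflexivity].
assert (cm : cont_on (concat G) (fun u => f u * matrix_coef x y u)%C).
  intros u hu; apply ccont_mult; [now apply holo_cont_on|now apply matrix_coef_cont_on].
exists V; split; [|exact Voff].
intros z hz; destruct (classic (spectrum T z)) as [sz|nz].
- assert (noz : ~ on_arcs (concat G) z) by (intros oz; exact (G_off z oz sz)).
  destruct (not_on_arcs_open _ z noz) as [d1 [d10 H1]].
  destruct (U_open z hz) as [d2 [d20 H2]].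
  apply (cdiff_ext_near V1 V z (Rmin d1 d2)); [now apply Rmin_glb_lt| |].
  + intros w hw.
    assert (w1 := Rlt_le_trans _ _ _ hw (Rmin_l _ _)).
    assert (w2 := Rlt_le_trans _ _ _ hw (Rmin_r _ _)).
    unfold V; destruct (excluded_middle_informative (spectrum T w)) as [sw|nw]; [reflexivity|].
    unfold V0, matrix_coef at 1; rewrite resolvent_calc_off by auto.
    destruct (cauchy_dixon U G f U_open U_bounded G_closed G_in index_out hf) as [_ cd].
    rewrite cd, (index_locally_const G z d1 G_closed H1 w w1), index_spec by auto.
    unfold V1; field; apply two_pi_i_neq0.
  + apply cdiff_mult; [apply cdiff_const|]; eexists; now apply cauchy_transform_derive.
- destruct (resolvent_locally_bounded T z nz) as [d [d0 Hd]].
  apply (cdiff_ext_near V0 V z d d0).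
    intros w hw; symmetry; apply Voff, Hd, hw.
  apply cdiff_minus; [now apply matrix_coef_diff|].
  apply cdiff_mult; [now apply hf|now apply matrix_coef_diff].
Qed.

Lemma cauchy_integral_mult (f g : C -> C) : holo U f -> holo U g ->
  cauchy_integral G T (fun w => g w * f w)%C =
  op_comp (cauchy_integral G T g) (cauchy_integral G T f).
Proof.
intros hf hg; apply operator_eq; intros x; apply inner_ext; intros y.
rewrite (inner_conj H _ y), (inner_conj H (op_comp _ _ x) y); f_equal.
change (op_comp (cauchy_integral G T g) (cauchy_integral G T f) x)
  with (cauchy_integral G T g (cauchy_integral G T f x)).
assert (cf := holo_cont_on f hf); assert (cg := holo_cont_on g hg).
rewrite !inner_cauchy_integral; try assumption;
  [|intros u hu; apply ccont_mult; [now apply cg|now apply cf]].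
f_equal.
destruct (quotient_extends f x y hf) as [V [hV eV]].
assert (I : line_int (concat G) (fun w => g w * V w)%C = RtoC 0).
  apply (global_cauchy U); try assumption.
  intros w hw; apply cdiff_mult; [now apply hg|now apply hV].
set (z := cauchy_integral G T f x) in *.
rewrite (line_int_ext _ (fun w => g w * matrix_coef z y w)%C
  (fun w => g w * V w + g w * f w * matrix_coef x y w)%C).
- rewrite line_int_plus, I; [ring| |].
  + intros u hu; apply ccont_mult; [now apply cg|now apply holo_cont_on].
  + intros u hu; apply ccont_mult; [apply ccont_mult; [now apply cg|now apply cf]|].
    now apply matrix_coef_cont_on.
- intros w hw; rewrite eV by now apply G_off.
  unfold matrix_coef at 1; ring.
Qed.

End Multiplicative.

End Calculus.

(** * The Crouzeix-Palencia estimate *)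

Lemma open_is_open (U : C -> Prop) : open U -> is_open U.
Proof. intros op z hz; apply locally_Cmod, op, hz. Qed.

(** Bounded closed sets of the plane are compact; here this is used through
    [bisection]. *)
Lemma holo_alg_bounded (Omega : C -> Prop) (f : C -> C) :
  Cbounded Omega -> holo_alg Omega f -> exists M, forall z, Omega z -> Cmod (f z) <= M.
Proof.
intros [B HB] [fc _].
set (S := Rabs B + 1); assert (S0 : 0 < S) by (assert (k := Rabs_pos B); unfold S; lra).
set (P := fun x y l => exists M, forall z, Omega z ->
  x <= fst z <= x + l * (2 * S) -> y <= snd z <= y + l * (2 * S) -> Cmod (f z) <= M).
assert (main : P (- S) (- S) 1).
  apply (bisection P (2 * S) (2 * S)); try lra.
  - intros x y l l0 [M1 q1] [M2 q2] [M3 q3] [M4 q4].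
    exists (Rmax (Rmax M1 M2) (Rmax M3 M4)); intros z hz hx hy.
    destruct (Rle_dec (fst z) (x + l / 2 * (2 * S))) as [a|a];
      destruct (Rle_dec (snd z) (y + l / 2 * (2 * S))) as [b|b].
    + apply Rle_trans with M1; [apply q1; auto; lra|].
      apply Rle_trans with (2 := Rmax_l _ _), Rmax_l.
    + apply Rle_trans with M3; [apply q3; auto; lra|].
      apply Rle_trans with (2 := Rmax_r _ _), Rmax_l.
    + apply Rle_trans with M2; [apply q2; auto; lra|].
      apply Rle_trans with (2 := Rmax_l _ _), Rmax_r.
    + apply Rle_trans with M4; [apply q4; auto; lra|].
      apply Rle_trans with (2 := Rmax_r _ _), Rmax_r.
  - intros u v _ _.
    assert (loc : exists d M, 0 < d /\ forall z, Omega z -> Cmod (z - (u, v)) < d -> Cmod (f z) <= M).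
      destruct (classic (Cclosure Omega (u, v))) as [cl|ncl].
      + assert (c := fc _ cl).
        assert (N : locally (T := C_UniformSpace) (f (u, v)) (fun w => Cmod (w - f (u, v)) < 1)).
          apply locally_Cmod; exists 1; split; [lra|auto].
        apply c in N.
        destruct (proj1 (locally_Cmod _ _) N) as [d [d0 Hd]].
        exists d, (Cmod (f (u, v)) + 1); split; [exact d0|]; intros z hz dz.
        assert (cz : Cclosure Omega z).
          intros e; exists z; split; [exact hz|].
          replace (z - z)%C with (RtoC 0) by ring; rewrite Cmod_0; apply cond_pos.
        assert (k := Hd z dz cz); assert (t := Cmod_triangle_inv (f z) (f (u, v))).
        apply Rabs_le_between in t; lra.
      + apply not_all_ex_not in ncl; destruct ncl as [e he].
        exists e, 0; split; [apply cond_pos|]; intros z hz dz.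
        destruct he; exists z; split; assumption.
    destruct loc as [d [M [d0 HM]]].
    exists (d / (4 * S)); split; [apply Rdiv_lt_0_compat; lra|].
    intros x y l hl hx hy; exists M; intros z hz zx zy; apply HM; [exact hz|].
    assert (k : l * (4 * S) < d).
      apply Rmult_lt_reg_r with (/ (4 * S)); [apply Rinv_0_lt_compat; lra|].
      rewrite Rmult_assoc, Rinv_r by lra; unfold Rdiv in hl; lra.
    rewrite (surjective_pairing (z - (u, v))%C).
    apply Rle_lt_trans with (1 := Cmod_le_sum _ _); simpl.
    assert (Rabs (fst z + - u) <= l * (2 * S)) by (apply Rabs_le; lra).
    assert (Rabs (snd z + - v) <= l * (2 * S)) by (apply Rabs_le; lra).
    lra.
destruct main as [M HM]; exists M; intros z hz.
assert (k := HB z hz); assert (b := Rle_abs B).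
assert (k1 := Rabs_fst_le z); assert (k2 := Rabs_snd_le z).
assert (k3 : - S <= fst z <= S) by (apply Rabs_le_between; unfold S; lra).
assert (k4 : - S <= snd z <= S) by (apply Rabs_le_between; unfold S; lra).
apply HM; auto; lra.
Qed.

Lemma supnorm_ub (Omega : C -> Prop) (f : C -> C) (z : C) :
  Cbounded Omega -> holo_alg Omega f -> Omega z -> Cmod (f z) <= supnorm Omega f.
Proof.
intros bO hf hz; destruct (holo_alg_bounded Omega f bO hf) as [M HM].
apply (sup_ub _ M); [|now exists z].
intros r [w [hw ->]]; now apply HM.
Qed.

(** For empty [Omega] the supremum in the extended reals is minus infinity,
    whose real part is zero. *)
Lemma supnorm_ge0 (Omega : C -> Prop) (f : C -> C) :
  Cbounded Omega -> holo_alg Omega f -> 0 <= supnorm Omega f.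
Proof.
intros bO hf; destruct (classic (exists z, Omega z)) as [[z hz]|no].
- apply Rle_trans with (1 := Cmod_ge_0 (f z)); now apply supnorm_ub.
- unfold supnorm, sup.
  assert (h := proj2 (Lub_Rbar_correct (fun r => exists z, Omega z /\ r = Cmod (f z))) m_infty).
  destruct (Lub_Rbar _) as [r| |]; simpl; try lra.
  exfalso; apply h; intros r' [z [hz _]]; apply no; now exists z.
Qed.

Lemma supnorm_le (Omega : C -> Prop) (f : C -> C) (M : R) :
  0 <= M -> (forall z, Omega z -> Cmod (f z) <= M) -> supnorm Omega f <= M.
Proof. intros M0 h; apply sup_le; [exact M0|]; intros r [z [hz ->]]; now apply h. Qed.

Lemma holo_alg_mult (Omega : C -> Prop) (f g : C -> C) :
  holo_alg Omega f -> holo_alg Omega g -> holo_alg Omega (fun z => f z * g z)%C.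
Proof.
intros [fc fd] [gc gd]; split.
- intros z hz; apply filterlim_Cmult; [apply within_filter, _|now apply fc|now apply gc].
- intros z hz; apply cdiff_mult; auto.
Qed.

Lemma on_arcs_trace (G : list (list arc)) (z : C) : on_arcs (concat G) z -> trace G z.
Proof.
intros [a [t [ha ht]]]; apply in_concat in ha; destruct ha as [p [hp ha]].
now exists p, a, t.
Qed.

Lemma winding_cauchy_transform (G : list (list arc)) (z : C) :
  cauchy_transform (concat G) (fun _ => RtoC 1) z = (two_pi_i * winding G z)%C.
Proof.
unfold winding; fold two_pi_i; rewrite Cmult_assoc, Cinv_r by apply two_pi_i_neq0.
rewrite Cmult_1_l; unfold cauchy_transform, sum_arcs.
induction (concat G) as [|a L IH]; simpl; [reflexivity|].
apply (f_equal2 Cplus); [|exact IH].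
apply (CRInt_ext _ _ 0 1); intros t _; unfold Cdiv; ring.
Qed.

Lemma pow4_le (a b : R) : 0 <= b -> a ^ 4 <= b ^ 4 -> a <= b.
Proof.
intros b0 h; destruct (Rle_or_lt a b) as [l|l]; [exact l|].
assert (k : b ^ 2 < a ^ 2) by nra.
assert (b ^ 4 < a ^ 4); [|lra].
replace (b ^ 4) with (b ^ 2 * b ^ 2) by ring; replace (a ^ 4) with (a ^ 2 * a ^ 2) by ring.
assert (b2 := pow2_ge_0 b); nra.
Qed.

Lemma fourth_root (b : R) : 0 <= b -> exists c, 0 <= c /\ c ^ 4 = b.
Proof.
intros b0; exists (sqrt (sqrt b)); split; [apply sqrt_pos|].
replace (sqrt (sqrt b) ^ 4) with
  ((sqrt (sqrt b) * sqrt (sqrt b)) * (sqrt (sqrt b) * sqrt (sqrt b))) by ring.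
rewrite !sqrt_sqrt by (apply sqrt_pos || exact b0); reflexivity.
Qed.

Lemma quartic_nonneg (k : R) : 0 <= k -> 0 <= 2 * k ^ 3 + k ^ 2.
Proof. intros k0; assert (h2 := pow_le k 2 k0); assert (h3 := pow_le k 3 k0); lra. Qed.

Lemma quartic_bound (k : R) : 0 <= k -> k ^ 4 <= 2 * k ^ 3 + k ^ 2 -> k <= 1 + sqrt 2.
Proof.
intros k0 h; assert (q := sqrt_pos 2); assert (q2 := sqrt_sqrt 2 ltac:(lra)).
destruct (Rle_or_lt k (1 + sqrt 2)) as [l|l]; [exact l|].
assert (p : 0 < k ^ 2 - 2 * k - 1) by nra.
assert (p2 : 0 < k ^ 2) by nra.
assert (pp := Rmult_lt_0_compat _ _ p2 p).
replace (k ^ 2 * (k ^ 2 - 2 * k - 1)) with (k ^ 4 - 2 * k ^ 3 - k ^ 2) in pp by ring; lra.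
Qed.

(** The infimum [k] of the admissible constants is admissible. By hypothesis so
    is the fourth root of [2 k^3 + k^2], whence [k^4 <= 2 k^3 + k^2]. *)
Lemma bootstrap_bound {X : Type} (A : X -> Prop) (n s : X -> R) :
  (forall x, A x -> 0 <= s x) ->
  (exists k, 0 <= k /\ forall x, A x -> n x <= k * s x) ->
  (forall k, 0 <= k -> (forall x, A x -> n x <= k * s x) ->
     forall x, A x -> n x ^ 4 <= (2 * k ^ 3 + k ^ 2) * s x ^ 4) ->
  forall x, A x -> n x <= (1 + sqrt 2) * s x.
Proof.
intros s0 [k1 hk1] improve.
set (adm := fun k => 0 <= k /\ forall x, A x -> n x <= k * s x).
destruct (completeness (fun r => adm (- r))) as [m [m1 m2]].
- exists 0; intros r [h _]; lra.
- exists (- k1); rewrite Ropp_involutive; exact hk1.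
- set (k := - m).
  assert (lower : forall j, adm j -> k <= j).
    intros j hj; assert (h : - j <= m) by (apply m1; rewrite Ropp_involutive; exact hj).
    unfold k; lra.
  assert (approx : forall e, 0 < e -> exists j, adm j /\ j < k + e).
    intros e e0; apply NNPP; intros no.
    assert (h : m <= m - e); [|lra].
    apply m2; intros r hr; destruct (Rle_or_lt r (m - e)) as [l|l]; [exact l|].
    destruct no; exists (- r); split; [exact hr|unfold k; lra].
  assert (k0 : 0 <= k).
    apply le_epsilon; intros e e0; destruct (approx e e0) as [j [[j0 _] hj]]; lra.
  assert (adm_k : forall x, A x -> n x <= k * s x).
    intros x hx; assert (n0 := s0 x hx).
    apply le_epsilon; intros e e0.
    destruct (approx (e / (s x + 1)) ltac:(apply Rdiv_lt_0_compat; lra)) as [j [[j0 Hj] hj]].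
    apply Rle_trans with (1 := Hj x hx).
    apply Rle_trans with ((k + e / (s x + 1)) * s x).
      apply Rmult_le_compat_r; lra.
    rewrite Rmult_plus_distr_r; apply Rplus_le_compat_l.
    apply Rmult_le_reg_r with (s x + 1); [lra|].
    replace (e / (s x + 1) * s x * (s x + 1)) with (e * s x) by (field; lra); nra.
  destruct (fourth_root _ (quartic_nonneg k k0)) as [c [c0 c4]].
  assert (kc : k <= c).
    apply lower; split; [exact c0|]; intros x hx; apply pow4_le.
      apply Rmult_le_pos; [exact c0|now apply s0].
    rewrite Rpow_mult_distr, c4; now apply improve.
  intros x hx; apply Rle_trans with (1 := adm_k x hx), Rmult_le_compat_r; [now apply s0|].
  apply quartic_bound; [exact k0|]; rewrite <- c4; apply pow_incr; now split.
Qed.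

(** With [w = F x] and [v] the image of [w] under the adjoint of [F], estimate
    [|v|^2 = <S v, w> - <v, G w>] where [S = F + G'], and use [|w|^2 = <x, v>].
    *)
Lemma crouzeix_palencia {H : HilbertSpace} (F G P : operator H) (k s : R) :
  0 <= k -> 0 <= s -> opnorm F <= k * s ->
  opnorm (plus F (adjoint G)) <= 2 * s ->
  op_comp F (op_comp G F) = P -> opnorm P <= k * s ^ 3 ->
  opnorm F ^ 4 <= (2 * k ^ 3 + k ^ 2) * s ^ 4.
Proof.
intros k0 s0 hF hS hP hPn.
assert (main : forall x, norm (F x) ^ 4 <= (2 * k ^ 3 + k ^ 2) * s ^ 4 * norm x ^ 4).
  intros x; set (n := norm x); set (w := F x); set (v := adjoint F w).
  assert (n0 : 0 <= n) by apply norm_ge_0.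
  assert (w0 : 0 <= norm w) by apply norm_ge_0; assert (v0 : 0 <= norm v) by apply norm_ge_0.
  assert (ks : 0 <= k * s) by now apply Rmult_le_pos.
  assert (hw : norm w <= k * s * n).
    apply Rle_trans with (1 := opnorm_ub F x); now apply Rmult_le_compat_r.
  assert (hv : norm v <= k * s * norm w).
    apply Rle_trans with (1 := opnorm_ub (adjoint F) w); apply Rmult_le_compat_r; [exact w0|].
    apply Rle_trans with (1 := opnorm_adjoint_le F), hF.
  assert (sq_w : norm w ^ 2 <= n * norm v).
    apply Rle_trans with (Cmod (inner x v)); [|exact (cauchy_schwarz x v)].
    unfold v; rewrite <- adjointP; fold w; rewrite inner_norm, Cmod_R; apply Rle_abs.
  set (S := plus F (adjoint G)) in *.
  assert (split : inner v v = (inner (S v) w - inner v (G w))%C).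
    assert (e1 : inner (S v) w = (inner (F v) w + inner (adjoint G v) w)%C)
      by exact (inner_plus_l H (F v) (adjoint G v) w).
    assert (e2 : inner (adjoint G v) w = inner v (G w)).
      rewrite inner_conj, <- adjointP, <- inner_conj; reflexivity.
    rewrite e1, e2, (adjointP F v w); fold v; ring.
  assert (term1 : Cmod (inner (S v) w) <= 2 * k ^ 3 * s ^ 4 * n ^ 2).
    apply Rle_trans with (1 := cauchy_schwarz _ _).
    apply Rle_trans with (2 * s * (k * s * (k * s * n)) * (k * s * n)); [|right; ring].
    apply Rmult_le_compat; [apply norm_ge_0|exact w0| |exact hw].
    apply Rle_trans with (1 := opnorm_ub S v).
    apply Rmult_le_compat; [apply opnorm_ge0|exact v0|exact hS|].
    apply Rle_trans with (1 := hv); now apply Rmult_le_compat_l.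
  assert (term2 : Cmod (inner v (G w)) <= k ^ 2 * s ^ 4 * n ^ 2).
    rewrite inner_conj, Cmod_conj; unfold v; rewrite <- adjointP.
    change (F (G w)) with (op_comp F (op_comp G F) x); rewrite hP.
    apply Rle_trans with (1 := cauchy_schwarz _ _).
    apply Rle_trans with (k * s ^ 3 * n * (k * s * n)); [|right; ring].
    apply Rmult_le_compat; [apply norm_ge_0|exact w0| |exact hw].
    apply Rle_trans with (1 := opnorm_ub P x); now apply Rmult_le_compat_r.
  assert (sq_v : norm v ^ 2 <= (2 * k ^ 3 + k ^ 2) * s ^ 4 * n ^ 2).
    assert (e : norm v ^ 2 = Cmod (inner v v)).
      rewrite inner_norm, Cmod_R, Rabs_pos_eq; [reflexivity|apply pow2_ge_0].
    rewrite e, split; unfold Cminus; apply Rle_trans with (1 := Cmod_triangle _ _).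
    rewrite Cmod_opp; lra.
  apply Rle_trans with ((n * norm v) ^ 2).
  - replace (norm w ^ 4) with ((norm w ^ 2) ^ 2) by ring.
    apply pow_incr; split; [apply pow2_ge_0|exact sq_w].
  - rewrite Rpow_mult_distr.
    replace ((2 * k ^ 3 + k ^ 2) * s ^ 4 * n ^ 4) with
      (n ^ 2 * ((2 * k ^ 3 + k ^ 2) * s ^ 4 * n ^ 2)) by ring.
    apply Rmult_le_compat_l; [apply pow2_ge_0|exact sq_v].
destruct (fourth_root _ (quartic_nonneg k k0)) as [c [c0 c4]].
rewrite <- c4, <- Rpow_mult_distr; apply pow_incr; split; [apply opnorm_ge0|].
apply opnorm_le; [now apply Rmult_le_pos|]; intros x; apply pow4_le.
  apply Rmult_le_pos; [now apply Rmult_le_pos|apply norm_ge_0].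
rewrite !Rpow_mult_distr, c4; apply main.
Qed.

Lemma cauchy_integral_nil {E : CompleteNormedModule C_AbsRing} (T : operator E) (f : C -> C) :
  opnorm (cauchy_integral nil T f) = 0.
Proof.
apply Rle_antisym; [|apply opnorm_ge0].
apply Rle_trans with (1 := opnorm_op_scal _ _).
rewrite <- (Rmult_0_r (Cmod (/ (RtoC (2 * PI) * Ci)))).
apply Rmult_le_compat_l; [apply Cmod_ge_0|right; exact opnorm_zero].
Qed.

Theorem lemma1p1 (H : HilbertSpace) (T : operator H) (Omega : C -> Prop)
    (Omega_open : open Omega) (Omega_bounded : Cbounded Omega)
    (spectrum_in : forall z : C, spectrum T z -> Omega z)
    (hyp : forall f : C -> C, holo_alg Omega f ->
       exists g : C -> C, holo_alg Omega g /\
         supnorm Omega g <= supnorm Omega f /\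
         opnorm (plus (holo_calc Omega T f) (adjoint (holo_calc Omega T g)))
           <= 2 * supnorm Omega f) :
  forall f : C -> C, holo_alg Omega f ->
    opnorm (holo_calc Omega T f) <= (1 + sqrt 2) * supnorm Omega f.
Proof.
unfold holo_calc in *.
set (G := choose_or nil (surrounds Omega (spectrum T))) in *.
set (Phi := cauchy_integral G T) in *.
destruct (classic (exists G, surrounds Omega (spectrum T) G)) as [ex|none].
2:{ intros f hf; apply Rle_trans with 0.
    - unfold Phi, G, choose_or.
      destruct (excluded_middle_informative _) as [e|_]; [contradiction|].
      right; apply cauchy_integral_nil.
    - assert (q := sqrt_pos 2).
      apply Rmult_le_pos; [lra|now apply supnorm_ge0]. }
destruct (choose_or_spec nil _ ex) as [cl [tr [ispec iout]]]; fold G in cl, tr, ispec, iout.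
assert (op := open_is_open Omega Omega_open).
assert (Gin : forall z, on_arcs (concat G) z -> Omega z) by (intros z oz; apply tr, on_arcs_trace, oz).
assert (Goff : forall z, on_arcs (concat G) z -> ~ spectrum T z)
  by (intros z oz; apply tr, on_arcs_trace, oz).
assert (out' : forall z, ~ Omega z -> cauchy_transform (concat G) (fun _ => RtoC 1) z = RtoC 0)
  by (intros z hz; rewrite winding_cauchy_transform, iout by exact hz; ring).
assert (spec' : forall z, spectrum T z -> cauchy_transform (concat G) (fun _ => RtoC 1) z = two_pi_i)
  by (intros z hz; rewrite winding_cauchy_transform, ispec by exact hz; ring).
assert (mult : forall f g, holo_alg Omega f -> holo_alg Omega g ->
    Phi (fun w => g w * f w)%C = op_comp (Phi g) (Phi f)).
  intros f g [_ hf] [_ hg]; now apply (cauchy_integral_mult T Omega).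
apply (bootstrap_bound (holo_alg Omega) (fun f => opnorm (Phi f)) (supnorm Omega)).
- intros f hf; now apply supnorm_ge0.
- destruct (cauchy_integral_bound T G Goff) as [K [K0 HK]].
  exists K; split; [exact K0|]; intros f hf; apply HK.
  + now apply supnorm_ge0.
  + apply (holo_cont_on Omega); [exact Gin|exact (proj2 hf)].
  + intros z oz; apply supnorm_ub; auto.
- intros k k0 hk f hf.
  destruct (hyp f hf) as [g [hg [gf hS]]].
  assert (n0 := supnorm_ge0 Omega f Omega_bounded hf).
  assert (hgf := holo_alg_mult Omega g f hg hf).
  assert (hfgf := holo_alg_mult Omega f _ hf hgf).
  apply (crouzeix_palencia (Phi f) (Phi g) (Phi (fun w => f w * (g w * f w))%C));
    [exact k0|exact n0|now apply hk|exact hS| |].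
  + rewrite (mult _ f hgf hf), (mult f g hf hg); reflexivity.
  + apply Rle_trans with (1 := hk _ hfgf), Rmult_le_compat_l; [exact k0|].
    apply supnorm_le; [now apply pow_le|]; intros z hz; rewrite !Cmod_mult.
    assert (kf := supnorm_ub Omega f z Omega_bounded hf hz).
    assert (kg := supnorm_ub Omega g z Omega_bounded hg hz).
    assert (f0 := Cmod_ge_0 (f z)); assert (g0 := Cmod_ge_0 (g z)).
    replace (supnorm Omega f ^ 3) with
      (supnorm Omega f * (supnorm Omega f * supnorm Omega f)) by ring.
    repeat apply Rmult_le_compat; try lra.
    now apply Rmult_le_pos.
Qed.
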